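(* Let $m,n$ be nonnegative integers (not both zero) and let $T(z)=\partial_z+\widehat E(z)$, where $\widehat E(z)=\big[e_{ij}(z)(-1)^{\bar\imath}\big]_{1\le i,j\le m+n}$ and $\partial_z$ is understood as a scalar matrix of size $m+n$. All Fourier coefficients of the fields $s_{kl}(z)$, $b_{kl}(z)$, $\sigma_{kl}(z)$ and $h_{kl}(z)$ defined by the decompositions $$:\mathrm{str}\,T(z)^k:\;=s_{k0}(z)\,\partial_z^k+s_{k1}(z)\,\partial_z^{k-1}+\dots+s_{kk}(z),$$ $$:\mathrm{Ber}\big(1+u\,T(z)\big):\;=\sum_{k=0}^\infty\sum_{l=0}^kb_{kl}(z)\,u^k\partial_z^{k-l},$$ $$:\mathrm{str}_{1,\dots,k}\,A_kT_1(z)\cdots T_k(z):\;=\sigma_{k0}(z)\,\partial_z^k+\sigma_{k1}(z)\,\partial_z^{k-1}+\dots+\sigma_{kk}(z),$$ $$:\mathrm{str}_{1,\dots,k}\,H_kT_1(z)\cdots T_k(z):\;=h_{k0}(z)\,\partial_z^k+h_{k1}(z)\,\partial_z^{k-1}+\dots+h_{kk}(z)$$ are Sugawara operators for $\widehat{\mathfrak{gl}}_{m|n}$. Moreover, $\sigma_{kl}(z)=b_{kl}(z)$ for all $k$ and $l$.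
   Context: The base field is $\mathbb C$. For $1\le i\le m+n$ set $\bar\imath=0$ if $i\le m$ and $\bar\imath=1$ if $i\ge m+1$; $e_{ij}$ denotes the standard basis element of $\mathfrak{gl}_{m|n}$ (or matrix unit in $\mathrm{End}\,\mathbb C^{m|n}$), of parity $\bar\imath+\bar\jmath$, and $e_{ij}[r]=e_{ij}t^r$. The affine Lie superalgebra $\widehat{\mathfrak{gl}}_{m|n}=\mathfrak{gl}_{m|n}[t,t^{-1}]\oplus\mathbb CK$ has even central element $K$ and relations $$[e_{ij}[r],e_{kl}[s]]=\delta_{kj}e_{il}[r+s]-\delta_{il}e_{kj}[r+s](-1)^{(\bar\imath+\bar\jmath)(\bar k+\bar l)}+K\Big(\delta_{kj}\delta_{il}(-1)^{\bar\imath}-\frac{\delta_{ij}\delta_{kl}}{m-n}(-1)^{\bar\imath+\bar k}\Big)r\,\delta_{r,-s}$$ for $m\ne n$. To treat all $m,n$ uniformly the central element is rescaled by $K=K'(n-m)$, so that the last term reads $K'\big((n-m)\delta_{kj}\delta_{il}(-1)^{\bar\imath}+\delta_{ij}\delta_{kl}(-1)^{\bar\imath+\bar k}\big)r\,\delta_{r,-s}$; for $m=n$ the central element is $K'$. The affine vertex algebra at the critical level, $V=V_{n-m}(\mathfrak{gl}_{m|n})$, is the quotient of $\mathrm U(\widehat{\mathfrak{gl}}_{m|n})$ by the left ideal generated by $\mathfrak{gl}_{m|n}[t]$ and $K-(n-m)$ (in rescaled terms: $K'-1$), identified as a superspace with $\mathrm U(t^{-1}\mathfrak{gl}_{m|n}[t^{-1}])$.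 Its state-field correspondence $Y:V\to\mathrm{End}\,V[[z,z^{-1}]]$ is given by $Y(1,z)=\mathrm{id}$, $Y(e_{ij}[-1],z)=e_{ij}(z):=\sum_{r\in\mathbb Z}e_{ij}[r]z^{-r-1}$, and $Y(e_{i_1j_1}[-r_1-1]\cdots e_{i_pj_p}[-r_p-1],z)=\frac1{r_1!\cdots r_p!}:\partial_z^{r_1}e_{i_1j_1}(z)\cdots\partial_z^{r_p}e_{i_pj_p}(z):$. The normally ordered product of homogeneous fields $a(z)=\sum_ra_{(r)}z^{-r-1}$, $b(w)=\sum_rb_{(r)}w^{-r-1}$ is $:a(z)b(w):=a(z)_+b(w)+(-1)^{\deg a\deg b}b(w)a(z)_-$, with $a(z)_+=\sum_{r<0}a_{(r)}z^{-r-1}$, $a(z)_-=\sum_{r\ge0}a_{(r)}z^{-r-1}$; for several fields normal ordering is read from right to left. The Fourier coefficients of a field are its coefficients of powers of $z$. A Segal–Sugawara vector is an element $b\in V$ with $\mathfrak{gl}_{m|n}[t]\,b=0$. Sugawara operators for $\widehat{\mathfrak{gl}}_{m|n}$ are the Fourier coefficients of the fields $Y(b,z)$ with $b$ a Segal–Sugawara vector; they belong to the center of the local completion $\mathrm U_{n-m}(\widehat{\mathfrak{gl}}_{m|n})_{\mathrm{loc}}$, the Lie superalgebra spanned by all Fourier coefficients of all fields $Y(a,z)$, $a\in V$. $\mathrm{str}\,X=\sum_i(-1)^{\bar\imath}x_{ii}$ for a matrix $X=[x_{ij}]$. Tensor products use the sign rule $(x\otimes y)(x'\otimes y')=(xx'\otimes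 yy')(-1)^{\deg y\deg x'}$. For $1\le a\le k$, $T_a(z)=\sum_{i,j}1^{\otimes(a-1)}\otimes e_{ij}\otimes1^{\otimes(k-a)}\otimes T_{ij}(z)(-1)^{\bar\imath\bar\jmath+\bar\jmath}$, with $T_{ij}(z)=\delta_{ij}\partial_z+(-1)^{\bar\imath}e_{ij}(z)$. The natural action of $\mathfrak S_k$ on $(\mathbb C^{m|n})^{\otimes k}$ represents $\sigma$ by $P_\sigma$, with $(a\,b)$, $a<b$, represented by $P_{ab}=\sum_{i,j}1^{\otimes(a-1)}\otimes e_{ij}\otimes1^{\otimes(b-a-1)}\otimes e_{ji}\otimes1^{\otimes(k-b)}\otimes1\,(-1)^{\bar\jmath}$; $H_k=\frac1{k!}\sum_{\sigma}P_\sigma$, $A_k=\frac1{k!}\sum_\sigma\mathrm{sgn}\,\sigma\,P_\sigma$; $\mathrm{str}_{1,\dots,k}$ sends $e_{i_1j_1}\otimes\dots\otimes e_{i_kj_k}\otimes y$ to $\delta_{i_1j_1}\cdots\delta_{i_kj_k}(-1)^{\bar\imath_1+\dots+\bar\imath_k}y$. For a matrix $X$, $\mathrm{Ber}(1+uX)=\sum_{\sigma\in\mathfrak S_m}\mathrm{sgn}\,\sigma\,x_{\sigma(1)1}\cdots x_{\sigma(m)m}\times\sum_{\rho\in\mathfrak S_n}\mathrm{sgn}\,\rho\,x'_{m+1,m+\rho(1)}\cdots x'_{m+n,m+\rho(n)}$ with $[x_{ij}]=1+uX$, $[x'_{ij}]=(1+uX)^{-1}=\sum_{k\ge0}(-u)^kX^k$.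 Each expression is expanded (in powers of $u$ where $u$ is present) into products of entries of $T(z)$, powers of $\partial_z$ are moved to the right by $\partial_z\,a(z)=a(z)\partial_z+a'(z)$, and the resulting monomials in the $e_{ij}(z)$ and their derivatives are normally ordered. *)

(* Defs.v *)
From HB Require Import structures.
From mathcomp Require Import all_boot all_order all_algebra.
From mathcomp Require Import fingroup perm generic_quotient ring_quotient.
From mathcomp Require Import finmap monalg.
From mathcomp Require Import boolp classical_sets fsbigop.

Set Implicit Arguments.
Unset Strict Implicit.
Unset Printing Implicit Defensive.

Import GRing.Theory.
Local Open Scope ring_scope.
Local Open Scope quotient_scope.

(* The free associative C-algebra on the alphabet X. *)
Definition free_alg (C : fieldType) (X : choiceType) := {malg C[{fmonom X}]}.
HB.instance Definition _ (C : fieldType) (X : choiceType) :=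
  GRing.Lalgebra.on (free_alg C X).

Definition letter (C : fieldType) (X : choiceType) (x : X) : free_alg C X :=
  << fmu x >>.

(* Indices run over 0, ..., m + n - 1; the parity of i is 1 iff m <= i. *)
Definition par (m n : nat) (i : 'I_(m + n)) : bool := (m <= i)%N.

Section Affine.
Variables (C : fieldType) (m n : nat).
Local Notation I := 'I_(m + n).
Local Notation par := (@par m n).

(* Basis of the affine Lie superalgebra: Some (i, j, r) stands for e_ij[r] and *)
(* None for the rescaled central element K'.                                   *)
Definition gen : Type := option (I * I * int).
HB.instance Definition _ := Choice.on gen.

Definition gen_par (x : gen) : bool :=
  if x is Some (i, j, _) then par i (+) par j else false.

Local Notation tensor_alg := (free_alg C gen).
Definition e_ (i j : I) (r : int) : tensor_alg := letter C (Some (i, j, r)).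
Definition K' : tensor_alg := letter C None.

Definition gen_bracket (x y : gen) : tensor_alg :=
  match x, y with
  | Some (i, j, r), Some (k, l, s) =>
      (k == j)%:R *: e_ i l (r + s)
      - ((i == l)%:R * (-1) ^+ ((par i (+) par j) && (par k (+) par l)))
          *: e_ k j (r + s)
      + (((n%:R - m%:R) * (k == j)%:R * (i == l)%:R * (-1) ^+ par i
          + (i == j)%:R * (k == l)%:R * (-1) ^+ (par i (+) par k))
         * r%:~R * (r == - s)%:R) *: K'
  | _, _ => 0
  end.

Definition env_relator (x y : gen) : tensor_alg :=
  letter C x * letter C y
  - (-1) ^+ (gen_par x && gen_par y) * (letter C y * letter C x)
  - gen_bracket x y.

(* The enveloping algebra is the quotient of tensor_alg by the two-sided ideal *)
(* generated by the env_relator x y; vac_ideal is the preimage in tensor_alg   *)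
(* of its left ideal generated by gl_{m|n}[t] and K' - 1.                      *)
Inductive vac_ideal : tensor_alg -> Prop :=
| vac_ideal0 : vac_ideal 0
| vac_idealD x y : vac_ideal x -> vac_ideal y -> vac_ideal (x + y)
| vac_idealM a x : vac_ideal x -> vac_ideal (a * x)
| vac_ideal_rel x y b : vac_ideal (env_relator x y * b)
| vac_ideal_ann i j (r : nat) : vac_ideal (e_ i j r%:Z)
| vac_ideal_level : vac_ideal (K' - 1).

Definition vac_pred : {pred tensor_alg} := fun x => `[< vac_ideal x >].

Lemma vac_predP x : reflect (vac_ideal x) (x \in vac_pred).
Proof. exact: asboolP. Qed.

Fact vac_pred_closed : zmod_closed vac_pred.
Proof.
split=> [|x y /vac_predP Jx /vac_predP Jy]; apply/vac_predP; first exact: vac_ideal0.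
by apply: vac_idealD=> //; rewrite -mulN1r; apply: vac_idealM.
Qed.

HB.instance Definition _ :=
  GRing.isZmodClosed.Build tensor_alg vac_pred vac_pred_closed.

(* The affine vertex algebra V at the critical level. *)
Definition vacmod : Type := Quotient.quot vac_pred.
HB.instance Definition _ := GRing.Zmodule.on vacmod.
HB.instance Definition _ := EqQuotient.on vacmod.

Definition act (x : tensor_alg) (v : vacmod) : vacmod :=
  \pi_vacmod (x * repr v).
Definition vac : vacmod := \pi_vacmod 1.

Lemma vac_piP x y : (\pi_vacmod x = \pi_vacmod y) <-> vac_ideal (x - y).
Proof.
split=> [/eqP|Jxy]; first by rewrite -Quotient.idealrBE => /vac_predP.
by apply/eqP; rewrite -Quotient.idealrBE; apply/vac_predP.
Qed.

Lemma vac_piD x y : \pi_vacmod (x + y) = \pi_vacmod x + \pi_vacmod y.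
Proof. exact: (Quotient.pi_add vac_pred x y). Qed.

Lemma act_pi a x : act a (\pi_vacmod x) = \pi_vacmod (a * x).
Proof.
apply/vac_piP; rewrite -mulrBr; apply/vac_idealM/vac_piP.
by rewrite reprK.
Qed.

Definition vac_scale (c : C) (v : vacmod) : vacmod := act (c%:A) v.

Fact vac_scaleA a b v : vac_scale a (vac_scale b v) = vac_scale (a * b) v.
Proof.
by rewrite -[v]reprK /vac_scale !act_pi mulrA -scalerAl mul1r scalerA reprK.
Qed.
Fact vac_scale1 : left_id 1 vac_scale.
Proof. by move=> v; rewrite -[v]reprK /vac_scale act_pi scale1r mul1r. Qed.
Fact vac_scaleDr : right_distributive vac_scale +%R.
Proof.
move=> a u v; rewrite -[u]reprK -[v]reprK /vac_scale -vac_piD !act_pi.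
by rewrite mulrDr vac_piD.
Qed.
Fact vac_scaleDl v : {morph vac_scale^~ v : a b / a + b}.
Proof.
move=> a b; rewrite -[v]reprK /vac_scale !act_pi.
by rewrite scalerDl mulrDl vac_piD.
Qed.
HB.instance Definition _ := GRing.Zmodule_isLmodule.Build C vacmod
  vac_scaleA vac_scale1 vac_scaleDr vac_scaleDl.

(* A field a(z) = sum_r a_(r) z^(-r-1) is given by its Fourier coefficients    *)
(* r |-> a_(r).                                                                *)
Definition field : Type := int -> vacmod -> vacmod.

Definition field_id : field := fun r v => if r == -1 then v else 0.
Definition current (i j : I) : field := fun r => act (e_ i j r).
Definition field_deriv (a : field) : field :=
  fun r v => (- r)%:~R *: a (r - 1) v.

(* :a(z) b(z): for homogeneous fields, s being the product of their parities.  *)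
(* The sums have finite support for fields a and b (\sum_(j \in _) is 0 when   *)
(* the support is infinite).                                                   *)
Definition nprod (s : bool) (a b : field) : field := fun r v =>
  \sum_(j \in [set j : int | (j < 0)%R]%classic) a j (b (r - 1 - j) v)
  + (-1) ^+ s *:
    \sum_(j \in [set j : int | (0 <= j)%R]%classic) b (r - 1 - j) (a j v).

(* (i, j, s) stands for the s-th derivative of e_ij(z). *)
Definition dletter : Type := I * I * nat.
Definition dletter_par (x : dletter) : bool := par x.1.1 (+) par x.1.2.
Definition dword_par (w : seq dletter) : bool :=
  \big[addb/false]_(x <- w) dletter_par x.

Fixpoint normal_order (w : seq dletter) : field :=
  if w is x :: w' then
    nprod (dletter_par x && dword_par w')
      (iter x.2 field_deriv (current x.1.1 x.1.2)) (normal_order w')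
  else field_id.

(* e_{i_1 j_1}[-r_1-1] ... e_{i_p j_p}[-r_p-1] 1 *)
Definition state (w : seq dletter) : vacmod :=
  foldr (fun x => act (e_ x.1.1 x.1.2 (- x.2.+1%:Z))) vac w.

(* The graph of Y : V -> End V[[z, z^-1]], namely the linear span of the pairs *)
(* (e[-r_1-1] ... e[-r_p-1] 1, 1/(r_1! ... r_p!) :d^r_1 e(z) ... d^r_p e(z):). *)
Definition state_field (b : vacmod) (F : field) : Prop :=
  exists y : seq (C * seq dletter),
    b = \sum_(t <- y) t.1 *: state t.2 /\
    F = fun r v => \sum_(t <- y)
          (t.1 / \prod_(x <- t.2) (x.2)`!%:R) *: normal_order t.2 r v.

Definition segal_sugawara (b : vacmod) : Prop :=
  forall (i j : I) (r : nat), act (e_ i j r%:Z) b = 0.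

Definition sugawara_operator (f : vacmod -> vacmod) : Prop :=
  exists (b : vacmod) (F : field) (r : int),
    [/\ segal_sugawara b, state_field b F & f = F r].

(* Formal expressions before normal ordering: None stands for d_z and          *)
(* Some (i, j) for e_ij(z).                                                    *)
Definition opletter : Type := option (I * I).
HB.instance Definition _ := Choice.on opletter.
Local Notation expr := (free_alg C opletter).

Definition opletter_par (x : opletter) : bool :=
  if x is Some (i, j) then par i (+) par j else false.

(* Terms of the derivative of a monomial, by the Leibniz rule. *)
Fixpoint leibniz (w : seq dletter) : seq (seq dletter) :=
  if w is x :: w' then ((x.1, x.2.+1) :: w') :: map (cons x) (leibniz w')
  else [::].

(* A monomial as a sum of terms (w, p), standing for w d_z^p, obtained with    *)
(* the rule d_z a(z) = a(z) d_z + a'(z).                                       *)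
Fixpoint move_right (w : seq opletter) : seq (seq dletter * nat) :=
  match w with
  | [::] => [:: ([::], 0%N)]
  | Some ij :: w' => [seq ((ij, 0%N) :: t.1, t.2) | t <- move_right w']
  | None :: w' =>
      flatten [seq (t.1, t.2.+1) :: [seq (v, t.2) | v <- leibniz t.1]
              | t <- move_right w']
  end.

(* The coefficient of d_z^p in the normally ordered expression :x:. *)
Definition normal_coef (x : expr) (p : nat) : field := fun r v =>
  \sum_(w <- msupp x) x@_w *:
    \sum_(t <- move_right w | t.2 == p) normal_order t.1 r v.

Definition dz : expr := letter C None.
Definition ehat (i j : I) : expr := letter C (Some (i, j)).

Definition Tmat : 'M[expr]_(m + n) :=
  \matrix_(i, j) ((i == j)%:R * dz + (-1) ^+ par i * ehat i j).

Definition str (X : 'M[expr]_(m + n)) : expr := \sum_i (-1) ^+ par i * X i i.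

(* Formal power series in u. *)
Definition useries : Type := nat -> expr.
Definition useries1 : useries := fun k => (k == 0%N)%:R.
Definition useries_mul (f g : useries) : useries :=
  fun k => \sum_(i < k.+1) f i * g (k - i)%N.

Definition one_plus_u (X : 'M[expr]_(m + n)) (i j : I) : useries := fun k =>
  match k with 0 => (i == j)%:R | 1 => X i j | _ => 0 end.
Definition one_plus_u_inv (X : 'M[expr]_(m + n)) (i j : I) : useries :=
  fun k => (-1) ^+ k * (X ^+ k) i j.

Definition ber (X : 'M[expr]_(m + n)) : useries :=
  useries_mul
    (fun k => \sum_(s : 'S_m) (-1) ^+ s *
       (\big[useries_mul/useries1]_(i < m)
          one_plus_u X (lshift n (s i)) (lshift n i)) k)
    (fun k => \sum_(s : 'S_n) (-1) ^+ s *
       (\big[useries_mul/useries1]_(i < n)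
          one_plus_u_inv X (rshift m i) (rshift m (s i))) k).

Section Tensor.
Variable k : nat.

(* X : tensor stands for the sum over p and q of                               *)
(* e_{p_1 q_1} (x) ... (x) e_{p_k q_k} (x) X p q.                              *)
Definition multi : Type := {ffun 'I_k -> I}.
HB.instance Definition _ := Finite.on multi.
Definition tensor : Type := multi -> multi -> expr.

Definition multi_par (p : multi) : bool := \big[addb/false]_(a < k) par (p a).

(* The parity automorphism if s is odd, the identity otherwise. *)
Definition parity_twist (s : bool) (x : expr) : expr :=
  \sum_(w <- msupp x)
    << (-1) ^+ (s && \big[addb/false]_(y <- (w : seq opletter)) opletter_par y)
       * x@_w *g w >>.

(* (e_pq (x) x) (e_qs (x) y) =                                                 *)
(*   e_pq e_qs (x) x y (-1)^(deg x deg e_qs), where                            *)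
(* (e_{p_1 q_1} (x) ...) (e_{q_1 s_1} (x) ...) = (-1)^(unit_sign p q s) e_ps.  *)
Definition unit_sign (p q s : multi) : bool :=
  \big[addb/false]_(a < k) \big[addb/false]_(b < k | (b < a)%N)
    ((par (p a) (+) par (q a)) && (par (q b) (+) par (s b))).

Definition tensor1 : tensor := fun p q => (p == q)%:R.
Definition tensor_mul (X Y : tensor) : tensor := fun p s =>
  \sum_q (-1) ^+ unit_sign p q s *
    (parity_twist (multi_par q (+) multi_par s) (X p q) * Y q s).

Definition Tslot (a : 'I_k) : tensor := fun p q =>
  [forall b : 'I_k, (b != a) ==> (p b == q b)]%:R *
    ((-1) ^+ ((par (p a) && par (q a)) (+) par (q a)) * Tmat (p a) (q a)).

(* The natural action moves the a-th factor to the position s a; koszul s q is *)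
(* the sign exponent it produces on e_{q_1} (x) ... (x) e_{q_k}, and           *)
(* unit_act_sign p q the one in                                                *)
(* (e_{p_1 q_1} (x) ... (x) e_{p_k q_k}) (e_{q_1} (x) ... (x) e_{q_k}).        *)
Definition koszul (s : 'S_k) (q : multi) : bool :=
  \big[addb/false]_(a < k) \big[addb/false]_(b < k | (a < b)%N && (s b < s a)%N)
    (par (q a) && par (q b)).
Definition unit_act_sign (p q : multi) : bool :=
  \big[addb/false]_(a < k) \big[addb/false]_(b < k | (b < a)%N)
    ((par (p a) (+) par (q a)) && par (q b)).
Definition Pperm (s : 'S_k) : tensor := fun p q =>
  [forall a : 'I_k, p (s a) == q a]%:R *
    (-1) ^+ (koszul s q (+) unit_act_sign p q).

(* Pperm (tperm a b) is the P_ab of the usual formula: the sum of              *)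
(* e_ij at position a and e_ji at position b with the sign (-1)^par j.         *)
Lemma Pperm_tperm (a b : 'I_k) (p q : multi) : (a < b)%N ->
  Pperm (tperm a b) p q =
    [&& p a == q b, p b == q a &
        [forall c : 'I_k, (c != a) && (c != b) ==> (p c == q c)]]%:R
      * (-1) ^+ par (q a).
Proof.
move=> ab; rewrite /Pperm.
have neab : b != a by rewrite -val_eqE gtn_eqF.
set P := [forall c, _]; set Q := [&& _, _ & _].
have -> : P = Q.
  apply/forallP/and3P => [H|[/eqP pa /eqP pb /forallP H] c].
    split; first by have := H b; rewrite tpermR.
      by have := H a; rewrite tpermL.
    apply/forallP=> c; apply/implyP=> /andP[ca cb].
    by have := H c; rewrite tpermD // eq_sym.
  by case: tpermP => [->|->|/eqP ca /eqP cb]; rewrite ?pa ?pb //;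
    have := H c; rewrite ca cb.
case: (boolP Q) => [/and3P[/eqP pa /eqP pb /forallP H]|_]; last by rewrite !mul0r.
congr (_ * (-1) ^+ (nat_of_bool _)).
have pc c : c != a -> c != b -> p c = q c.
  by move=> ca cb; have := H c; rewrite ca cb => /eqP.
pose f c := par (q c).
pose S := \big[addb/false]_(d < k | (a < d < b)%N) f d.
pose A := \big[addb/false]_(d < k | (d < a)%N) f d.
pose B := \big[addb/false]_(d < k | (d < b)%N) f d.
have EB : B = A (+) (f a (+) S).
  rewrite /B (bigID (fun d : 'I_k => (d < a)%N)) /=; congr (_ (+) _).
    by apply: eq_bigl => d; case: (ltnP d a) => da; rewrite ?andbF ?andbT // (ltn_trans da).
  rewrite (bigD1 a) /= ?ab ?ltnn //; congr (_ (+) _).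
  apply: eq_bigl => d; rewrite -leqNgt -andbA andbC; congr (_ && _).
  by rewrite ltn_neqAle eq_sym -val_eqE eq_sym andbC.
have EU : unit_act_sign p q = (f a (+) f b) && (f a (+) S).
  rewrite /unit_act_sign (bigD1 a) //= [X in _ (+) X](bigD1 b) //=.
  rewrite [X in _ (+) (_ (+) X)]big1 => [|c /andP[ca cb]]; last first.
    by rewrite big1 // => d _; rewrite pc // addbb.
  rewrite -!big_distrr /= pa pb -/A -/B -/(f a) -/(f b) EB.
  by clear EB; case: (f a) (f b) A S => [] [] [] [].
have EK : koszul (tperm a b) q = (f a && (f b (+) S)) (+) (S && f b).
  rewrite /koszul (bigD1 a) //= [X in _ (+) X](bigD1 b) //= tpermL tpermR.
  rewrite -!big_distrr /= -/(f a) -/(f b).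
  congr (_ (+) _); first (congr (_ && _)).
    rewrite (bigD1 b) /= ?tpermR ?ab //; congr (_ (+) _).
    apply: eq_bigl => d; case: tpermP => [->|->|/eqP da /eqP db].
    - by rewrite ltnn.
    - by rewrite eqxx !andbF ltnn andbF.
    - by rewrite db andbT.
  rewrite [X in f b && X]big1 ?andbF => [|d]; last first.
    case: tpermP => [->|->|_ _] /andP[].
    - by rewrite ltnNge (ltnW ab).
    - by rewrite ltnn.
    - by move=> bd /(ltn_trans bd) ba; have := ltn_trans ab ba; rewrite ltnn.
  rewrite addFb /S big_distrl /= [RHS]big_mkcond [LHS]big_mkcond /=; apply: eq_bigr => c _.
  case: (eqVneq c a) => [->|ca] /=; first by rewrite ltnn.
  case: (eqVneq c b) => [->|cb] /=; first by rewrite ltnn andbF.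
  rewrite tpermD 1?eq_sym //.
  have [acb|nacb] := ifP.
    case/andP: acb => ac cltb.
    rewrite (bigD1 b) /= ?tpermR ?cltb //= big1 ?addbF // => d /andP[/andP[cd]].
    case: tpermP => [->|->|_ _]; rewrite ?eqxx //.
      by move=> /(ltn_trans cltb); rewrite ltnn.
    by move=> dc; have := ltn_trans cd dc; rewrite ltnn.
  rewrite big1 // => d /andP[cd]; case: tpermP => [E|E|_ _].
  - by move=> bc; have := ltn_trans (ltn_trans ab bc) cd; rewrite E ltnn.
  - by move=> ac; move: nacb; rewrite ac -E cd.
  - by move=> dc; have := ltn_trans cd dc; rewrite ltnn.
by rewrite EU EK -/(f a) {EB EU EK}; case: (f a) (f b) S => [] [] [].
Qed.

Definition Hk : tensor := fun p q =>
  (k`!%:R^-1 : C) *: \sum_(s : 'S_k) Pperm s p q.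
Definition Ak : tensor := fun p q =>
  (k`!%:R^-1 : C) *: \sum_(s : 'S_k) (-1) ^+ s * Pperm s p q.

Definition Tprod : tensor := \big[tensor_mul/tensor1]_(a < k) Tslot a.

Definition tensor_str (X : tensor) : expr :=
  \sum_p (-1) ^+ multi_par p * X p p.

End Tensor.

(* The coefficients of d_z^(k-l); meaningful for l <= k. *)
Definition s_coef (k l : nat) : field := normal_coef (str (Tmat ^+ k)) (k - l).
Definition b_coef (k l : nat) : field := normal_coef (ber Tmat k) (k - l).
Definition sigma_coef (k l : nat) : field :=
  normal_coef (tensor_str (tensor_mul (@Ak k) (@Tprod k))) (k - l).
Definition h_coef (k l : nat) : field :=
  normal_coef (tensor_str (tensor_mul (@Hk k) (@Tprod k))) (k - l).

End Affine.

Arguments s_coef C m n k l : clear implicits.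
Arguments b_coef C m n k l : clear implicits.
Arguments sigma_coef C m n k l : clear implicits.
Arguments h_coef C m n k l : clear implicits.

(* Main.v *)
Require Import Defs.
From HB Require Import structures.
From mathcomp Require Import all_boot all_order all_algebra.
From mathcomp Require Import boolp.

Set Implicit Arguments.
Unset Strict Implicit.
Unset Printing Implicit Defensive.

(* The matrix T(z) is a Manin matrix: in the differential module spanned by the
   coefficients of powers of d_z one has [e_ij, e_kl} = delta_kj [d_z, e_il] - ... ,
   hence [T_ij, T_kl} = +-[T_kj, T_il}.  Super versions of the Newton identities
   then express the coefficients of Ber(1 + uT) and the traces of A_k T_1 ... T_k
   by the same recurrence in the str T^l, and those of H_k T_1 ... T_k by a similar
   one.  On the vacuum module, the modes e_ij[0] and e_ij[1] annihilate everything
   generated from the vacuum by the operators str T^l, because at the critical level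
   all that remains in [e_ij[1], str T^N] is a sum that vanishes by the Manin
   relations for powers of T; the modes e_ij[r], r >= 2, are reached from e_ij[1] by
   bracketing with the derivation e_ij[r] |-> - r e_ij[r + 1].  Applied to normally
   ordered fields, for which quasi-commutativity of the normally ordered product
   gives the same Manin relations, the Newton identities yield sigma_kl = b_kl. *)

(** In the expressions d_z is a formal symbol, so both evaluations take place on sequences
    [nat -> W]: the entry at p is the coefficient of d_z^p, and d_z acts by f d_z^p |-> f d_z^(p+1)
    + f' d_z^p. With W = V the result is a sequence of states, on which annihilation by gl_{m|n}[t]
    is tested. The equality of [sigma_coef] and [b_coef] concerns fields, and [state_field] is only
    a relation, so W is taken a second time to be a space of fields split by parity, where a letter
    acts by normally ordered multiplication. The algebra is done once, over an abstract ring with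
    Manin relations and cancellation of positive integers. The derivation e[r] |-> - r e[r + 1]
    enters because brackets of e[0] and e[1] do not reach e[2] in general: gl_1 is abelian. It must
    act on powers of d_z too, compatibly with [L, D] = 2H, and this brings in the grading operator
    H. For the Berezinian the recurrence comes from u d/du. The two determinants in it are
    differentiated separately; the traces of the inverse of the even block, which both produce,
    cancel by block inversion. *)

Import GRing.Theory.
Local Open Scope ring_scope.

(** * A decision procedure for noncommutative rings *)

Inductive rterm :=
  | TVar of nat | T0 | T1 | TAdd of rterm & rterm | TOpp of rterm
  | TMul of rterm & rterm.

Fixpoint teval (R : pzRingType) (e : seq R) (t : rterm) : R :=
  match t with
  | TVar i => nth 0 e i
  | T0 => 0
  | T1 => 1
  | TAdd a b => teval e a + teval e b
  | TOpp a => - teval e a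
  | TMul a b => teval e a * teval e b
  end.

Definition ncpoly := seq (int * seq nat).

Definition ncpoly_eval (R : pzRingType) (e : seq R) (p : ncpoly) : R :=
  \sum_(m <- p) (\prod_(i <- m.2) nth 0 e i) *~ m.1.

Fixpoint ncpoly_insert (c : int) (w : seq nat) (p : ncpoly) : ncpoly :=
  if p is m :: p' then
    if m.2 == w then (c + m.1, w) :: p' else m :: ncpoly_insert c w p'
  else [:: (c, w)].

Definition ncpoly_add (p q : ncpoly) : ncpoly :=
  foldr (fun m acc => ncpoly_insert m.1 m.2 acc) q p.

Definition ncpoly_mul (p q : ncpoly) : ncpoly :=
  foldr (fun m acc =>
    ncpoly_add [seq (m.1 * m'.1, m.2 ++ m'.2) | m' <- q] acc) [::] p.

Fixpoint tnorm (t : rterm) : ncpoly :=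
  match t with
  | TVar i => [:: (1, [:: i])]
  | T0 => [::]
  | T1 => [:: (1, [::])]
  | TAdd a b => ncpoly_add (tnorm a) (tnorm b)
  | TOpp a => [seq (- m.1, m.2) | m <- tnorm a]
  | TMul a b => ncpoly_mul (tnorm a) (tnorm b)
  end.

Lemma ncpoly_insertE (R : pzRingType) (e : seq R) c w p :
  ncpoly_eval e (ncpoly_insert c w p)
  = (\prod_(i <- w) nth 0 e i) *~ c + ncpoly_eval e p.
Proof.
rewrite /ncpoly_eval; elim: p => [|m p IHp] /=; first by rewrite big_seq1 big_nil addr0.
case: eqP => [<-|_]; rewrite !big_cons /=; first by rewrite mulrzDr addrA.
by rewrite IHp addrCA.
Qed.

Lemma ncpoly_addE (R : pzRingType) (e : seq R) p q :
  ncpoly_eval e (ncpoly_add p q) = ncpoly_eval e p + ncpoly_eval e q.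
Proof.
elim: p => [|m p IHp] /=; first by rewrite /ncpoly_eval big_nil add0r.
by rewrite ncpoly_insertE IHp [in RHS]/ncpoly_eval big_cons addrA.
Qed.

Lemma ncpoly_mulE (R : pzRingType) (e : seq R) p q :
  ncpoly_eval e (ncpoly_mul p q) = ncpoly_eval e p * ncpoly_eval e q.
Proof.
elim: p => [|m p IHp] /=; first by rewrite /ncpoly_eval !big_nil mul0r.
rewrite ncpoly_addE IHp [ncpoly_eval e (m :: p)]/ncpoly_eval big_cons mulrDl; congr (_ + _).
rewrite /ncpoly_eval big_map mulr_sumr; apply: eq_bigr => m' _ /=.
by rewrite big_cat /= mulrzAl mulrzAr -mulrzA [_ *~ (_ * _)]/(_ *~ _) mulrC.
Qed.

Lemma tnormE (R : pzRingType) (e : seq R) t :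
  teval e t = ncpoly_eval e (tnorm t).
Proof.
elim: t => [i|||a IHa b IHb|a IHa|a IHa b IHb] /=.
- by rewrite /ncpoly_eval big_seq1 /= big_seq1.
- by rewrite /ncpoly_eval big_nil.
- by rewrite /ncpoly_eval big_seq1 /= big_nil.
- by rewrite ncpoly_addE IHa IHb.
- rewrite IHa /ncpoly_eval big_map /= -sumrN.
  by apply: eq_bigr => m _; rewrite mulrNz.
- by rewrite ncpoly_mulE IHa IHb.
Qed.

(** [ncpoly_insert] keeps monomials whose coefficients have cancelled, so the test asks for zero
    coefficients rather than for an empty list. *)
Lemma tnorm_eq (R : pzRingType) (e : seq R) t u :
  all (fun m => m.1 == 0) (tnorm (TAdd t (TOpp u))) -> teval e t = teval e u.
Proof.
move=> H; apply/eqP; rewrite -subr_eq0.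
rewrite -[teval e t - _]/(teval e (TAdd t (TOpp u))) tnormE /ncpoly_eval big1_seq //.
by move=> m /= /(allP H) /eqP ->.
Qed.

(** Syntactic comparison comes first; unification then identifies atoms that agree only up to
    conversion. *)
Ltac nring_same x y := first [constr_eq x y | unify x y].

Ltac nring_find x e :=
  lazymatch e with
  | nil => constr:(0%N)
  | cons ?y ?e' =>
    match constr:(Set) with
    | _ => let _ := match constr:(Set) with _ => nring_same x y end in constr:(0%N)
    | _ => let n := nring_find x e' in constr:(S n)
    end
  end.

Ltac nring_mem x e :=
  lazymatch e with
  | nil => constr:(false)
  | cons ?y ?e' =>
    match constr:(Set) with
    | _ => let _ := match constr:(Set) with _ => nring_same x y end in constr:(true)
    | _ => nring_mem x e'
    end
  end.

Ltac nring_atoms t e :=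
  lazymatch t with
  | (?a + ?b)%R => let e1 := nring_atoms a e in nring_atoms b e1
  | (- ?a)%R => nring_atoms a e
  | (?a * ?b)%R => let e1 := nring_atoms a e in nring_atoms b e1
  | 0%R => e
  | 1%R => e
  | _ => lazymatch nring_mem t e with
         | true => e
         | false => constr:(cons t e)
         end
  end.

Ltac nring_reify t e :=
  lazymatch t with
  | (?a + ?b)%R =>
    let x := nring_reify a e in let y := nring_reify b e in constr:(TAdd x y)
  | (- ?a)%R => let x := nring_reify a e in constr:(TOpp x)
  | (?a * ?b)%R =>
    let x := nring_reify a e in let y := nring_reify b e in constr:(TMul x y)
  | 0%R => constr:(T0)
  | 1%R => constr:(T1)
  | _ => let n := nring_find t e in constr:(TVar n)
  end.

Ltac nring :=
  intros; rewrite ?expr0 ?expr1;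
  lazymatch goal with
  | |- @eq ?R ?t ?u =>
    let e0 := nring_atoms t (@nil R) in
    let e := nring_atoms u e0 in
    let a := nring_reify t e in
    let b := nring_reify u e in
    apply: (@tnorm_eq _ e a b); vm_compute; reflexivity
  end.

(** * Endomorphism rings and formal power series over noncommutative rings *)

(** Additivity alone makes the operators a ring; C-linearity is carried by separate hypotheses. The
    ring is only a [pzRingType] because M may be trivial. *)
Record endo (M : zmodType) := Endo {
  endo_fun :> M -> M;
  endo_subproof : zmod_morphism endo_fun
}.

HB.instance Definition _ (M : zmodType) := gen_eqMixin (endo M).
HB.instance Definition _ (M : zmodType) := gen_choiceMixin (endo M).

Section Endo.
Variable M : zmodType.
Implicit Types a b c : endo M.

Lemma endoP a b : (forall v, a v = b v) -> a = b.
Proof.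
case: a b => [f Hf] [g Hg] /= /funext fg; rewrite fg in Hf *.
by rewrite (Prop_irrelevance Hf Hg).
Qed.

HB.instance Definition _ a :=
  GRing.isZmodMorphism.Build M M (endo_fun a) (endo_subproof a).

Fact endo0_subproof : zmod_morphism (fun _ : M => 0 : M).
Proof. by move=> u v; rewrite subr0. Qed.
Fact endo1_subproof : zmod_morphism (fun v : M => v).
Proof. by []. Qed.
Fact endoD_subproof a b : zmod_morphism (fun v => a v + b v).
Proof. by move=> u v; rewrite !raddfB addrACA opprD. Qed.
Fact endoN_subproof a : zmod_morphism (fun v => - a v).
Proof. by move=> u v; rewrite raddfB opprB opprK addrC. Qed.
Fact endoM_subproof a b : zmod_morphism (fun v => a (b v)).
Proof. by move=> u v; rewrite !raddfB. Qed.

Let zero := Endo endo0_subproof.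
Let one := Endo endo1_subproof.
Let add a b := Endo (endoD_subproof a b).
Let opp a := Endo (endoN_subproof a).
Let mul a b := Endo (endoM_subproof a b).

Fact endo_addA : associative add.
Proof. by move=> a b c; apply: endoP => v /=; rewrite addrA. Qed.
Fact endo_addC : commutative add.
Proof. by move=> a b; apply: endoP => v /=; rewrite addrC. Qed.
Fact endo_add0 : left_id zero add.
Proof. by move=> a; apply: endoP => v /=; rewrite add0r. Qed.
Fact endo_addN : left_inverse zero opp add.
Proof. by move=> a; apply: endoP => v /=; rewrite addNr. Qed.
HB.instance Definition _ :=
  GRing.isZmodule.Build (endo M) endo_addA endo_addC endo_add0 endo_addN.

Fact endo_mulA : associative mul.
Proof. by move=> a b c; apply: endoP. Qed.
Fact endo_mul1 : left_id one mul.
Proof. by move=> a; apply: endoP. Qed.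
Fact endo_mulr1 : right_id one mul.
Proof. by move=> a; apply: endoP. Qed.
Fact endo_mulDl : left_distributive mul +%R.
Proof. by move=> a b c; apply: endoP. Qed.
Fact endo_mulDr : right_distributive mul +%R.
Proof. by move=> a b c; apply: endoP => v; apply: raddfD. Qed.
HB.instance Definition _ := GRing.Zmodule_isPzRing.Build (endo M)
  endo_mulA endo_mul1 endo_mulr1 endo_mulDl endo_mulDr.

Lemma endoD a b v : (a + b) v = a v + b v. Proof. by []. Qed.
Lemma endoN a v : (- a) v = - a v. Proof. by []. Qed.
Lemma endo0 v : (0 : endo M) v = 0. Proof. by []. Qed.
Lemma endo1 v : (1 : endo M) v = v. Proof. by []. Qed.
Lemma endoM a b v : (a * b) v = a (b v). Proof. by []. Qed.
Definition endoE := (endoD, endoN, endo0, endo1, endoM).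

Lemma endoDr a u v : a (u + v) = a u + a v. Proof. exact: raddfD. Qed.
Lemma endoBr a u v : a (u - v) = a u - a v. Proof. exact: raddfB. Qed.
Lemma endoNr a u : a (- u) = - a u. Proof. exact: raddfN. Qed.
Lemma endo0r a : a 0 = 0. Proof. exact: raddf0. Qed.
Lemma endo_sumr a (I : Type) (r : seq I) (P : pred I) (F : I -> M) :
  a (\sum_(i <- r | P i) F i) = \sum_(i <- r | P i) a (F i).
Proof. exact: raddf_sum. Qed.

Lemma endo_sum (I : Type) (r : seq I) (P : pred I) (F : I -> endo M) v :
  (\sum_(i <- r | P i) F i) v = \sum_(i <- r | P i) F i v.
Proof. by elim/big_rec2: _ => // i x y _ <-. Qed.

Lemma endo_sign (b : bool) v : ((-1) ^+ b : endo M) v = if b then - v else v.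
Proof. by case: b; rewrite ?expr0 ?expr1. Qed.

End Endo.

(** Series in a variable u that commutes with the coefficients. The wrapper keeps the Cauchy product
    apart from pointwise operations on functions. *)
Record pser (R : Type) := PSer { pcoef : nat -> R }.

HB.instance Definition _ (R : Type) := gen_eqMixin (pser R).
HB.instance Definition _ (R : Type) := gen_choiceMixin (pser R).

Section PSer.
Variable R : pzRingType.
Implicit Types f g h : pser R.

Lemma pserP f g : (forall k, pcoef f k = pcoef g k) -> f = g.
Proof. by case: f g => [f] [g] /= /funext ->. Qed.

Let zero := PSer (fun _ => 0 : R).
Let one := PSer (fun k => (k == 0%N)%:R : R).
Let add f g := PSer (fun k => pcoef f k + pcoef g k).
Let opp f := PSer (fun k => - pcoef f k).
Let mul f g := PSer (fun k => \sum_(i < k.+1) pcoef f i * pcoef g (k - i)).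

Fact pser_addA : associative add.
Proof. by move=> a b c; apply: pserP => v /=; rewrite addrA. Qed.
Fact pser_addC : commutative add.
Proof. by move=> a b; apply: pserP => v /=; rewrite addrC. Qed.
Fact pser_add0 : left_id zero add.
Proof. by move=> a; apply: pserP => v /=; rewrite add0r. Qed.
Fact pser_addN : left_inverse zero opp add.
Proof. by move=> a; apply: pserP => v /=; rewrite addNr. Qed.
HB.instance Definition _ :=
  GRing.isZmodule.Build (pser R) pser_addA pser_addC pser_add0 pser_addN.

Fact pser_mul_rev f g k :
  pcoef (mul f g) k = \sum_(i < k.+1) pcoef f (k - i) * pcoef g i.
Proof.
rewrite /= (reindex_inj rev_ord_inj) /=.
by apply: eq_bigr => j _; rewrite (sub_ordK j).
Qed.

Fact pser_mulA : associative mul.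
Proof.
move=> p q r; apply: pserP => i; rewrite [RHS]pser_mul_rev /=.
pose coef3 j k := pcoef p j * (pcoef q (i - j - k) * pcoef r k).
transitivity (\sum_(j < i.+1) \sum_(k < i.+1 | (k <= i - j)%N) coef3 j k).
  apply: eq_bigr => /= j _.
  rewrite -[X in _ * X]/(pcoef (mul q r) (i - j)) pser_mul_rev mulr_sumr /=.
  by rewrite (big_ord_narrow_leq (leq_subr _ _)).
rewrite (exchange_big_dep predT) //=; apply: eq_bigr => k _.
transitivity (\sum_(j < i.+1 | (j <= i - k)%N) coef3 j k).
  apply: eq_bigl => j; rewrite -ltnS -(ltnS j) -!subSn ?leq_ord //.
  by rewrite -subn_gt0 -(subn_gt0 j) -!subnDA addnC.
rewrite (big_ord_narrow_leq (leq_subr _ _)) mulr_suml /=.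
by apply: eq_bigr => j _; rewrite /coef3 -!subnDA addnC mulrA.
Qed.
Fact pser_mul1 : left_id one mul.
Proof.
move=> f; apply: pserP => k /=; rewrite big_ord_recl /= subn0 mul1r.
by rewrite big1 ?addr0 // => i _; rewrite mul0r.
Qed.
Fact pser_mulr1 : right_id one mul.
Proof.
move=> f; apply: pserP => k; rewrite pser_mul_rev big_ord_recl /= subn0 mulr1.
by rewrite big1 ?addr0 // => i _; rewrite mulr0.
Qed.
Fact pser_mulDl : left_distributive mul +%R.
Proof.
move=> a b c; apply: pserP => k /=; rewrite -big_split /=.
by apply: eq_bigr => i _; rewrite mulrDl.
Qed.
Fact pser_mulDr : right_distributive mul +%R.
Proof.
move=> a b c; apply: pserP => k /=; rewrite -big_split /=.
by apply: eq_bigr => i _; rewrite mulrDr.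
Qed.
HB.instance Definition _ := GRing.Zmodule_isPzRing.Build (pser R)
  pser_mulA pser_mul1 pser_mulr1 pser_mulDl pser_mulDr.

Lemma pcoefD f g k : pcoef (f + g) k = pcoef f k + pcoef g k.
Proof. by []. Qed.
Lemma pcoefN f k : pcoef (- f) k = - pcoef f k. Proof. by []. Qed.
Lemma pcoefB f g k : pcoef (f - g) k = pcoef f k - pcoef g k.
Proof. by []. Qed.
Lemma pcoef0 k : pcoef (0 : pser R) k = 0. Proof. by []. Qed.
Lemma pcoef1 k : pcoef (1 : pser R) k = (k == 0%N)%:R. Proof. by []. Qed.
Lemma pcoefM f g k :
  pcoef (f * g) k = \sum_(i < k.+1) pcoef f i * pcoef g (k - i).
Proof. by []. Qed.
Lemma pcoefMr f g k :
  pcoef (f * g) k = \sum_(i < k.+1) pcoef f (k - i) * pcoef g i.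
Proof. exact: pser_mul_rev. Qed.
Lemma pcoef_sum (I : Type) (r : seq I) (P : pred I) (F : I -> pser R) k :
  pcoef (\sum_(i <- r | P i) F i) k = \sum_(i <- r | P i) pcoef (F i) k.
Proof. by elim/big_rec2: _ => // i x y _ <-. Qed.

Lemma pcoef_signM (b : bool) f k :
  pcoef ((-1) ^+ b * f) k = (-1) ^+ b * pcoef f k.
Proof. by rewrite !mulr_sign; case: b. Qed.

Lemma pser_two_reg : (forall z : R, z + z = 0 -> z = 0) ->
  forall z : pser R, z + z = 0 -> z = 0.
Proof.
move=> H z zz; apply: pserP => k; apply: H.
by rewrite -pcoefD zz.
Qed.

(** x + u y; its companion [pgeom y] is the inverse of 1 + u y. *)
Definition plin (x y : R) : pser R :=
  PSer (fun k => match k with 0 => x | 1 => y | _ => 0 end).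
Definition pgeom (y : R) : pser R := PSer (fun k => (-1) ^+ k * y ^+ k).

Lemma pcoef_plinM x y f k :
  pcoef (plin x y * f) k.+1 = x * pcoef f k.+1 + y * pcoef f k.
Proof.
rewrite pcoefM big_ord_recl big_ord_recl /= big1 ?addr0; last first.
  by move=> i _; rewrite mul0r.
by rewrite subn0 subSS subn0.
Qed.
Lemma pcoef_Mplin x y f k :
  pcoef (f * plin x y) k.+1 = pcoef f k.+1 * x + pcoef f k * y.
Proof.
rewrite pcoefMr big_ord_recl big_ord_recl /= big1 ?addr0; last first.
  by move=> i _; rewrite mulr0.
by rewrite subn0 subSS subn0.
Qed.

Lemma plinK y : plin 1 y * pgeom y = 1.
Proof.
apply: pserP => -[|k]; first by rewrite pcoefM big_ord1 /= expr0 !mul1r.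
rewrite pcoef_plinM /= mul1r exprS exprS.
by rewrite !mulN1r mulNr mulrA -(commrX k (commrN1 y)) -mulrA addNr.
Qed.
Lemma pgeomK y : pgeom y * plin 1 y = 1.
Proof.
apply: pserP => -[|k]; first by rewrite pcoefM big_ord1 /= expr0 !mul1r.
rewrite pcoef_Mplin /= mulr1 exprS exprSr.
by rewrite !mulN1r mulNr mulrA addNr.
Qed.

End PSer.

(** * Super Manin matrices *)

Fact sg_key : unit. Proof. exact: tt. Qed.
(** Locked so that a sign stays an atom under simplification and conversion: signs are gathered with
    [sgMMl] and [sgCA] and evaluated only on demand by [sg0] and [sg1]. *)
Definition sg {R : pzRingType} (b : bool) : R :=
  locked_with sg_key (if b then -1 else 1).

Section Signs.
Variable R : pzRingType.
Implicit Types x y : R.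

Lemma sg0 : sg false = 1 :> R. Proof. by rewrite /sg unlock. Qed.
Lemma sg1 : sg true = -1 :> R. Proof. by rewrite /sg unlock. Qed.
Lemma sgE b : sg b = (-1) ^+ b :> R.
Proof. by case: b; rewrite ?sg0 ?sg1 ?expr0 ?expr1. Qed.
Lemma sgD a b : sg (a (+) b) = sg a * sg b :> R.
Proof.
by case: a b => [] []; rewrite /= ?sg0 ?sg1 ?mulr1 ?mul1r ?mulrNN ?mulr1.
Qed.
Lemma sgC b x : x * sg b = sg b * x.
Proof. by case: b; rewrite ?sg0 ?sg1 ?mulr1 ?mul1r ?mulrN1 ?mulN1r. Qed.
Lemma sgCA b x y : x * (sg b * y) = sg b * (x * y).
Proof. by rewrite mulrA sgC mulrA. Qed.
Lemma sgMM b : sg b * sg b = 1 :> R.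
Proof. by rewrite -sgD addbb sg0. Qed.
Lemma sgK b x : sg b * (sg b * x) = x.
Proof. by rewrite mulrA sgMM mul1r. Qed.
Lemma sgMMl a b x : sg a * (sg b * x) = sg (a (+) b) * x.
Proof. by rewrite mulrA sgD. Qed.
Lemma sgNl b x : sg (~~ b) * x = - (sg b * x).
Proof. by rewrite -addTb sgD sg1 mulN1r mulNr. Qed.
End Signs.

(** P is the graded flip of two tensor slots, a and b the same matrix acting in either slot. That P
    fixes the commutator of a and b is the Manin property, and the conclusion is this property for
    the inverse matrix. Conjugation by P exchanges a' and b', hence negates S; this forces 2 S Q = S
    Q (b' a' Q), so S Q = 0 by the last hypothesis, and then P S = S. *)
Lemma manin_inverse (B : pzRingType) (P a a' b b' : B) :
    P * P = 1 -> P * a * P = b -> a * a' = 1 -> a' * a = 1 ->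
    b * b' = 1 -> b' * b = 1 -> P * (a * b - b * a) = a * b - b * a ->
    (forall z, z + z = z * (b' * a' * (a * b - b * a)) -> z = 0) ->
  P * (a' * b' - b' * a') = a' * b' - b' * a'.
Proof.
move=> PP PaP aa' a'a bb' b'b; set Q := _ - b * a => PQ Qreg.
have PbP : P * b * P = a by rewrite -PaP !mulrA PP mul1r -mulrA PP mulr1.
have Pa' : P * a' = b' * P.
  rewrite -[LHS]mul1r -{1}b'b -PaP.
  have -> : b' * (P * a * P) * (P * a') = b' * P * (a * (P * P) * a') by nring.
  by rewrite PP mulr1 aa' mulr1.
have Pb' : P * b' = a' * P.
  rewrite -[LHS]mul1r -{1}a'a -PbP.
  have -> : a' * (P * b * P) * (P * b') = a' * P * (b * (P * P) * b') by nring.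
  by rewrite PP mulr1 bb' mulr1.
set S := a' * b' - b' * a'.
(* The commutator of the inverses is the commutator Q conjugated by them; P then acts on the left
   factors a' b' and is absorbed by Q. *)
have SE : S = a' * b' * Q * b' * a'.
  have -> : a' * b' * Q * b' * a'
    = a' * b' * a * (b * b') * a' - a' * (b' * b) * a * b' * a' by rewrite /Q; nring.
  rewrite bb' b'b !mulr1.
  have -> : a' * b' * a * a' = a' * b' * (a * a') by nring.
  by rewrite aa' a'a mulr1 mul1r.
have PS : S - P * S = S * Q * b' * a'.
  have -> : P * S = b' * a' * Q * b' * a'.
    rewrite SE !mulrA Pa' -!mulrA (mulrA P b') Pb' -!mulrA (mulrA P Q) PQ.
    by rewrite !mulrA.
  by rewrite {1}SE /S; nring.
have PSQ : P * S * Q = - (S * Q).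
  have PSP : P * S * P = - S.
    have E1 : P * (a' * b') * P = b' * a'.
      by rewrite mulrA Pa' -(mulrA b') Pb' -!mulrA PP mulr1.
    have E2 : P * (b' * a') * P = a' * b'.
      by rewrite mulrA Pb' -(mulrA a') Pa' -!mulrA PP mulr1.
    by rewrite /S mulrBr mulrBl E1 E2 opprB.
  by rewrite -{1}PQ mulrA PSP mulNr.
have Z0 : S * Q = 0.
  apply: Qreg; rewrite -[X in X + _]opprK -PSQ addrC -mulNr -mulrDl PS.
  by rewrite !mulrA.
by apply/eqP; rewrite eq_sym -subr_eq0 PS Z0 !mul0r.
Qed.

(** W has no constant term, so coefficient k of z W involves only earlier coefficients of z, which
    vanish by induction. It serves as the last hypothesis of [manin_inverse], the commutator there
    being divisible by u^2. *)
Lemma pser_contract (B : pzRingType) (W : pser B) :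
  (forall z : B, z + z = 0 -> z = 0) -> pcoef W 0 = 0 ->
  forall z, z + z = z * W -> z = 0.
Proof.
move=> reg W0 z zW; apply: pserP => k; rewrite pcoef0.
elim/ltn_ind: k => k IHk; apply: reg; rewrite -pcoefD zW pcoefM big1 // => i _.
case: (ltnP i k) => [ik|ki]; first by rewrite IHk ?mul0r.
by rewrite (eqP (ki : k - i == 0)%N) W0 mulr0.
Qed.

Section SuperManin.
Variables (R : pzRingType) (d : nat) (par : 'I_d -> bool).
Local Notation I := 'I_d.

Definition scom (a b : bool) (x y : R) : R := x * y - sg (a && b) * (y * x).

(** For purely even indices this is [y_ij, y_kl] = [y_kj, y_il]. *)
Definition smanin (y : I -> I -> R) : Prop := forall i j k l,
  scom (par i (+) par j) (par k (+) par l) (y i j) (y k l)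
  = sg ((par i && par j) (+) (par i && par k) (+) (par j && par k))
    * scom (par k (+) par j) (par i (+) par l) (y k j) (y i l).

Local Notation B := (endo {ffun I * I -> R}).

Fact slot2_subproof (x : 'M[R]_d) :
  zmod_morphism (fun f : {ffun I * I -> R} =>
    [ffun p : I * I => \sum_l x p.2 l * f (p.1, l)]).
Proof.
move=> f g; apply/ffunP => p; rewrite !ffunE -sumrB.
by apply: eq_bigr => l _; rewrite !ffunE mulrBr.
Qed.
Definition slot2 (x : 'M[R]_d) : B := Endo (@slot2_subproof x).

Fact sflip_subproof : zmod_morphism (fun f : {ffun I * I -> R} =>
    [ffun p : I * I => sg (par p.1 && par p.2) * f (p.2, p.1)]).
Proof. by move=> f g; apply/ffunP => p; rewrite !ffunE mulrBr. Qed.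
Definition sflip : B := Endo sflip_subproof.

Lemma sflipK : sflip * sflip = 1.
Proof.
apply: endoP => f; apply/ffunP => -[i k].
by rewrite !endoE /= !ffunE /= [par k && _]andbC sgK.
Qed.

(** Obtained from the second slot by conjugation with the graded flip, so that every sign caused by
    odd indices comes from [sflip]. *)
Definition slot1 (x : 'M[R]_d) : B := sflip * slot2 x * sflip.

Lemma slot2M x y : slot2 (x *m y) = slot2 x * slot2 y.
Proof.
apply: endoP => f; apply/ffunP => -[i k]; rewrite !endoE !ffunE /=.
under [RHS]eq_bigr => l _ do rewrite !ffunE mulr_sumr.
rewrite [RHS]exchange_big; apply: eq_bigr => l _.
rewrite mxE mulr_suml; apply: eq_bigr => h _.
by rewrite mulrA.
Qed.

Lemma slot21 : slot2 1%:M = 1.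
Proof.
apply: endoP => f; apply/ffunP => -[i k]; rewrite !endoE !ffunE /=.
rewrite (bigD1 k) //= big1 ?addr0 => [|l lk].
  by rewrite mxE eqxx mul1r.
by rewrite mxE eq_sym (negPf lk) mul0r.
Qed.

Lemma slot2X x k : slot2 (x ^+ k) = slot2 x ^+ k.
Proof.
elim: k => [|k IHk]; first by rewrite !expr0 slot21.
by rewrite !exprS slot2M IHk.
Qed.

Lemma slot1X x k : slot1 (x ^+ k) = slot1 x ^+ k.
Proof.
rewrite /slot1 slot2X; elim: k => [|k IHk].
  by rewrite !expr0 mulr1 sflipK.
rewrite !exprS -IHk -!mulrA (mulrA sflip sflip) sflipK mul1r.
by rewrite !mulrA.
Qed.

Lemma slot_com x y f i k :
  (slot1 x * slot2 y - slot2 y * slot1 x) f (i, k)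
  = \sum_j \sum_l sg ((par i (+) par j) && par k)
      * scom (par i (+) par j) (par k (+) par l) (x i j) (y k l) * f (j, l).
Proof.
rewrite /slot1 !endoE !ffunE /= mulr_sumr.
have -> : \sum_l y k l * (sflip (slot2 x (sflip f))) (i, l)
  = \sum_j \sum_l sg ((par i (+) par j) && par l) * (y k l * x i j) * f (j, l).
  rewrite exchange_big; apply: eq_bigr => l _; rewrite !ffunE /= !mulr_sumr.
  apply: eq_bigr => j _; rewrite ffunE /= !(sgMMl, sgCA) !mulrA.
  by congr (sg _ * _ * _ * _); case: (par i) (par j) (par l) => [] [] [].
rewrite -sumrB; apply: eq_bigr => j _.
rewrite !ffunE !mulr_sumr -sumrB; apply: eq_bigr => l _.
rewrite /scom mulrBr mulrBl; congr (_ - _).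
  rewrite -!mulrA !(sgMMl, sgCA) !mulrA.
  by congr (sg _ * _ * _ * _); case: (par i) (par j) (par k) => [] [] [].
rewrite -!mulrA !(sgMMl, sgCA) !mulrA; congr (sg _ * _ * _ * _).
by case: (par i) (par j) (par k) (par l) => [] [] [] [].
Qed.

(** On matrix coefficients, the flip on the left exchanges the row indices i and k, which is the
    exchange in [smanin]; the remaining signs agree case by case. *)
Lemma slot_com_manin (x : 'M[R]_d) : smanin x ->
  sflip * (slot1 x * slot2 x - slot2 x * slot1 x)
  = slot1 x * slot2 x - slot2 x * slot1 x.
Proof.
move=> xM; apply: endoP => f; apply/ffunP => -[i k].
rewrite endoM ffunE /= !slot_com mulr_sumr; apply: eq_bigr => j _.
rewrite mulr_sumr; apply: eq_bigr => l _.
rewrite (xM i) -!mulrA !(sgMMl, sgCA) !mulrA; congr (sg _ * _ * _).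
by case: (par i) (par j) (par k) => [] [] [].
Qed.

Hypothesis two_reg : forall z : R, z + z = 0 -> z = 0.

(** (-x)^k, the coefficient of u^k in (1 + u x)^(-1). *)
Definition geom_mx (x : 'M[R]_d) (k : nat) : 'M[R]_d :=
  if odd k then - x ^+ k else x ^+ k.

Definition pgeom_mx (x : 'M[R]_d) (i j : I) : pser R :=
  PSer (fun k => geom_mx x k i j).

Lemma geom_mxE x k i j : geom_mx x k i j = sg (odd k) * (x ^+ k) i j.
Proof. by rewrite /geom_mx; case: (odd k); rewrite ?sg0 ?sg1 ?mul1r // mxE mulN1r. Qed.

Lemma slot2_geom x k : pcoef (pgeom (slot2 x)) k = slot2 (geom_mx x k).
Proof.
rewrite /= -signr_odd /geom_mx; case: (odd k); rewrite ?expr0 ?expr1.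
  rewrite mulN1r -slot2X; apply: endoP => f; apply/ffunP => p.
  by rewrite endoE !ffunE -sumrN; apply: eq_bigr => l _; rewrite mxE mulNr.
by rewrite mul1r slot2X.
Qed.

Lemma slot1_geom x k : pcoef (pgeom (slot1 x)) k = slot1 (geom_mx x k).
Proof.
rewrite /slot1 -slot2_geom /= -signr_odd -sgE -/(slot1 x) -slot1X /slot1 slot2X.
by rewrite -!mulrA sgCA.
Qed.

Lemma pconstM (T : pzRingType) (c : T) f k :
  pcoef (plin c 0 * f) k = c * pcoef f k.
Proof.
case: k => [|k]; first by rewrite pcoefM big_ord1.
by rewrite pcoef_plinM mul0r addr0.
Qed.

Lemma Mpconst (T : pzRingType) (c : T) f k :
  pcoef (f * plin c 0) k = pcoef f k * c.
Proof.
case: k => [|k]; first by rewrite pcoefM big_ord1.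
by rewrite pcoef_Mplin mulr0 addr0.
Qed.

Lemma plin_com (T : pzRingType) (y z : T) :
  plin 1 y * plin 1 z - plin 1 z * plin 1 y
  = PSer (fun k => if k == 2 then y * z - z * y else 0).
Proof.
apply: pserP => -[|[|k]].
- by rewrite pcoefB !pcoefM !big_ord1 subrr.
- by rewrite pcoefB !pcoef_plinM /=; nring.
- by rewrite pcoefB !pcoef_plinM /=; case: k => [|k] /=; nring.
Qed.

(** [manin_inverse] for power series over operators on functions of two indices: P is the constant
    series [sflip], and a, b are 1 + u x in the two slots. The assertion is the coefficient of
    u^N. *)
Lemma pgeom_mx_manin (x : 'M[R]_d) : smanin x -> forall N i j k l,
  \sum_(p < N.+1) scom (par i (+) par j) (par k (+) par l)
     (geom_mx x p i j) (geom_mx x (N - p) k l)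
  = sg ((par i && par j) (+) (par i && par k) (+) (par j && par k)) *
   \sum_(p < N.+1) scom (par k (+) par j) (par i (+) par l)
     (geom_mx x p k j) (geom_mx x (N - p) i l).
Proof.
move=> xM N i j k l.
have breg (z : B) : z + z = 0 -> z = 0.
  move=> zz; apply: endoP => f; apply/ffunP => p; rewrite endo0 ffunE.
  apply: two_reg; move/(congr1 (fun z : B => z f p)): zz.
  by rewrite endoD endo0 !ffunE.
have PaP : plin sflip 0 * plin 1 (slot1 x) * plin sflip 0 = plin 1 (slot2 x).
  apply: pserP => n; rewrite Mpconst pconstM.
  case: n => [|[|n]] /=; rewrite ?mulr1 ?sflipK ?mulr0 ?mul0r //.
  by rewrite /slot1 !mulrA sflipK mul1r -mulrA sflipK mulr1.
have PP : plin sflip 0 * plin sflip 0 = 1 :> pser B.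
  apply: pserP => n; rewrite pconstM.
  by case: n => [|[|n]] /=; rewrite ?sflipK ?mulr0.
have PQ : plin sflip 0 * (plin 1 (slot1 x) * plin 1 (slot2 x)
      - plin 1 (slot2 x) * plin 1 (slot1 x))
    = plin 1 (slot1 x) * plin 1 (slot2 x) - plin 1 (slot2 x) * plin 1 (slot1 x).
  rewrite plin_com; apply: pserP => n; rewrite pconstM /=.
  by case: eqP => _; rewrite ?slot_com_manin // mulr0.
have := manin_inverse PP PaP (plinK _) (pgeomK _) (plinK _) (pgeomK _) PQ.
move=> /(_ (pser_contract breg _)); rewrite plin_com pcoefM big_ord1 /= mulr0.
move=> /(_ erefl).
(* Applying an operator to the delta function at (j, l) reads off its matrix entries in that
   column. *)
pose f0 : {ffun I * I -> R} := [ffun p => (p == (j, l))%:R].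
have f0E (F : I -> I -> R) : \sum_j' \sum_l' F j' l' * f0 (j', l') = F j l.
  rewrite (bigD1 j) //= (bigD1 l) //= ffunE eqxx mulr1 !big1 ?addr0 //.
    move=> j' jj'; rewrite big1 // => l' _; rewrite ffunE xpair_eqE.
    by rewrite (negPf jj') mulr0.
  by move=> l' ll'; rewrite ffunE xpair_eqE (negPf ll') andbF mulr0.
move/(congr1 (fun z : pser B => pcoef z N f0 (i, k))).
have E (i' k' : I) : pcoef (pgeom (slot1 x) * pgeom (slot2 x)
      - pgeom (slot2 x) * pgeom (slot1 x)) N f0 (i', k')
    = sg ((par i' (+) par j) && par k') * \sum_(p < N.+1)
       scom (par i' (+) par j) (par k' (+) par l)
     (geom_mx x p i' j) (geom_mx x (N - p) k' l).
  rewrite pcoefB pcoefM pcoefMr -sumrB endo_sum sum_ffunE mulr_sumr.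
  apply: eq_bigr => p _; rewrite !slot1_geom !slot2_geom slot_com.
  by rewrite (f0E (fun j' l' => _ * scom _ _ (geom_mx x p i' j') _)).
rewrite pconstM endoM ffunE /= !E => /(congr1 (GRing.mul (sg ((par i (+) par j) && par k)))).
rewrite sgK sgMMl sgMMl => <-; congr (sg _ * _).
by case: (par i) (par j) (par k) => [] [] [].
Qed.

End SuperManin.

Lemma pcoef_sgM (R : pzRingType) b (f : pser R) k :
  pcoef (sg b * f) k = sg b * pcoef f k.
Proof. by case: b; rewrite ?sg0 ?sg1 ?mul1r ?mulN1r. Qed.

Lemma pcoef_scom (R : pzRingType) a b (f g : pser R) k :
  pcoef (scom a b f g) k = \sum_(i < k.+1) scom a b (pcoef f i) (pcoef g (k - i)).
Proof.
rewrite /scom pcoefB pcoef_sgM pcoefM pcoefMr mulr_sumr -sumrB.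
by [].
Qed.

Lemma smanin_pgeom (R : pzRingType) d (par : 'I_d -> bool) (x : 'M[R]_d) :
  (forall z : R, z + z = 0 -> z = 0) -> smanin par x -> smanin par (pgeom_mx x).
Proof.
move=> reg xM i j k l; apply: pserP => N.
by rewrite pcoef_sgM !pcoef_scom pgeom_mx_manin.
Qed.

(** The coefficient of u^N in the Manin relation of the inverse: every product there carries (-1)^p
    (-1)^(N - p) = (-1)^N, a common factor. *)
Lemma smanin_expr (R : pzRingType) d (par : 'I_d -> bool) (x : 'M[R]_d) :
  (forall z : R, z + z = 0 -> z = 0) -> smanin par x -> forall N i j k l,
  \sum_(p < N.+1) scom (par i (+) par j) (par k (+) par l)
     ((x ^+ p) i j) ((x ^+ (N - p)) k l)
  = sg ((par i && par j) (+) (par i && par k) (+) (par j && par k)) *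
   \sum_(p < N.+1) scom (par k (+) par j) (par i (+) par l)
     ((x ^+ p) k j) ((x ^+ (N - p)) i l).
Proof.
move=> reg xM N i j k l.
have E a b i' j' k' l' :
  \sum_(p < N.+1) scom a b ((x ^+ p) i' j') ((x ^+ (N - p)) k' l')
  = sg (odd N) * \sum_(p < N.+1) scom a b (geom_mx x p i' j') (geom_mx x (N - p) k' l').
  rewrite mulr_sumr; apply: eq_bigr => p _.
  have -> : odd N = odd (N - p) (+) odd p by rewrite -oddD subnK // -ltnS.
  rewrite /scom !geom_mxE; case: (odd p) (odd (N - p)) (a && b) => [] [] [];
  by rewrite ?sg0 ?sg1; nring.
by rewrite !E (pgeom_mx_manin reg xM) sgCA.
Qed.

(** * Super wedge products over noncommutative rings *)

Section Gsplit.
Variables (T : Type) (V : zmodType).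
Implicit Types (p q : seq T) (F G : seq T -> T -> seq T -> V).

(* The sum of F p1 i p2 over all decompositions p = p1 ++ i :: p2. *)
Fixpoint gsplit F p : V :=
  if p is i :: p' then F [::] i p' + gsplit (fun p1 => F (i :: p1)) p' else 0.

Lemma eq_gsplit F G p :
  (forall p1 i p2, p = p1 ++ i :: p2 -> F p1 i p2 = G p1 i p2) ->
  gsplit F p = gsplit G p.
Proof.
elim: p F G => //= i p IHp F G FG; congr (_ + _); first exact: FG.
by apply: IHp => p1 j p2 pE; apply: FG; rewrite pE.
Qed.

Lemma gsplitD F G p :
  gsplit (fun p1 i p2 => F p1 i p2 + G p1 i p2) p = gsplit F p + gsplit G p.
Proof.
elim: p F G => [|i p IHp] F G /=; first by rewrite addr0.
by rewrite IHp addrACA.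
Qed.

Lemma gsplit_rcons F p j :
  gsplit F (rcons p j)
  = gsplit (fun p1 i p2 => F p1 i (rcons p2 j)) p + F p j [::].
Proof.
elim: p F => [|i p IHp] F /=; first by rewrite addr0 add0r.
by rewrite IHp addrA.
Qed.

End Gsplit.

Section Wedge.
Variables (R : pzRingType) (T : Type) (par : T -> bool) (eps : bool).
Implicit Types (p q : seq T) (f g : seq T -> R) (v w : T -> R) (d e t : bool).

Definition wpar p : bool := \big[addb/false]_(i <- p) par i.

Lemma wpar_nil : wpar [::] = false. Proof. exact: big_nil. Qed.
Lemma wpar_cons i p : wpar (i :: p) = par i (+) wpar p.
Proof. exact: big_cons. Qed.
Lemma wpar_cat p q : wpar (p ++ q) = wpar p (+) wpar q.
Proof. exact: big_cat. Qed.
Lemma wpar_rcons i p : wpar (rcons p i) = par i (+) wpar p.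
Proof. by rewrite -cats1 wpar_cat wpar_cons /wpar big_nil addbF addbC. Qed.

(* f stands for a tensor f(i_1, ..., i_k) psi_{i_1} ... psi_{i_k} of parity d, *)
(* v for the vector sum_i psi_i v(i); eps is true for exterior powers and      *)
(* false for symmetric powers.                                                 *)
Fixpoint wedge d f v p : R :=
  if p is i :: p' then
    sg ((eps && odd (size p')) (+) (par i && d)) * f p' * v i
    + wedge (d (+) par i) (fun q => f (i :: q)) v p'
  else 0.

Lemma wedge_split d f v p :
  wedge d f v p = gsplit (fun p1 i p2 =>
    sg ((eps && odd (size p2)) (+) (par i && (wpar p1 (+) d)))
      * f (p1 ++ p2) * v i) p.
Proof.
elim: p d f => //= i p IHp d f; rewrite IHp wpar_nil addFb; congr (_ + _).
apply: eq_gsplit => p1 k p2 _; rewrite wpar_cons.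
by congr (sg _ * _ * _); case: (par k) (par i) (wpar p1) d => [] [] [] [].
Qed.

Lemma eq_wedge d f g v w p :
  (forall q, size q = (size p).-1 -> f q = g q) -> v =1 w ->
  wedge d f v p = wedge d g w p.
Proof.
move=> fg vw; rewrite !wedge_split; apply: eq_gsplit => p1 i p2 pE.
by rewrite fg ?vw // pE !size_cat /= addnS.
Qed.

Lemma wedgeDl d f g v p :
  wedge d (fun q => f q + g q) v p = wedge d f v p + wedge d g v p.
Proof.
elim: p d f g => [|i p IHp] d f g /=; first by rewrite addr0.
by rewrite IHp mulrDr mulrDl addrACA.
Qed.

Lemma wedgeMl d x f v p : (forall i b, x * sg b * v i = sg b * x * v i) ->
  wedge d (fun q => x * f q) v p = x * wedge d f v p.
Proof.
move=> xC; elim: p d f => [|i p IHp] d f /=; first by rewrite mulr0.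
by rewrite IHp mulrDr; congr (_ + _); rewrite !mulrA sgC.
Qed.

Lemma wedgeDr d f v w p :
  wedge d f (fun i => v i + w i) p = wedge d f v p + wedge d f w p.
Proof.
elim: p d f => [|i p IHp] d f /=; first by rewrite addr0.
by rewrite IHp mulrDr addrACA.
Qed.

Lemma wedgeMr d f v x p : wedge d f (fun i => v i * x) p = wedge d f v p * x.
Proof.
elim: p d f => [|i p IHp] d f /=; first by rewrite mul0r.
by rewrite IHp mulrDl !mulrA.
Qed.

Definition rowanti f : Prop := forall p1 i j p2,
  f (p1 ++ i :: j :: p2)
  = sg (eps (+) (par i && par j)) * f (p1 ++ j :: i :: p2).

(** Among the terms of [wedge], those splitting off i and j trade places under the exchange; all
    other terms inherit the symmetry from f. *)
Lemma rowanti_wedge d f v : rowanti f -> rowanti (wedge d f v).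
Proof.
move=> fA p1; elim: p1 d f fA => [|h p1 IHp] d f fA i j p2 /=; last first.
  rewrite IHp; last by move=> q1 a b q2; apply: (fA (h :: q1)).
  rewrite mulrDr; congr (_ + _); rewrite fA !mulrA -!sgD !size_cat /=.
  by congr (sg _ * _ * _); rewrite addbC.
rewrite mulrDr mulrDr !addrA; congr (_ + _).
  rewrite addrC -!mulrA !(sgMMl, sgCA) !mulrA /=; congr (sg _ * _ * _ + sg _ * _ * _).
    by case: eps (par i) (par j) d (odd _) => [] [] [] [] [].
  by case: eps (par i) (par j) d (odd _) => [] [] [] [] [].
rewrite -wedgeMl; last by move=> k b; rewrite sgC.
have -> : d (+) par i (+) par j = d (+) par j (+) par i by rewrite -!addbA (addbC (par i)).
by apply: eq_wedge => // q _; apply: (fA [::]).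
Qed.

(** The coefficient at the two-letter word i k of the product v w, where v has parity e. Quadratic
    relations between vectors are stated through it. *)
Definition pairq e v w i k : R :=
  sg (eps (+) (par i && e)) * v k * w i + sg (par k && (e (+) par i)) * v i * w k.

Lemma wedge_pairq d f e v w i k p :
  sg (eps (+) (par i && e)) * wedge d f v (k :: p) * w i
    + wedge (d (+) e (+) par i) (fun q => f q * v i) w (k :: p)
  = sg ((eps && odd (size p)) (+) (par k && d)) * f p * pairq e v w i k
    + (sg (eps (+) (par i && e)) * wedge (d (+) par k) (fun q => f (k :: q)) v p * w i
    + wedge (d (+) par k (+) e (+) par i) (fun q => f (k :: q) * v i) w p).
Proof.
rewrite /= /pairq !mulrDr mulrDl -!addrA; congr (_ + _).
  by rewrite -!mulrA !(sgMMl, sgCA) addbC.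
rewrite addrCA; congr (_ + _).
  rewrite -!mulrA !(sgMMl, sgCA); congr (sg _ * _).
  by case: eps (par i) (par k) d e (odd _) => [] [] [] [] [] [].
by congr (_ + wedge _ _ _ _); case: (par i) (par k) d e => [] [] [] [].
Qed.

Lemma wedge2_pairq t e v w e1 v1 w1 d f i p :
  (forall i k, pairq e v w i k = sg t * pairq e1 v1 w1 i k) ->
  sg (eps (+) (par i && e)) * wedge d f v p * w i
    + wedge (d (+) e (+) par i) (fun q => f q * v i) w p
  = sg t * (sg (eps (+) (par i && e1)) * wedge d f v1 p * w1 i
    + wedge (d (+) e1 (+) par i) (fun q => f q * v1 i) w1 p).
Proof.
move=> vw; elim: p d f => [|k p IHp] d f.
  by rewrite /= !(mulr0, mul0r) addr0 mulr0.
rewrite !wedge_pairq IHp vw [in RHS]mulrDr; congr (_ + _).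
by rewrite -!mulrA !(sgMMl, sgCA) addbC.
Qed.

(** Two successive multiplications depend on the two vectors only through [pairq], because each pair
    of positions of p contributes a coefficient of f times one [pairq]. A quadratic relation may
    therefore be used inside any longer product. *)
Lemma wedge2_swap t e v w e1 v1 w1 d f p :
  (forall i k, pairq e v w i k = sg t * pairq e1 v1 w1 i k) ->
  wedge (d (+) e) (wedge d f v) w p
  = sg t * wedge (d (+) e1) (wedge d f v1) w1 p.
Proof.
move=> vw; elim: p d f => [|i p IHp] d f; first by rewrite /= mulr0.
have E e0 v0 w0 : wedge (d (+) e0) (wedge d f v0) w0 (i :: p) =
    sg ((eps && ~~ odd (size p)) (+) (par i && d))
      * (sg (eps (+) (par i && e0)) * wedge d f v0 p * w0 i
        + wedge (d (+) e0 (+) par i) (fun q => f q * v0 i) w0 p)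
    + wedge (d (+) par i (+) e0) (wedge (d (+) par i) (fun q => f (i :: q)) v0) w0 p.
  rewrite /= wedgeDl mulrDr !addrA; congr (_ + _ + _).
  - rewrite -!mulrA !sgMMl; congr (sg _ * _).
    by case: eps (odd _) (par i) d e0 => [] [] [] [] [].
  - rewrite -wedgeMl; last by move=> k b; rewrite sgC.
    case: p IHp => [//|k p] _; apply: eq_wedge => // q /= ->.
    by rewrite /= negbK !mulrA.
  - by congr wedge; case: (par i) d e0 => [] [] [].
by rewrite !E IHp (wedge2_pairq _ _ _ _ vw) [in RHS]mulrDr !sgMMl addbC.
Qed.

Fixpoint wedges d f (vs : seq (bool * (T -> R))) : seq T -> R :=
  if vs is (e, v) :: vs' then wedges (d (+) e) (wedge d f v) vs' else f.

Definition vpar (vs : seq (bool * (T -> R))) : bool :=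
  \big[addb/false]_(v <- vs) v.1.

Lemma wedges_cat d f vs ws :
  wedges d f (vs ++ ws) = wedges (d (+) vpar vs) (wedges d f vs) ws.
Proof.
elim: vs d f => [|[e v] vs IHvs] d f /=; first by rewrite /vpar big_nil addbF.
by rewrite IHvs /vpar big_cons addbA.
Qed.

Lemma wedges_rcons d f vs e v :
  wedges d f (rcons vs (e, v)) = wedge (d (+) vpar vs) (wedges d f vs) v.
Proof. by rewrite -cats1 wedges_cat. Qed.

Lemma eq_wedges d f g vs p : f =1 g -> wedges d f vs p = wedges d g vs p.
Proof.
elim: vs d f g => [|[e v] vs IHvs] d f g fg //=.
by apply: IHvs => q; apply: eq_wedge => [q' _|i]; rewrite ?fg.
Qed.

Lemma wedgesMl d x f vs p : (forall y b, x * (sg b * y) = sg b * (x * y)) ->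
  wedges d (fun q => x * f q) vs p = x * wedges d f vs p.
Proof.
move=> xC; elim: vs d f => [|[e v] vs IHvs] d f //=.
rewrite -IHvs; apply: eq_wedges => q; apply: wedgeMl => i b.
by rewrite -!mulrA xC mulrA.
Qed.

Lemma rowanti_wedges d f vs : rowanti f -> rowanti (wedges d f vs).
Proof.
elim: vs d f => [|[e v] vs IHvs] d f fA //=.
by apply: IHvs; apply: rowanti_wedge.
Qed.

Lemma wedges_swap t d f vs e v e' w e1 v1 e1' w1 ws p :
  (forall i k, pairq e v w i k = sg t * pairq e1 v1 w1 i k) ->
  e (+) e' = e1 (+) e1' ->
  wedges d f (vs ++ (e, v) :: (e', w) :: ws) p
  = sg t * wedges d f (vs ++ (e1, v1) :: (e1', w1) :: ws) p.
Proof.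
move=> vw ee; rewrite !wedges_cat /= -!(addbA _ e) -!(addbA _ e1) ee.
rewrite -wedgesMl; last by move=> y b; rewrite sgCA.
by apply: eq_wedges => q; apply: wedge2_swap.
Qed.

Definition unitf p : R := (nilp p)%:R.

Lemma rowanti_unitf : rowanti unitf.
Proof. by case=> [|h p1] i j p2; rewrite /unitf /nilp /= mulr0. Qed.

Definition wprod vs : seq T -> R := wedges false unitf vs.

End Wedge.

(** * Newton identities *)

Lemma rowanti_move (R : pzRingType) (T : Type) (par : T -> bool) eps (f : seq T -> R) :
  rowanti par eps f -> forall p1 h p2,
  f (p1 ++ h :: p2)
  = sg ((eps && odd (size p2)) (+) (par h && wpar par p2)) * f (p1 ++ rcons p2 h).
Proof.
move=> fA p1 h p2; elim: p2 p1 => [|i p2 IHp] p1 /=.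
  by rewrite wpar_nil !andbF sg0 mul1r.
rewrite fA -cat_rcons IHp sgMMl cat_rcons wpar_cons; congr (sg _ * _).
by case: (eps) (odd _) (par h) (par i) (wpar _ _) => [] [] [] [] [].
Qed.

Lemma gsplitM (R : pzRingType) (T : Type) (F : seq T -> T -> seq T -> R) x y p :
  x * gsplit F p * y = gsplit (fun p1 i p2 => x * F p1 i p2 * y) p.
Proof.
elim: p F => [|i p IHp] F /=; first by rewrite mulr0 mul0r.
by rewrite mulrDr mulrDl IHp.
Qed.

Section Wsum.
Variables (T : finType) (V : zmodType).
Implicit Types (g : seq T -> V).

(* The sum of g over all words of length n. *)
Fixpoint wsum (n : nat) g : V :=
  if n is n'.+1 then \sum_i wsum n' (fun p => g (i :: p)) else g [::].

Lemma eq_wsum n g g' : (forall p, size p = n -> g p = g' p) -> wsum n g = wsum n g'.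
Proof.
elim: n g g' => [|n IHn] g g' gg' /=; first exact: gg'.
by apply: eq_bigr => i _; apply: IHn => p pn; apply: gg'; rewrite /= pn.
Qed.

Lemma wsumD n g g' : wsum n (fun p => g p + g' p) = wsum n g + wsum n g'.
Proof.
elim: n g g' => //= n IHn g g'; rewrite -big_split.
by apply: eq_bigr => i _; rewrite IHn.
Qed.

Lemma wsum_sum n (I : finType) (g : I -> seq T -> V) :
  wsum n (fun p => \sum_i g i p) = \sum_i wsum n (g i).
Proof.
elim: n g => //= n IHn g; rewrite exchange_big.
by apply: eq_bigr => i _; rewrite IHn.
Qed.

Lemma wsum_rcons n g : wsum n.+1 g = \sum_j wsum n (fun p => g (rcons p j)).
Proof.
elim: n g => // n IHn g.
transitivity (\sum_i wsum n.+1 (fun p => g (i :: p))) => //.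
by under eq_bigr => i _ do rewrite IHn; rewrite exchange_big.
Qed.

(** Deleting one letter from the words of length n + 1 produces each pair of a remaining word and a
    deleted letter once for every one of the n + 1 positions. *)
Lemma wsum_gsplit n (F : seq T -> T -> V) :
  wsum n.+1 (gsplit (fun p1 h p2 => F (p1 ++ p2) h))
  = (wsum n (fun p => \sum_h F p h)) *+ n.+1.
Proof.
elim: n F => [|n IHn] F.
  by rewrite /= mulr1n; apply: eq_bigr => i _; rewrite addr0.
rewrite mulrS wsum_sum.
transitivity (\sum_i wsum n.+1 (fun p => F p i
  + gsplit (fun p1 h p2 => F (i :: p1 ++ p2) h) p)) => //.
under eq_bigr => i _ do rewrite wsumD (IHn (fun p => F (i :: p))).
rewrite big_split /= sumrMnl; congr (_ + _ *+ _); rewrite exchange_big /=.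
by apply: eq_bigr => i _; rewrite wsum_sum.
Qed.

End Wsum.

Lemma wsumM (T : finType) (R : pzRingType) n (g : seq T -> R) x :
  wsum n (fun p => g p * x) = wsum n g * x.
Proof.
elim: n g => //= n IHn g; rewrite mulr_suml.
by apply: eq_bigr => i _; rewrite IHn.
Qed.

Lemma Mwsum (T : finType) (R : pzRingType) n (g : seq T -> R) x :
  wsum n (fun p => x * g p) = x * wsum n g.
Proof.
elim: n g => //= n IHn g; rewrite mulr_sumr.
by apply: eq_bigr => i _; rewrite IHn.
Qed.

Section Newton.
Variables (R : pzRingType) (d : nat) (par : 'I_d -> bool) (eps : bool).
Variable x : 'M[R]_d.
Local Notation T := 'I_d.
Local Notation wpar := (wpar par).

Definition col (j : T) : T -> R := fun i => x i j.
Definition cols (q : seq T) : seq (bool * (T -> R)) := [seq (par j, col j) | j <- q].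
(** The coefficient at the word p of the product of the columns listed in q: a super analogue of a
    minor for [eps] true and of a permanent for [eps] false. *)
Definition wdet (q p : seq T) : R := wprod par eps (cols q) p.

Lemma vpar_cols q : vpar (cols q) = wpar q.
Proof. by rewrite /vpar /cols big_map. Qed.

(** Graded commutation of columns. For [eps] true it follows from the Manin relations; for [eps]
    false it will be used for the transposed matrix over the opposite ring. *)
Definition colrel : Prop := forall j l i k,
  pairq par eps (par j) (col j) (col l) i k
  = sg (eps (+) (par j && par l)) * pairq par eps (par l) (col l) (col j) i k.

Hypothesis xrel : colrel.

Lemma wdet_colanti p : rowanti par eps (wdet^~ p).
Proof.
move=> q1 j l q2; rewrite /wdet /wprod /cols !map_cat /=.
by apply: wedges_swap; [exact: xrel | rewrite addbC].
Qed.

Lemma wdet_rowanti q : rowanti par eps (wdet q).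
Proof. exact/rowanti_wedges/rowanti_unitf. Qed.

(** Laplace expansion along the last column. When the deleted row h lies inside p, column h is
    carried to the end by [wdet_colanti], and the same shape returns with h in place of k: this is
    what makes a recurrence possible. *)
Lemma wdet_rcons p k j :
  wdet (rcons p k) (rcons p j)
  = gsplit (fun p1 h p2 => sg (eps (+) par h)
      * wdet (rcons (p1 ++ p2) h) (rcons (p1 ++ p2) j) * x h k) p
    + wdet p p * x j k.
Proof.
rewrite /wdet /wprod /cols map_rcons wedges_rcons wedge_split gsplit_rcons.
rewrite addFb vpar_cols cats0 /= andbF addbb andbF sg0 mul1r; congr (_ + _).
apply: eq_gsplit => p1 h p2 pE; rewrite size_rcons /=.
have -> : wedges par eps false (@unitf R T) [seq (par l, col l) | l <- p] (p1 ++ rcons p2 j)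
  = sg ((eps && odd (size p2)) (+) (par h && wpar p2))
    * wdet (p1 ++ rcons p2 h) (p1 ++ rcons p2 j).
  by rewrite pE; exact: (rowanti_move (wdet_colanti _)).
rewrite mulrA -sgD !rcons_cat pE wpar_cat wpar_cons.
congr (sg _ * _ * _).
by case: (eps) (odd _) (par h) (wpar p1) (wpar p2) => [] [] [] [] [].
Qed.

Definition strx (y : 'M[R]_d) : R := \sum_i sg (par i) * y i i.

Definition wstr n : R := wsum n (fun p => sg (wpar p) * wdet p p).

(** A supertrace over n + 1 slots whose last slot is contracted with y instead of being closed up; y
    = 1 gives [wstr n.+1]. *)
Definition wstr_with n (y : 'M[R]_d) : R :=
  \sum_k \sum_j wsum n (fun p =>
    sg (wpar p (+) par j) * wdet (rcons p k) (rcons p j) * y k j).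

Lemma wstrS n : wstr n.+1 = wstr_with n 1%:M.
Proof.
rewrite /wstr wsum_rcons /wstr_with; apply: eq_bigr => k _.
rewrite (bigD1 k) //= big1 ?addr0 => [|j jk].
  by apply: eq_wsum => p _; rewrite mxE eqxx mulr1 wpar_rcons addbC.
rewrite wsumM mxE eq_sym (negPf jk) mulr0 //.
Qed.

(** In [wdet_rcons] the deleted row j closes the loop to str (x y), while each of the n possible
    positions of h gives the same sum, in which x y has taken the place of y. *)
Lemma wstr_withE n y :
  wstr_with n y = wstr n * strx (x *m y)
    + (if n is n'.+1 then (sg eps * wstr_with n' (x *m y)) *+ n else 0).
Proof.
pose F p1 h k j := sg (wpar p1 (+) par h (+) par j (+) (eps (+) par h))
  * wdet (rcons p1 h) (rcons p1 j) * x h k * y k j.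
have E : wstr_with n y = \sum_k \sum_j
    (wsum n (fun p => sg (wpar p) * wdet p p) * (sg (par j) * (x j k * y k j))
     + wsum n (gsplit (fun p1 h p2 => F (p1 ++ p2) h k j))).
  apply: eq_bigr => k _; apply: eq_bigr => j _; rewrite -wsumM -wsumD.
  apply: eq_wsum => p _; rewrite wdet_rcons mulrDr mulrDl addrC; congr (_ + _).
    by rewrite sgD -!mulrA !(sgMMl, sgCA) addbC.
  rewrite gsplitM; apply: eq_gsplit => p1 h p2 pE.
  rewrite /F -!mulrA sgMMl pE !wpar_cat wpar_cons; congr (sg _ * _).
  by case: (eps) (par h) (par j) (wpar p1) (wpar p2) => [] [] [] [] [].
rewrite {}E; under eq_bigr => k _ do rewrite big_split.
rewrite big_split /=; congr (_ + _).
  rewrite exchange_big /strx mulr_sumr; apply: eq_bigr => j _.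
  by rewrite mxE -!mulr_sumr.
case: n => [|n]; first by rewrite big1 // => k _; rewrite big1.
under eq_bigr => k _ do under eq_bigr => j _ do
  rewrite (wsum_gsplit _ (fun p h => F p h k j)) wsum_sum.
under eq_bigr => k _ do rewrite sumrMnl.
rewrite sumrMnl; congr (_ *+ _); rewrite /wstr_with mulr_sumr.
under eq_bigr => k _ do rewrite exchange_big.
rewrite exchange_big; apply: eq_bigr => h _; rewrite mulr_sumr exchange_big.
apply: eq_bigr => j _; rewrite -wsum_sum -Mwsum; apply: eq_wsum => p _.
rewrite mxE !mulr_sumr; apply: eq_bigr => k _; rewrite /F -!mulrA sgMMl.
by congr (sg _ * _); case: (eps) (par h) (par j) (wpar p) => [] [] [] [].
Qed.

Hypothesis torsion_free : forall (z : R) n, z *+ n.+1 = 0 -> z = 0.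

(** Unrolling [wstr_withE] from y = 1 absorbs one more power of x at each step. The successive
    factors n, n - 1, ... build the quotients of factorials that the normalisation by n! removes. *)
Lemma newton (c : nat -> R) : (forall n, wstr n = c n *+ n`!) ->
  forall n, c n.+1 *+ n.+1
  = \sum_(l < n.+1) sg (eps && odd l) * c (n - l)%N * strx (x ^+ l.+1).
Proof.
move=> cE.
have withE n y : wstr_with n y =
    (\sum_(l < n.+1) sg (eps && odd l) * c (n - l)%N * strx (x ^+ l.+1 *m y)) *+ n`!.
  elim: n y => [|n IHn] y; rewrite wstr_withE cE.
    by rewrite big_ord1 andbF sg0 mul1r addr0 fact0 !mulr1n expr1.
  rewrite IHn [in RHS]big_ord_recl andbF sg0 mul1r subn0 expr1 mulrnDl mulrnAl.
  congr (_ + _); rewrite mulrnAr -mulrnA [(_ * n.+1)%N]mulnC -factS mulr_sumr.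
  congr (_ *+ _); apply: eq_bigr => l _.
  rewrite subSS !mulrA -sgD mulmxA -[_ *m x]/(_ ^+ _ * _) -exprSr.
  by congr (sg _ * _ * _); rewrite /=; case: (eps); case: (odd l).
move=> n; apply/eqP; rewrite -subr_eq0; apply/eqP.
have : (c n.+1 *+ n.+1 - \sum_(l < n.+1) sg (eps && odd l) * c (n - l)%N * strx (x ^+ l.+1))
   *+ n`! = 0.
  rewrite mulrnBl -mulrnA -factS -cE wstrS withE.
  by under [X in _ - X *+ _]eq_bigr => l _ do rewrite -[x ^+ _]mulmx1; rewrite subrr.
by have := fact_gt0 n; case: n`! => // N _; apply: torsion_free.
Qed.

End Newton.

(** * Newton identity for the Berezinian *)

Lemma gsplit_const (T : eqType) (V : zmodType) (g : T -> V) (r : seq T) :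
  gsplit (fun _ k _ => g k) r = \sum_(k <- r) g k.
Proof. by elim: r => [|k r IHr] /=; rewrite ?big_nil ?big_cons ?IHr. Qed.

Lemma gsplit_sum (T : Type) (V : zmodType) (I : Type) (s : seq I)
    (F : I -> seq T -> T -> seq T -> V) r :
  gsplit (fun r1 k r2 => \sum_(c <- s) F c r1 k r2) r
  = \sum_(c <- s) gsplit (F c) r.
Proof.
elim: r F => [|k r IHr] F /=; first by rewrite big1.
by rewrite (IHr (fun c r1 => F c (k :: r1))) big_split.
Qed.

Lemma gsplitN (T : Type) (V : zmodType) (F : seq T -> T -> seq T -> V) r :
  gsplit (fun r1 k r2 => - F r1 k r2) r = - gsplit F r.
Proof.
elim: r F => [|k r IHr] F /=; first by rewrite oppr0.
by rewrite IHr opprD.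
Qed.

(** * Determinants over noncommutative rings as exterior products with even indices *)

Section Alt.
Variables (S : pzRingType) (T : Type).
Implicit Types (v w : T -> S) (vs ws : seq (T -> S)) (p q : seq T).

Definition wedge0 := @wedge S T (fun _ => false) true false.
Definition wedges0 (f : seq T -> S) vs : seq T -> S := foldl wedge0 f vs.
Definition alt vs : seq T -> S := wedges0 (@unitf S T) vs.

Lemma wedge_par0 d d' f v : @wedge S T (fun _ => false) true d f v
  =1 @wedge S T (fun _ => false) true d' f v.
Proof.
by move=> p; elim: p d d' f => //= i p IHp d d' f; congr (_ + _); apply: IHp.
Qed.

Lemma wedge0_cons f v i p :
  wedge0 f v (i :: p)
  = sg (odd (size p)) * f p * v i + wedge0 (fun q => f (i :: q)) v p.
Proof. by rewrite /wedge0 /= addbF. Qed.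

Lemma eq_wedge0 f g v w : f =1 g -> v =1 w -> wedge0 f v =1 wedge0 g w.
Proof. by move=> fg vw p; apply: eq_wedge => // q _. Qed.

Lemma eq_wedges0 f g vs : f =1 g -> wedges0 f vs =1 wedges0 g vs.
Proof.
elim: vs f g => //= v vs IHvs f g fg; apply: IHvs.
exact: eq_wedge0.
Qed.

Lemma wedges0_cons f v vs : wedges0 f (v :: vs) = wedges0 (wedge0 f v) vs.
Proof. by []. Qed.

Lemma wedges0D f g vs p :
  wedges0 (fun q => f q + g q) vs p = wedges0 f vs p + wedges0 g vs p.
Proof.
elim: vs f g => //= v vs IHvs f g; rewrite -IHvs.
by apply: eq_wedges0 => q; apply: wedgeDl.
Qed.

Lemma wedges0Ml x f vs p :
  wedges0 (fun q => x * f q) vs p = x * wedges0 f vs p.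
Proof.
elim: vs f => //= v vs IHvs f; rewrite -IHvs.
by apply: eq_wedges0 => q; apply: wedgeMl => i b; rewrite sgC.
Qed.

Lemma altE vs p : alt vs p
  = wprod (fun _ => false) true [seq (false, v) | v <- vs] p.
Proof.
by rewrite /alt /wprod; elim: vs (@unitf S T) => //= v vs IHvs f.
Qed.

(** The coefficients of v w + w v vanish, the basis vectors anticommuting with each other and
    commuting with the entries. *)
Definition anticomm v w := forall i k,
  v i * w k - v k * w i = - (w i * v k - w k * v i).

Lemma wedges0_pair t v w v1 w1 f ws p :
  (forall i k, v i * w k - v k * w i = sg t * (v1 i * w1 k - v1 k * w1 i)) ->
  wedges0 f (v :: w :: ws) p = sg t * wedges0 f (v1 :: w1 :: ws) p.
Proof.
move=> vw; transitivity (sg t * wedges0 (wedge0 (wedge0 f v1) w1) ws p) => //.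
rewrite -wedges0Ml; apply: (@eq_wedges0 (wedge0 (wedge0 f v) w)) => q.
apply: (@wedge2_swap S T (fun _ => false) true t false v w false v1 w1 false) => i k.
rewrite /pairq /= sg1 sg0 !mulN1r !mul1r !mulNr ![- _ + _]addrC.
exact: vw.
Qed.

Lemma wedges0_swap v w f ws p : anticomm v w ->
  wedges0 f (v :: w :: ws) p = - wedges0 f (w :: v :: ws) p.
Proof.
move=> vw; have H i k : v i * w k - v k * w i = sg true * (w i * v k - w k * v i).
  by rewrite vw sg1 mulN1r.
by rewrite (@wedges0_pair true v w w v f ws p H) sg1 mulN1r.
Qed.

Lemma wedges0_cat f vs ws : wedges0 f (vs ++ ws) = wedges0 (wedges0 f vs) ws.
Proof. exact: foldl_cat. Qed.

Lemma alt_swap vs v w ws p : anticomm v w ->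
  alt (vs ++ v :: w :: ws) p = - alt (vs ++ w :: v :: ws) p.
Proof. by move=> vw; rewrite /alt !wedges0_cat wedges0_swap. Qed.

Lemma anticommC v w : anticomm v w -> anticomm w v.
Proof. by move=> vw i k; rewrite vw opprK. Qed.

Lemma alt_move (K : Type) (f : K -> T -> S) vs v (r : seq K) ws p :
  (forall k, anticomm v (f k)) ->
  alt (vs ++ v :: map f r ++ ws) p
  = sg (odd (size r)) * alt (vs ++ map f r ++ v :: ws) p.
Proof.
move=> vf; elim: r vs => [|k r IHr] vs /=; first by rewrite sg0 mul1r.
rewrite alt_swap // -cat_rcons IHr cat_rcons -sgNl //.
Qed.

Lemma alt_slotD vs v w ws p :
  alt (vs ++ (fun i => v i + w i) :: ws) p
  = alt (vs ++ v :: ws) p + alt (vs ++ w :: ws) p.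
Proof.
rewrite /alt !wedges0_cat !wedges0_cons -wedges0D; apply: eq_wedges0 => q.
exact: wedgeDr.
Qed.

Lemma alt_slotN vs v ws p :
  alt (vs ++ (fun i => - v i) :: ws) p = - alt (vs ++ v :: ws) p.
Proof.
apply/eqP; rewrite -addr_eq0 -alt_slotD; apply/eqP.
rewrite /alt wedges0_cat wedges0_cons.
have -> : wedges0 (wedge0 (wedges0 (@unitf S T) vs) (fun i => - v i + v i)) ws p
  = wedges0 (fun q => 0 * @unitf S T q) ws p.
  apply: eq_wedges0 => q; rewrite mul0r /wedge0 wedge_split.
  elim: q (wedges0 _ _) => //= i q IHq f; rewrite addNr mulr0 add0r.
  transitivity (gsplit (fun (_ : seq T) (_ : T) (_ : seq T) => (0 : S)) q).
    by apply: eq_gsplit => p1 j p2 _; rewrite addNr mulr0.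
  by elim: {IHq} q => //= j q ->; rewrite addr0.
by rewrite wedges0Ml mul0r.
Qed.

Lemma eq_alt_slot vs v w ws p : v =1 w ->
  alt (vs ++ v :: ws) p = alt (vs ++ w :: ws) p.
Proof. by move=> /funext ->. Qed.

Lemma alt_slot_sum (I : Type) (s : seq I) vs (v : I -> T -> S) ws p :
  alt (vs ++ (fun i => \sum_(c <- s) v c i) :: ws) p
  = \sum_(c <- s) alt (vs ++ v c :: ws) p.
Proof.
elim: s => [|c s IHs].
  rewrite big_nil (@eq_alt_slot _ _ (fun i => - (0 : S) + 0)); last first.
    by move=> i; rewrite big_nil addNr.
  by rewrite alt_slotD alt_slotN addNr.
rewrite big_cons -IHs -alt_slotD; apply: eq_alt_slot => i.
by rewrite big_cons.
Qed.

Lemma alt_lastM vs v x p :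
  alt (rcons vs (fun i => v i * x)) p = alt (rcons vs v) p * x.
Proof. by rewrite /alt -!cats1 !wedges0_cat /= /wedge0 wedgeMr. Qed.

Lemma alt_headM x v vs p :
  alt ((fun i => x * v i) :: vs) p = x * alt (v :: vs) p.
Proof.
transitivity (x * wedges0 (wedge0 (@unitf S T) v) vs p) => //.
rewrite -wedges0Ml /alt wedges0_cons; apply: eq_wedges0 => q.
rewrite /wedge0 !wedge_split -[RHS]mulr1 gsplitM; apply: eq_gsplit => p1 i p2 _.
rewrite /unitf mulr1 !mulrA; congr (_ * _).
by case: (nilp _); rewrite ?mulr1 ?mulr0 ?mul0r // sgC.
Qed.

(** The Leibniz rule distributes [th] over the factors. The initial tensor [unitf] contributes
    nothing because its entries are 0 and 1. *)
Lemma alt_deriv (K : Type) (th : {additive S -> S}) (v : K -> T -> S) (r : seq K) p :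
  (forall x y, th (x * y) = th x * y + x * th y) ->
  th (alt (map v r) p)
  = gsplit (fun r1 k r2 =>
      alt (map v r1 ++ (fun i => th (v k i)) :: map v r2) p) r.
Proof.
move=> thM; rewrite /alt.
have th1 : th 1 = 0 by apply: (addIr (th 1)); rewrite add0r -{3}[1]mulr1 thM mulr1 mul1r.
have thsg b x : th (sg b * x) = sg b * th x.
  by case: b; rewrite ?sg0 ?sg1 ?mul1r ?mulN1r ?raddfN.
have thw f w q : th (wedge0 f w q)
    = wedge0 (fun q => th (f q)) w q + wedge0 f (fun i => th (w i)) q.
  rewrite /wedge0; elim: q f => [|i q IHq] f /=; first by rewrite raddf0 addr0.
  by rewrite raddfD IHq -mulrA thsg thM mulrDr !mulrA addrACA.
have H f : th (wedges0 f (map v r) p) = wedges0 (fun q => th (f q)) (map v r) p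
    + gsplit (fun r1 k r2 => wedges0 f (map v r1 ++ (fun i => th (v k i)) :: map v r2) p) r.
  elim: r f => [|k r IHr] f /=; first by rewrite addr0.
  by rewrite IHr (eq_wedges0 _ (thw _ _)) wedges0D -addrA.
rewrite H; set Z := wedges0 _ _ _.
suff -> : Z = 0 by rewrite add0r.
rewrite /Z -[RHS](mul0r (wedges0 (@unitf S T) (map v r) p)) -wedges0Ml.
by apply: eq_wedges0 => q; rewrite mul0r /unitf; case: (nilp _) => /=; rewrite ?raddf0.
Qed.

Hypothesis two_reg : forall z : S, z + z = 0 -> z = 0.

Lemma alt_repeat vs v ws p : anticomm v v -> alt (vs ++ v :: v :: ws) p = 0.
Proof.
move=> vv; apply: two_reg; rewrite {1}alt_swap //.
by rewrite addNr.
Qed.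

Lemma alt_dupr (K : eqType) (v : K -> T -> S) vs (r : seq K) l ws p :
  (forall k, anticomm (v l) (v k)) -> l \in r ->
  alt (vs ++ map v r ++ v l :: ws) p = 0.
Proof.
move=> vA /path.splitPr [r1 r2].
rewrite map_cat map_cons -catA cat_cons (catA vs) alt_move //.
by rewrite (catA (vs ++ _)) alt_repeat ?mulr0.
Qed.

Lemma alt_dupl (K : eqType) (v : K -> T -> S) vs (r : seq K) l ws p :
  (forall k, anticomm (v l) (v k)) -> l \in r ->
  alt (vs ++ v l :: map v r ++ ws) p = 0.
Proof. by move=> vA lr; rewrite alt_move // alt_dupr // mulr0. Qed.

End Alt.

Section Cdet.
Variables (S : pzRingType) (th : {additive S -> S}).
Hypothesis thM : forall x y, th (x * y) = th x * y + x * th y.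
Hypothesis two_reg : forall z : S, z + z = 0 -> z = 0.
Variables (m : nat) (A Z : 'M[S]_m).
Hypothesis thA : forall i j, th (A i j) = A i j - (i == j)%:R.
Hypothesis AZ : A *m Z = 1%:M.
Hypothesis Amanin : forall j l, anticomm (A^~ j) (A^~ l).

(** A noncommutative Jacobi formula. With A = 1 + u X and [th] = u d/du, column k of A becomes A_k -
    e_k; expanding the basis vector e_k in the columns of A leaves only the multiple Z k k of A_k,
    since every other column is already present. *)
Lemma cdet_newton : let cdet := alt [seq A^~ j | j <- enum 'I_m] (enum 'I_m) in
  th cdet = cdet * \sum_j (1 - Z j j).
Proof.
move=> cdet; rewrite alt_deriv // mulr_sumr -big_enum -gsplit_const /=.
apply: eq_gsplit => r1 k r2 rE; rewrite mulrBr mulr1.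
have -> : (fun i => th (A i k)) = (fun i => A i k + - (i == k)%:R).
  by apply/funext => i; rewrite thA.
rewrite alt_slotD alt_slotN; congr (_ - _).
  by rewrite /cdet rE map_cat.
(* A constant vector anticommutes with any vector, so e_k can be carried to the last slot. *)
have dA j : anticomm (fun i : 'I_m => (i == k)%:R) (A^~ j).
  move=> i h /=; case: (i == k); case: (h == k); rewrite /= ?mulr1n ?mulr0n; nring.
rewrite -[map _ r2]cats0 alt_move // catA -map_cat.
(* The expansion e_k = sum_l A_l Z_lk has its coefficients on the right, and only from the last slot
   can they leave the product. *)
rewrite (@eq_alt_slot _ _ _ _ (fun i => \sum_l A i l * Z l k)); last first.
  by move=> i; have /matrixP /(_ i k) := AZ; rewrite !mxE.
rewrite alt_slot_sum (bigD1 k) //= big1 ?addr0 => [|l lk]; last first.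
  rewrite cats1 (@alt_lastM _ _ _ (A^~ l)) -cats1.
  rewrite -[X in alt X]cat0s (@alt_dupr _ _ two_reg _ (fun j => A^~ j)) ?mul0r //.
  have : l \in enum 'I_m by rewrite mem_enum.
  by rewrite rE !mem_cat in_cons (negPf lk).
rewrite cats1 (@alt_lastM _ _ _ (A^~ k)) -cats1 map_cat -catA mulrA.
rewrite -(@alt_move _ _ _ (fun j => A^~ j)) // cats0.
by rewrite /cdet rE map_cat.
Qed.

End Cdet.

Section EtaVariable.
Variables (S : pzRingType) (T : Type).
Implicit Types (v : T -> S) (vs : seq (T -> S)).

(** A new basis vector, indexed by [None], is adjoined. [eta] is this vector, and extended vectors
    have no component along it; reading a coefficient at a word starting with [None] extracts the
    part linear in [eta]. *)
Definition ext v (o : option T) : S := if o is Some j then v j else 0.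
Definition eta (o : option T) : S := if o is None then 1 else 0.

Lemma alt_ext0 vs q : alt (map ext vs) (None :: q) = 0.
Proof.
have H (f : seq (option T) -> S) : (forall q, f (None :: q) = 0) ->
    forall q, wedges0 f (map ext vs) (None :: q) = 0.
  elim: vs f => [|v vs IHvs] f f0 q' //=.
  apply: IHvs => {}q; rewrite wedge0_cons /= mulr0 add0r.
  rewrite (@eq_wedge0 _ _ _ (fun q => 0 * f q) _ (ext v)) //; last first.
    by move=> q2; rewrite mul0r f0.
  by rewrite /wedge0 wedgeMl ?mul0r // => i b; rewrite !mul0r mulr0 mul0r.
by apply: H.
Qed.

Lemma wedge0_map_some (h : seq (option T) -> S) (f : seq T -> S) w q :
  (forall q, h (map Some q) = f q) ->
  wedge0 h w (map Some q) = wedge0 f (fun j => w (Some j)) q.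
Proof.
rewrite /wedge0; elim: q h f => //= i q IHq h f hf; rewrite hf size_map.
by congr (_ + _); apply: IHq => q'; apply: (hf (i :: q')).
Qed.

Lemma alt_eta (ws : seq (option T -> S)) p :
  alt (eta :: ws) (None :: map Some p) = alt [seq (fun j => w (Some j)) | w <- ws] p.
Proof.
have H (f : seq (option T) -> S) (f' : seq T -> S) :
    (forall q, f (None :: map Some q) = f' q) -> (forall q, f (map Some q) = 0) ->
    forall q, wedges0 f ws (None :: map Some q)
      = wedges0 f' [seq (fun j => w (Some j)) | w <- ws] q.
  elim: ws f f' => [|w ws IHws] f f' ff' f0 q //=.
  apply: IHws => {}q.
    rewrite wedge0_cons f0 mulr0 mul0r add0r.
    exact: wedge0_map_some.
  rewrite /wedge0; elim: q f f0 {ff'} => //= i q IHq f f0.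
  rewrite f0 mulr0 mul0r add0r; apply: IHq => q'; exact: (f0 (i :: q')).
apply: H => q.
  rewrite wedge0_cons /= mulr1 /unitf /nilp size_map /wedge0.
  rewrite wedge_split (eq_gsplit (G := fun _ _ _ => 0)); last first.
    by move=> p1 i p2 _; rewrite mulr0 mul0r.
  have -> : gsplit (fun (_ : seq (option T)) _ _ => 0 : S) (map Some q) = 0.
    by elim: {+}q => //= _ q' ->; rewrite addr0.
  by rewrite addr0; case: q => [|i q] /=; rewrite ?sg0 ?mul1r ?mulr0.
rewrite /wedge0 wedge_split; elim: q (@unitf S (option T)) => //= i q IHq f.
by rewrite mulr0 add0r; apply: (IHq (fun q => f (Some i :: q))).
Qed.

Lemma anticomm_eta v : anticomm eta (ext v).
Proof. by case=> [i|] [k|] /=; nring. Qed.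

End EtaVariable.

Arguments ext {S T} v o.
Arguments eta {S T} o.

Section Inner.
Variables (S : pzRingType) (y : S).
Definition inner_der (x : S) : S := y * x - x * y.
Fact inner_der_subproof : zmod_morphism inner_der.
Proof. by move=> u v; rewrite /inner_der; nring. Qed.
HB.instance Definition _ := GRing.isZmodMorphism.Build S S inner_der inner_der_subproof.
Lemma inner_derM u v : inner_der (u * v) = inner_der u * v + u * inner_der v.
Proof. by rewrite /inner_der; nring. Qed.
End Inner.

(** * The row determinant of the odd block of the inverse matrix *)

Section Rdet.
Variables (S : pzRingType) (th : {additive S -> S}).
Hypothesis thM : forall x y, th (x * y) = th x * y + x * th y.
Hypothesis two_reg : forall z : S, z + z = 0 -> z = 0.
Variables (m n : nat).
Local Notation I := 'I_(m + n).
Local Notation par := (fun i : I => (m <= i)%N).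
Local Notation O := (rshift m).
Variables (Y : I -> I -> S) (g : I -> 'I_n -> S).
Hypothesis Ymanin : smanin par Y.
Hypothesis thY : forall i j, th (Y i j) = \sum_c Y i c * Y c j - Y i j.
Hypothesis gY : forall c j, Y c (O j) = \sum_l g c l * Y (O l) (O j).

Definition phi (c : I) : 'I_n -> S := fun j => Y c (O j).
Local Notation phiO := (fun k : 'I_n => phi (O k)).
Definition rdet : S := alt (map phiO (enum 'I_n)) (enum 'I_n).

Let parO (k : 'I_n) : par (O k) = true. Proof. exact: leq_addr. Qed.

Lemma anticomm_phi c k : anticomm (phi c) (phi (O k)).
Proof.
move=> j l; have := Ymanin c (O j) (O k) (O l).
rewrite /scom !parO; case: (m <= c)%N => /=; rewrite sg0 sg1 !mul1r mulN1r.
  by move=> /(canRL (subrK _)) E; rewrite /phi E; nring.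
by move=> /(canRL (subrK _)) E; rewrite /phi E; nring.
Qed.

(** Row [O k] on the odd columns, extended by its entry in column c. The Manin relations between
    column c and the odd columns make these extended rows anticommute, whatever the parity of c. *)
Definition eta_phi c k (o : option 'I_n) : S :=
  ext (phi (O k)) o + Y (O k) c * eta o.

Lemma anticomm_eta_phi c k l : anticomm (eta_phi c k) (eta_phi c l).
Proof.
have H (j : 'I_n) : Y (O k) (O j) * Y (O l) c - Y (O l) c * Y (O k) (O j)
    = - (Y (O l) (O j) * Y (O k) c - Y (O k) c * Y (O l) (O j)).
  have := Ymanin (O k) (O j) (O l) c.
  by rewrite /scom !parO /= !sg0 !mul1r sg1 mulN1r.
have H' (j : 'I_n) : Y (O k) c * Y (O l) (O j) - Y (O l) (O j) * Y (O k) c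
    = - (Y (O l) c * Y (O k) (O j) - Y (O k) (O j) * Y (O l) c).
  have /(canRL (subrK _)) -> := H j; nring.
move=> [i|] [j|]; rewrite /eta_phi /= ?mulr0 ?mulr1 ?addr0 ?add0r.
- exact: anticomm_phi.
- have /(canRL (subrK _)) -> := H i; nring.
- have /(canRL (subrK _)) -> := H' j; nring.
- nring.
Qed.

Definition Vsum c : S := gsplit (fun r1 k r2 =>
  alt (map phiO r1 ++ (fun j => phi c j * Y (O k) c) :: map phiO r2) (enum 'I_n))
  (enum 'I_n).

(** Expand the first extended row. Its ordinary part exchanges with [phi c] and joins the list s.
    Its part Y (O k) c * [eta] exchanges with [phi c], leaving the scalar on the right of [phi c];
    then [eta] moves to the front and is removed, which strips the remaining rows of their [eta]
    parts. *)
Lemma eta_expand c (s r : seq 'I_n) p :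
  alt (map ext (map phiO s) ++ ext (phi c) :: map (eta_phi c) r) (None :: map Some p)
  = - (sg (odd (size s)) * gsplit (fun r1 k r2 =>
    alt (map phiO s ++ map phiO r1 ++ (fun j => phi c j * Y (O k) c)
      :: map phiO r2) p) r).
Proof.
have mapE q : map ext (map phiO q) = map (fun k => ext (phi (O k))) q.
  by rewrite -map_comp.
elim: r s => [|k r IHr] s /=.
  rewrite mulr0 oppr0 -[_ :: _]/(map ext [:: phi c]) -map_cat.
  exact: alt_ext0.
rewrite -cat_rcons alt_slotD !cat_rcons mulrDr opprD addrC; congr (_ + _).
  rewrite /alt wedges0_cat.
  rewrite (@wedges0_pair _ _ true _ _ (@eta S 'I_n) (ext (fun j => phi c j * Y (O k) c))); last first.
    by move=> [i|] [j|] /=; rewrite sg1; nring.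
  rewrite sg1 mulN1r -wedges0_cat -/(alt _); congr (- _).
  rewrite mapE -[LHS](sgK (odd (size s))).
  rewrite -(@alt_move _ _ _ (fun k => ext (phi (O k))) [::]); last first.
    by move=> l; exact: anticomm_eta.
  rewrite cat0s alt_eta map_cat /= -!map_comp; congr (sg _ * alt (_ ++ _ :: _) _).
  apply: eq_map => l; apply/funext => j /=.
  by rewrite /eta_phi /= mulr0 addr0.
rewrite alt_swap; last first.
  move=> [i|] [j|] /=; rewrite ?mulr0 ?mul0r ?subrr ?oppr0 //.
  exact: anticomm_phi.
have -> : map ext (map phiO s) ++ ext (phi (O k)) :: ext (phi c) :: map (eta_phi c) r
  = map ext (map phiO (rcons s k)) ++ ext (phi c) :: map (eta_phi c) r.
  by rewrite !map_rcons cat_rcons.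
rewrite IHr size_rcons /= sgNl opprK; congr (- (sg _ * _)).
by apply: eq_gsplit => r1 l r2 _; rewrite map_rcons cat_rcons.
Qed.

(** Take s empty in [eta_expand] and write [phi c] as the sum of g c l * ([eta_phi c l] - Y (O l) c
    * [eta]). The first summand repeats an extended row and drops out; the second reduces to
    [rdet]. *)
Lemma VsumE c : Vsum c = \sum_l g c l * Y (O l) c * rdet.
Proof.
have := eta_expand c [::] (enum 'I_n) (enum 'I_n); rewrite /= sg0 mul1r.
move=> /(congr1 -%R); rewrite opprK -/(Vsum c) => <-.
have -> : ext (phi c) = (fun o => \sum_l (g c l * eta_phi c l o
    + - (g c l * (Y (O l) c * eta o)))).
  apply/funext => o.
  under eq_bigr => l _ do rewrite /eta_phi mulrDr addrK.
  by case: o => [j|] /=; [rewrite /phi gY | rewrite big1 // => l _; rewrite mulr0].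
rewrite -[_ :: _]cat0s alt_slot_sum -sumrN; apply: eq_bigr => l _.
rewrite alt_slotD alt_slotN !cat0s alt_headM.
rewrite (@alt_headM _ _ (g c l) (fun o => Y (O l) c * eta o)).
rewrite (@alt_headM _ _ (Y (O l) c) eta) alt_eta.
have -> : alt (eta_phi c l :: map (eta_phi c) (enum 'I_n)) (None :: map Some (enum 'I_n)) = 0.
  rewrite -[X in alt X]cat0s -[map _ _]cats0.
  apply: alt_dupl => //; last by rewrite mem_enum.
  by move=> k; apply: anticomm_eta_phi.
rewrite mulr0 add0r opprK mulrA; congr (_ * alt _ _).
rewrite -map_comp; apply: eq_map => k; apply/funext => j /=.
by rewrite /eta_phi /= mulr0 addr0.
Qed.

(** [Vsum] with the scalar on the other side of [phi c]. The derivation [th] produces [Usum], and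
    the commutator with Y c c produces both, so [Usum] can be eliminated. *)
Definition Usum c : S := gsplit (fun r1 k r2 =>
  alt (map phiO r1 ++ (fun j => Y (O k) c * phi c j) :: map phiO r2) (enum 'I_n))
  (enum 'I_n).

(** The Manin relations expand the commutator of Y c c with an entry Y (O k) (O j) as Y c (O j) Y (O
    k) c plus, up to the sign of c, the same product in the other order. Leibniz over the rows does
    the rest. *)
Lemma inner_rdet c :
  Y c c * rdet - rdet * Y c c = sg (par c) * Usum c + Vsum c.
Proof.
rewrite -[LHS]/(inner_der (Y c c) rdet) alt_deriv; last exact: inner_derM.
have -> : sg (par c) * Usum c = gsplit (fun r1 k r2 => sg (par c) *
    alt (map phiO r1 ++ (fun j => Y (O k) c * phi c j) :: map phiO r2) (enum 'I_n))
  (enum 'I_n).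
  by rewrite /Usum; case: (m <= c)%N; rewrite ?sg0 ?sg1 ?mul1r ?mulN1r -?gsplitN;
    apply: eq_gsplit => *; rewrite ?mul1r ?mulN1r.
rewrite -gsplitD; apply: eq_gsplit => r1 k r2 _.
have E j : inner_der (Y c c) (phi (O k) j)
    = sg (par c) * (Y (O k) c * phi c j) + phi c j * Y (O k) c.
  have := Ymanin c c (O k) (O j); rewrite /scom /inner_der /phi !parO.
  case: (m <= c)%N => /=; rewrite sg0 ?sg1 ?mul1r ?mulN1r => ->; nring.
have -> : (fun j => inner_der (Y c c) (phi (O k) j))
    = (fun j => sg (par c) * (Y (O k) c * phi c j) + phi c j * Y (O k) c).
  exact/funext.
rewrite alt_slotD; congr (_ + _).
case: (m <= c)%N; rewrite ?sg0 ?sg1 ?mul1r ?mulN1r.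
  rewrite -alt_slotN; apply: eq_alt_slot => j; exact: mulN1r.
by apply: eq_alt_slot => j; rewrite mul1r.
Qed.

Lemma th_rdet : th rdet = \sum_c Usum c - rdet * n%:R.
Proof.
rewrite /rdet alt_deriv // -gsplit_sum.
have -> : rdet * n%:R = gsplit (fun _ _ _ => rdet) (enum 'I_n).
  by rewrite (gsplit_const (fun _ => rdet)) big_enum sumr_const card_ord mulr_natr.
rewrite -gsplitN -gsplitD; apply: eq_gsplit => r1 k r2 rE.
have -> : (fun j => th (phi (O k) j))
    = (fun j => (\sum_c Y (O k) c * phi c j) + - phi (O k) j).
  by apply/funext => j; rewrite thY.
rewrite alt_slotD alt_slotN alt_slot_sum; congr (_ - _).
by rewrite /rdet rE map_cat.
Qed.

Hypothesis g_odd : forall k l, g (O k) l = (k == l)%:R.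

(** Eliminating [Usum] from [th_rdet] by [inner_rdet] leaves the supertrace of Y on the right. On
    the left remains Y c c - sum_l g c l Y (O l) c, which is zero for odd c and a diagonal entry of
    a Schur complement for even c. *)
Lemma rdet_newton : th rdet =
  - rdet * n%:R - rdet * (\sum_c sg (par c) * Y c c)
  + (\sum_(a < m) (Y (lshift n a) (lshift n a)
      - \sum_l g (lshift n a) l * Y (O l) (lshift n a))) * rdet.
Proof.
have parE (a : 'I_m) : (m <= lshift n a)%N = false by rewrite leqNgt /= ltn_ord.
rewrite th_rdet addrC mulNr -addrA; congr (_ + _).
have U c : Usum c = sg (par c) * (Y c c * rdet - rdet * Y c c - Vsum c).
  by rewrite inner_rdet addrK sgK.
have {}U c : Usum c = - (rdet * (sg (par c) * Y c c))
    + sg (par c) * (Y c c - \sum_l g c l * Y (O l) c) * rdet.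
  rewrite U VsumE -mulr_suml sgCA; case: (m <= c)%N; rewrite ?sg0 ?sg1; nring.
rewrite (eq_bigr _ (fun c _ => U c)) big_split /= sumrN -mulr_sumr; congr (_ + _).
rewrite -mulr_suml big_split_ord /= [X in _ + X]big1 ?addr0 => [|k _].
  by congr (_ * _); apply: eq_bigr => a _; rewrite parE sg0 mul1r.
rewrite (bigD1 k) //= big1 ?addr0 ?g_odd ?eqxx ?mul1r ?subrr ?mulr0 // => l lk.
by rewrite g_odd eq_sym (negPf lk) mul0r.
Qed.

End Rdet.

Module BerezinianNewton.

Section Euler.
Variable R : pzRingType.

(** The derivation u d/du. *)
Definition euler (f : pser R) : pser R := PSer (fun k => pcoef f k *+ k).
Fact euler_subproof : zmod_morphism euler.
Proof. by move=> f g; apply: pserP => k; rewrite /= mulrnBl. Qed.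
HB.instance Definition _ :=
  GRing.isZmodMorphism.Build (pser R) (pser R) euler euler_subproof.

Lemma eulerM f g : euler (f * g) = euler f * g + f * euler g.
Proof.
apply: pserP => k; rewrite /= -sumrMnl -big_split; apply: eq_bigr => i _ /=.
by rewrite mulrnAl mulrnAr -mulrnDr subnKC // -ltnS.
Qed.

Lemma pcoef_bool (b : bool) k : pcoef (b%:R : pser R) k = (b && (k == 0%N))%:R.
Proof. by case: b. Qed.

Lemma plinb_com (a b : bool) (y z : R) :
  plin a%:R y * plin b%:R z - plin b%:R z * plin a%:R y
  = PSer (fun k => if k == 2 then y * z - z * y else 0).
Proof.
apply: pserP => -[|[|k]].
- by rewrite pcoefB !pcoefM !big_ord1 /=; case: a; case: b;
    rewrite /= ?mulr1n ?mulr0n; nring.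
- by rewrite pcoefB !pcoef_plinM /=; case: a; case: b; rewrite /= ?mulr1n ?mulr0n; nring.
- by rewrite pcoefB !pcoef_plinM /=; case: k => [|k] /=; nring.
Qed.

End Euler.

Section Resolvent.
Variables (R : pzRingType) (d : nat) (y : 'M[R]_d).

Definition plin_mx : 'M[pser R]_d := \matrix_(i, j) plin (i == j)%:R (y i j).
Definition res_mx : 'M[pser R]_d := \matrix_(i, j) pgeom_mx y i j.

Lemma geom_mx0 : geom_mx y 0 = 1%:M. Proof. by rewrite /geom_mx expr0. Qed.

Lemma geom_mxS k : geom_mx y k.+1 = - (y *m geom_mx y k).
Proof.
rewrite /geom_mx /= exprS; case: (odd k) => //=.
by rewrite mulmxN opprK.
Qed.

Lemma geom_mxM p q : geom_mx y p *m geom_mx y q = geom_mx y (p + q).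
Proof.
rewrite /geom_mx oddD exprD; case: (odd p); case: (odd q) => //=;
  by rewrite ?mulmxN ?mulNmx ?opprK.
Qed.

Lemma plin_resM : plin_mx *m res_mx = 1%:M.
Proof.
apply/matrixP => i k; rewrite !mxE; apply: pserP => N.
rewrite pcoef_sum pcoef_bool; case: N => [|N].
  under eq_bigr => j _ do rewrite !mxE pcoefM big_ord1 /= geom_mx0.
  rewrite andbT (bigD1 i) //= big1 ?addr0 => [|j ji]; first by rewrite eqxx mul1r mxE.
  by rewrite eq_sym (negPf ji) mul0r.
rewrite andbF; under eq_bigr => j _ do rewrite !mxE pcoef_plinM.
rewrite big_split /= geom_mxS (bigD1 i) //= big1 ?addr0 => [|j ji]; last first.
  by rewrite eq_sym (negPf ji) mul0r.
by rewrite eqxx mul1r !mxE addNr.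
Qed.

Lemma res_plinM : res_mx *m plin_mx = 1%:M.
Proof.
apply/matrixP => i k; rewrite !mxE; apply: pserP => N.
rewrite pcoef_sum pcoef_bool; case: N => [|N].
  under eq_bigr => j _ do rewrite !mxE pcoefM big_ord1 /= geom_mx0.
  rewrite andbT (bigD1 i) //= big1 ?addr0 => [|j ji]; first by rewrite mxE eqxx mul1r.
  by rewrite mxE eq_sym (negPf ji) mul0r.
rewrite andbF; under eq_bigr => j _ do rewrite !mxE pcoef_Mplin.
rewrite big_split /= (bigD1 k) //= big1 ?addr0 => [|j jk]; last first.
  by rewrite (negPf jk) mulr0.
rewrite eqxx mulr1; have -> : geom_mx y N.+1 = - (geom_mx y N *m y).
  rewrite geom_mxS /geom_mx; congr (- _); case: (odd N); rewrite ?mulmxN ?mulNmx.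
    by congr (- _); exact: commrX.
  exact: commrX.
by rewrite !mxE addNr.
Qed.

(** The coefficient of u^N in (1 + u y)^(-2) is (N + 1) (-y)^N, since each of the N + 1 terms of the
    Cauchy product equals (-y)^N. *)
Lemma euler_res i j : euler (res_mx i j) = (res_mx *m res_mx) i j - res_mx i j.
Proof.
apply: pserP => N; rewrite pcoefB [(_ *m _) i j]mxE pcoef_sum !mxE.
under eq_bigr => c _ do rewrite !mxE pcoefM.
rewrite exchange_big /=.
have E (p : 'I_N.+1) : \sum_c pcoef (pgeom_mx y i c) p * pcoef (pgeom_mx y c j) (N - p)
    = geom_mx y N i j.
  have := geom_mxM p (N - p); rewrite subnKC; last by rewrite -ltnS.
  by move=> <-; rewrite mxE.
by rewrite (eq_bigr _ (fun p _ => E p)) sumr_const card_ord mulrS /= addrAC subrr add0r.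
Qed.

End Resolvent.

Lemma smanin_anticomm (R : pzRingType) d (par : 'I_d -> bool) (y : 'M[R]_d) j l :
  smanin par y -> (forall i, par i = false) -> anticomm ((plin_mx y)^~ j) ((plin_mx y)^~ l).
Proof.
move=> yM p0 i k.
have com i' j' k' l' : plin_mx y i' j' * plin_mx y k' l' - plin_mx y k' l' * plin_mx y i' j'
    = plin_mx y k' j' * plin_mx y i' l' - plin_mx y i' l' * plin_mx y k' j'.
  rewrite !mxE !plinb_com; apply: pserP => N /=; case: eqP => // _.
  have := yM i' j' k' l'; rewrite /scom !p0 /= sg0 !mul1r; exact.
have /(canRL (subrK _)) -> := com i j k l; nring.
Qed.

Section BerNewton.
Variables (R : pzRingType) (m n : nat) (x : 'M[R]_(m + n)).
Local Notation par := (fun i : 'I_(m + n) => (m <= i)%N).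
Hypothesis two_reg : forall z : R, z + z = 0 -> z = 0.
Hypothesis xM : smanin par x.

Definition berezinian : pser R :=
  alt [seq (plin_mx (ulsubmx x))^~ j | j <- enum 'I_m] (enum 'I_m)
  * alt [seq (fun j => res_mx x (rshift m k) (rshift m j)) | k <- enum 'I_n] (enum 'I_n).

Let th : {additive pser R -> pser R} := @euler R.
Let X : 'M[pser R]_(m + n) := plin_mx x.
Let Y : 'M[pser R]_(m + n) := res_mx x.
Let A : 'M[pser R]_m := plin_mx (ulsubmx x).
Let Z : 'M[pser R]_m := res_mx (ulsubmx x).
(** Row c of Y on the odd columns is a combination of the odd rows with these coefficients: for even
    c they form the block - Z X_12, read off from the upper right block of X Y = 1. *)
Let g (c : 'I_(m + n)) (l : 'I_n) : pser R :=
  match split c with inl a => - (Z *m ursubmx X) a l | inr k => (k == l)%:R end.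

Lemma ulsub_plin : ulsubmx X = A.
Proof. by apply/matrixP => i j; rewrite !mxE (inj_eq (@lshift_inj _ _)). Qed.

Lemma block_mul (C : 'M[pser R]_(m + n)) :
  X *m C = 1%:M -> A *m ulsubmx C + ursubmx X *m dlsubmx C = 1%:M
    /\ A *m ursubmx C + ursubmx X *m drsubmx C = 0.
Proof.
move=> XC; have := XC; rewrite -{1}(submxK X) -{1}(submxK C) mulmx_block.
rewrite (@scalar_mx_block _ m n 1) ulsub_plin => /eq_block_mx [-> -> _ _].
by [].
Qed.

(** u d/du multiplies the Berezinian on the right by str (1 - Y), with Y = (1 + u x)^(-1). The trace
    of Z from [cdet_newton] and the one from [rdet_newton] meet between the two determinants and
    cancel. Coefficients of u^(k+1) are compared at the end. *)
Lemma ber_newton k : pcoef berezinian k.+1 *+ k.+1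
  = \sum_(l < k.+1) sg (odd l) * pcoef berezinian (k - l)%N * strx par (x ^+ l.+1).
Proof.
have preg := pser_two_reg two_reg.
have [XY1 XY2] := block_mul (plin_resM x).
have ZA : Z *m A = 1%:M by exact: res_plinM.
(* Block inversion: the Schur complement of the odd block of Y is the inverse Z of the even block of
   X. *)
have E1 : ulsubmx Y - - (Z *m ursubmx X) *m dlsubmx Y = Z.
  have := congr1 (mulmx Z) XY1; rewrite mulmxDr !mulmxA ZA mul1mx mulmx1 mulNmx opprK.
  by [].
have E2 : ursubmx Y = - (Z *m ursubmx X) *m drsubmx Y.
  have /eqP := congr1 (mulmx Z) XY2.
  by rewrite mulmxDr !mulmxA ZA mul1mx mulmx0 mulNmx addr_eq0 => /eqP.
have gl a l : g (lshift n a) l = (- (Z *m ursubmx X)) a l.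
  rewrite /g -[lshift n a]/(unsplit (inl a)) unsplitK //.
  by rewrite [RHS]mxE.
have gr k' l : g (rshift m k') l = (k' == l)%:R.
  by rewrite /g -[rshift m k']/(unsplit (inr k')) unsplitK.
have cN := @cdet_newton _ th (@eulerM R) preg m A Z.
have /cN {}cN : forall i j, th (A i j) = A i j - (i == j)%:R.
  move=> i j; rewrite !mxE; apply: pserP => N; rewrite pcoefB pcoef_bool /=.
  case: N => [|[|N]] /=; rewrite ?mulr0n ?mulr1n ?andbT ?subrr ?andbF ?subr0 //.
  by rewrite mul0rn.
have /cN {}cN : A *m Z = 1%:M by exact: plin_resM.
have parE (a : 'I_m) : (m <= lshift n a)%N = false by rewrite leqNgt /= ltn_ord.
have AM : smanin (fun _ : 'I_m => false) (ulsubmx x).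
  move=> i j h l; have := xM (lshift n i) (lshift n j) (lshift n h) (lshift n l).
  by rewrite !parE !mxE.
have {}cN := cN (fun j l => smanin_anticomm j l AM (fun _ => erefl)).
have YM : smanin par Y.
  by move=> i j h l; rewrite !mxE; apply: (smanin_pgeom two_reg xM).
have rN : th (alt [seq (fun j => Y (rshift m k) (rshift m j)) | k <- enum 'I_n] (enum 'I_n)) = _
  := @rdet_newton _ th (@eulerM R) preg m n Y g YM _ _ _.
have thB : th berezinian = berezinian * \sum_c sg (par c) * (1 - Y c c).
  have thM : forall f g, th (f * g) = th f * g + f * th g := @eulerM R.
  rewrite /berezinian thM cN rN; last 3 first.
  - by move=> i j; rewrite [LHS]euler_res mxE.
  - move=> c j; case: (splitP c) => [a ca|k' ck].
      have -> : c = lshift n a by apply: val_inj.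
      under eq_bigr => l _ do rewrite gl.
      have := congr1 (fun B : 'M_(m, n) => B a j) E2.
      by rewrite mxE [RHS]mxE mxE => ->; apply: eq_bigr => l _; rewrite [drsubmx _ _ _]mxE [dsubmx _ _ _]mxE.
    have -> : c = rshift m k' by apply: val_inj.
    rewrite (bigD1 k') //= big1 ?addr0 ?gr ?eqxx ?mul1r // => l lk.
    by rewrite gr eq_sym (negPf lk) mul0r.
  - by [].
  set D := alt _ (enum 'I_n); set Ct := alt _ (enum 'I_m).
  have -> : \sum_(a < m) (Y (lshift n a) (lshift n a)
      - \sum_l g (lshift n a) l * Y (rshift m l) (lshift n a)) = \sum_a Z a a.
    apply: eq_bigr => a _; have := congr1 (fun B : 'M_m => B a a) E1.
    rewrite mxE [ulsubmx _ _ _]mxE [usubmx _ _ _]mxE [(- (_ *m _)) a a]mxE => <-.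
    rewrite [(_ *m dlsubmx Y) a a]mxE; congr (_ - _); apply: eq_bigr => l _.
    by rewrite gl [dlsubmx Y _ _]mxE [dsubmx Y _ _]mxE.
  have -> : \sum_c sg (par c) * (1 - Y c c)
      = m%:R - n%:R - \sum_c sg (par c) * Y c c.
    under eq_bigr => c _ do rewrite mulrBr mulr1.
    rewrite sumrB; congr (_ - _); rewrite big_split_ord /=; congr (_ + _).
      by rewrite (eq_bigr (fun _ => 1)) ?sumr_const ?card_ord // => a _; rewrite parE sg0.
    rewrite (eq_bigr (fun _ => - 1)) ?sumr_const ?card_ord ?mulNrn // => k' _.
    by rewrite /= leq_addr sg1.
  have -> : \sum_j (1 - Z j j) = m%:R - \sum_a Z a a.
    by rewrite sumrB sumr_const card_ord.
  have H (D' C' z s : pser R) : C' * (m%:R - z) * D' + C' * (- D' * n%:R - D' * s + z * D')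
      = C' * D' * (m%:R - n%:R - s).
    have -> : C' * (m%:R - z) * D' = C' * (m%:R * D') - C' * z * D' by nring.
    rewrite -(commr_nat D' m); nring.
  exact: H.
rewrite -[LHS]/(pcoef (th berezinian) k.+1) thB pcoefMr big_ord_recl subn0.
have cE l : pcoef (\sum_c sg (par c) * (1 - Y c c)) l
    = if l is l'.+1 then sg (odd l') * strx par (x ^+ l'.+1) else 0.
  rewrite pcoef_sum; case: l => [|l].
    rewrite big1 // => c _; rewrite pcoef_sgM pcoefB mxE /= geom_mx0 mxE eqxx.
    by rewrite subrr mulr0.
  rewrite mulr_sumr; apply: eq_bigr => c _.
  rewrite pcoef_sgM pcoefB mxE /= sub0r geom_mxE /= sgNl opprK.
  by rewrite !sgMMl addbC.
rewrite cE mulr0 add0r; apply: eq_bigr => l _.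
by rewrite cE lift0 subSS sgCA mulrA.
Qed.

End BerNewton.

End BerezinianNewton.
Import BerezinianNewton.

From mathcomp Require Import fingroup perm.
From mathcomp Require Import zify.

(** * Super wedge products as sums over permutations *)

Section LiftPerm.
Variable k : nat.

Definition lift_last (q : 'I_k.+1 * 'S_k) : 'S_k.+1 := lift_perm ord_max q.1 q.2.

Lemma lift_last_bij : bijective lift_last.
Proof.
apply: inj_card_bij; last by rewrite card_prod card_ord !card_Sn factS.
move=> [i s] [j t] /= E.
have ij : i = j by have /permP /(_ ord_max) := E; rewrite /lift_last !lift_perm_id.
rewrite {}ij in E *; congr (_, _); apply/permP => a.
have /permP /(_ (lift ord_max a)) := E.
by rewrite /lift_last !lift_perm_lift => /lift_inj.
Qed.

Lemma sum_lift_last (V : zmodType) (F : 'S_k.+1 -> V) :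
  \sum_s F s = \sum_i \sum_(s : 'S_k) F (lift_perm ord_max i s).
Proof.
rewrite (reindex lift_last) /=; last exact: onW_bij lift_last_bij.
by rewrite pair_bigA.
Qed.

End LiftPerm.

Section WprodPerm.
Variables (R : pzRingType) (T : Type) (par : T -> bool) (eps : bool).

Lemma wedge_enum k d (f : seq T -> R) v (p : 'I_k.+1 -> T) :
  wedge par eps d f v [seq p a | a <- enum 'I_k.+1]
  = \sum_(i < k.+1) sg ((eps && odd (k - i)) (+) (par (p i)
        && (\big[addb/false]_(b < k.+1 | (b < i)%N) par (p b) (+) d)))
      * f [seq p (lift i a) | a <- enum 'I_k] * v (p i).
Proof.
have big0 n (F : 'I_n.+1 -> bool) : \big[addb/false]_(b < n.+1 | (b < 0)%N) F b = false.
  by rewrite big_pred0.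
elim: k d f p => [|k IHk] d f p; rewrite enum_ordSl /= big_ord_recl big0 addFb.
  by rewrite big_ord0 (size0nil (size_enum_ord 0)).
rewrite -map_comp size_map size_enum_ord subn0 (IHk _ _ (p \o lift ord0)).
congr (_ + _).
apply: eq_bigr => i _; rewrite subSS; congr (sg (_ (+) (_ && _)) * f _ * _).
  rewrite [in RHS]big_mkcond big_ord_recl -big_mkcond /= -addbA [RHS]addbC -addbA.
  by congr (_ (+) (_ (+) _)); apply: eq_bigl => b.
rewrite [in RHS]enum_ordSl /= -map_comp; congr (p _ :: _).
  by apply: val_inj.
apply: eq_map => a /=; congr (p _); apply: val_inj => /=.
by rewrite /bump /= ltnS addnA [(1 + _)%N]addnC -addnA.
Qed.

(** The exponent of the Koszul sign that brings the basis vectors psi_{p(s a)} back to the order of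
    p. *)
Definition inv_sign k (s : 'S_k) (p : 'I_k -> bool) : bool :=
  \big[addb/false]_(a < k) \big[addb/false]_(b < k | (a < b)%N && (s b < s a)%N)
    (p (s a) && p (s b)).

(** The exponent of the sign for moving each coefficient, of parity p(s a) + e(a), to the right past
    the later basis vectors psi_{p(s b)}. *)
Definition cross_sign k (s : 'S_k) (p e : 'I_k -> bool) : bool :=
  \big[addb/false]_(a < k) \big[addb/false]_(b < k | (a < b)%N)
    ((p (s a) (+) e a) && p (s b)).

Lemma bigaddb_lift n (i : 'I_n.+1) (F : 'I_n.+1 -> bool) :
  \big[addb/false]_(b < n.+1) F b = F i (+) \big[addb/false]_(c < n) F (lift i c).
Proof. exact: bigD1_ord. Qed.

Lemma bigaddb_recr n (F : 'I_n.+1 -> bool) :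
  \big[addb/false]_(b < n.+1) F b
  = \big[addb/false]_(c < n) F (lift ord_max c) (+) F ord_max.
Proof. by rewrite (bigaddb_lift ord_max) addbC. Qed.

Lemma lift_lt n (i : 'I_n.+1) (a b : 'I_n) : (lift i a < lift i b)%N = (a < b)%N.
Proof. by rewrite /= /bump; case: leqP => ?; case: leqP => ?; lia. Qed.

Lemma lift_max_lt n (a : 'I_n) : (lift ord_max a < (ord_max : 'I_n.+1))%N.
Proof. by rewrite lift_max. Qed.

Lemma max_lift_lt n (a : 'I_n.+1) : ((ord_max : 'I_n.+1) < a)%N = false.
Proof. by rewrite ltnNge -ltnS ltn_ord. Qed.

Lemma inv_sign_lift k (i : 'I_k.+1) (s : 'S_k) (p : 'I_k.+1 -> bool) :
  inv_sign (lift_perm ord_max i s) p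
  = inv_sign s (fun a => p (lift i a))
    (+) \big[addb/false]_(c < k | (i < lift i c)%N) (p (lift i c) && p i).
Proof.
rewrite /inv_sign bigaddb_recr [X in _ (+) X]big1 ?addbF; last first.
  by move=> b; rewrite max_lift_lt.
rewrite [X in _ = _ (+) X](reindex_inj (@perm_inj _ s)) [X in _ = _ (+) X]big_mkcond.
rewrite -big_split; apply: eq_bigr => a _ /=.
rewrite big_mkcond bigaddb_recr lift_max_lt /= !lift_perm_lift lift_perm_id.
congr (_ (+) _); rewrite [RHS]big_mkcond; apply: eq_bigr => b _.
by rewrite lift_perm_lift ?lift_lt; have /= -> := lift_lt ord_max a b.
Qed.

Lemma cross_sign_lift k (i : 'I_k.+1) (s : 'S_k) (p e : 'I_k.+1 -> bool) :
  cross_sign (lift_perm ord_max i s) p e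
  = cross_sign s (fun a => p (lift i a)) (fun a => e (lift ord_max a))
    (+) \big[addb/false]_(c < k) ((p (lift i c) (+) e (lift ord_max (s^-1%g c))) && p i).
Proof.
rewrite /cross_sign bigaddb_recr [X in _ (+) X]big1 ?addbF; last first.
  by move=> b; rewrite max_lift_lt.
rewrite [X in _ = _ (+) X](reindex_inj (@perm_inj _ s)).
rewrite -big_split; apply: eq_bigr => a _ /=.
rewrite big_mkcond bigaddb_recr lift_max_lt /= !lift_perm_lift lift_perm_id permK.
congr (_ (+) _); rewrite [RHS]big_mkcond; apply: eq_bigr => b _.
by rewrite lift_perm_lift ?lift_lt; have /= -> := lift_lt ord_max a b.
Qed.

(** Indices above i occur in both sums on the left and cancel in pairs, which leaves those below i,
    as in the sign of [wedge_enum]. *)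
Lemma sign_collect k (i : 'I_k.+1) (s : 'S_k) (p : 'I_k.+1 -> bool) (e : 'I_k -> bool) :
  \big[addb/false]_(c < k | (i < lift i c)%N) (p (lift i c) && p i)
    (+) \big[addb/false]_(c < k) ((p (lift i c) (+) e (s^-1%g c)) && p i)
  = p i && (\big[addb/false]_(b < k.+1 | (b < i)%N) p b
      (+) \big[addb/false]_(a < k) e a).
Proof.
rewrite -!big_distrl /= -andb_addl andbC; congr (_ && _).
rewrite big_split /= addbA; congr (_ (+) _); last first.
  by rewrite (reindex_inj (@perm_inj _ s)); apply: eq_bigr => a _; rewrite permK.
rewrite [RHS]big_mkcond (bigaddb_lift i) ltnn addFb big_mkcond -big_split.
apply: eq_bigr => c _ /=; have : lift i c != i by rewrite eq_sym neq_lift.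
rewrite -val_eqE neq_ltn /=.
by case: ltngtP => //= _ _; rewrite ?addbb ?addbF.
Qed.

(** Induction along [sum_lift_last]: expanding in the last vector chooses the position i from which
    it takes its row index, and the smaller product runs over permutations of the other
    positions. *)
Lemma wprod_perm k (e : 'I_k -> bool) (v : 'I_k -> T -> R) (p : 'I_k -> T) :
  wprod par eps [seq (e a, v a) | a <- enum 'I_k] [seq p a | a <- enum 'I_k]
  = \sum_(s : 'S_k) sg ((eps && s) (+) inv_sign s (par \o p)
        (+) cross_sign s (par \o p) e)
      * \prod_(a < k) v a (p (s a)).
Proof.
elim: k e v p => [|k IHk] e v p.
  rewrite (size0nil (size_enum_ord 0)) (big_pred1 1%g) => [|s]; last first.
    by apply/esym/eqP/permP => -[].
  by rewrite /inv_sign /cross_sign !big_ord0 odd_perm1 andbF sg0 mulr1.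
rewrite {1}enum_ordSr map_rcons -map_comp /wprod wedges_rcons addFb wedge_enum.
rewrite sum_lift_last; apply: eq_bigr => i _.
rewrite -/(wprod par eps _ _).
have wE a : widen_ord (leqnSn k) a = lift ord_max a.
  by apply: val_inj; rewrite /= /bump leqNgt ltn_ord.
have -> : [seq ((fun a => (e a, v a)) \o widen_ord (leqnSn k)) a | a <- enum 'I_k]
  = [seq (e (lift ord_max a), v (lift ord_max a)) | a <- enum 'I_k].
  by apply: eq_map => a /=; rewrite wE.
rewrite (IHk (e \o lift ord_max) (v \o lift ord_max) (p \o lift i)) mulr_sumr mulr_suml.
apply: eq_bigr => s _; rewrite /vpar big_map big_enum /=.
rewrite big_ord_recr /= lift_perm_id !mulrA -!sgD; congr (sg _ * _ * _).
  rewrite inv_sign_lift cross_sign_lift odd_lift_perm oddB; last by rewrite -ltnS.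
  have /= <- := sign_collect i s (par \o p) (e \o lift ord_max).
  have H (a b c A B C D : bool) : a (+) b (+) (C (+) D) (+) (c (+) A (+) B)
      = a (+) b (+) c (+) (A (+) C) (+) (B (+) D).
    by case: a b c A B C D => [] [] [] [] [] [] [].
  rewrite !andb_addr; exact: H.
by apply: eq_bigr => a _; rewrite wE lift_perm_lift.
Qed.

End WprodPerm.

(** * Newton identities for supertraces over permutations *)

Lemma wsum_ffun (T : finType) (V : zmodType) n (g : seq T -> V) :
  wsum n g = \sum_(p : {ffun 'I_n -> T}) g [seq p a | a <- enum 'I_n].
Proof.
elim: n g => [|n IHn] g /=.
  rewrite (big_pred1 [ffun a : 'I_0 => match a with Ordinal _ H => False_rect T (notF H) end]).
    by rewrite (size0nil (size_enum_ord 0)).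
  by move=> p; apply/esym/eqP/ffunP => -[].
pose h (q : T * {ffun 'I_n -> T}) : {ffun 'I_n.+1 -> T} :=
  [ffun a => oapp q.2 q.1 (unlift ord0 a)].
pose h' (p : {ffun 'I_n.+1 -> T}) : T * {ffun 'I_n -> T} :=
  (p ord0, [ffun a => p (lift ord0 a)]).
have hK : cancel h h'.
  move=> [i q]; rewrite /h' /h !ffunE unlift_none; congr (_, _).
  by apply/ffunP => a; rewrite !ffunE liftK.
have h'K : cancel h' h.
  move=> p; apply/ffunP => a; rewrite /h ffunE.
  by case: unliftP => [b ->|->]; rewrite //= ffunE.
rewrite (reindex h) /=; last by apply: onW_bij; exists h'.
rewrite -(pair_bigA _ (fun i q => g [seq h (i, q) a | a <- enum 'I_n.+1])) /=.
apply: eq_bigr => i _; rewrite IHn; apply: eq_bigr => q _.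
rewrite enum_ordSl /= -map_comp ffunE unlift_none; congr (g (_ :: _)).
by apply: eq_map => a; rewrite /= ffunE liftK.
Qed.

Section PermStr.
Variables (R : pzRingType) (d : nat) (par : 'I_d -> bool).
Local Notation I := 'I_d.

(* str P_s x_1 ... x_k, with the sign of s when eps is true. *)
Definition perm_sign k eps (s : 'S_k) (p : {ffun 'I_k -> I}) : bool :=
  \big[addb/false]_(a < k) par (p a) (+) (eps && s)
  (+) inv_sign s (par \o p) (+) cross_sign s (par \o p) (par \o p).

Definition perm_str k eps (x : 'M[R]_d) : R :=
  \sum_(p : {ffun 'I_k -> I}) \sum_(s : 'S_k)
    sg (perm_sign eps s p) * \prod_(a < k) x (p (s a)) (p a).

Lemma wstr_perm k eps x : wstr par eps x k = perm_str k eps x.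
Proof.
rewrite /wstr wsum_ffun; apply: eq_bigr => p _.
have -> : wdet par eps x [seq p a | a <- enum 'I_k] [seq p a | a <- enum 'I_k]
  = wprod par eps [seq (par (p a), col x (p a)) | a <- enum 'I_k] [seq p a | a <- enum 'I_k].
  by rewrite /wdet /cols -map_comp.
rewrite (wprod_perm par eps (fun a => par (p a)) (fun a => col x (p a))) mulr_sumr.
apply: eq_bigr => s _; rewrite sgMMl /wpar big_map big_enum /=.
by rewrite /perm_sign !addbA.
Qed.

Lemma colrel_smanin (x : 'M[R]_d) : smanin par x -> colrel par true x.
Proof.
move=> xM j l i k; have := xM i j k l; rewrite /scom /pairq /col.
move=> /(congr1 (GRing.mul (sg (par k && (par j (+) par i))))).
move/eqP; rewrite -subr_eq0 => /eqP H; apply/eqP; rewrite -subr_eq0; apply/eqP.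
rewrite -[RHS]H; case: (par i) (par j) (par k) (par l) => [] [] [] [] /=;
  rewrite ?sg0 ?sg1; nring.
Qed.

(** The Manin relation is not symmetric under transposition. Over the opposite ring, the columns of
    the transposed matrix satisfy the relations of a symmetric product; the traces with H_k are
    therefore treated in [R^c]. *)
Lemma colrel_conv (x : 'M[R]_d) : smanin par x ->
  @colrel R^c d par false (x^T : 'M[R^c]_d).
Proof.
move=> xM j l i k; have := xM j i l k; rewrite /scom /pairq /col.
move=> /(congr1 (GRing.mul (sg (par l && (par j (+) par i))))).
have sgc b : (sg b : R^c) = (sg b : R) by case: b; rewrite !(sg0, sg1).
rewrite !sgc !mxE.
have cE (a b : R) : (a : R^c) * (b : R^c) = (b * a : R) by [].
rewrite !cE.
move/eqP; rewrite -subr_eq0 => /eqP H; apply/eqP; rewrite -subr_eq0; apply/eqP.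
rewrite -[RHS]oppr0 -[X in _ = - X]H.
by case: (par i) (par j) (par k) (par l) => [] [] [] [] /=;
  rewrite ?sg0 ?sg1; nring.
Qed.

Lemma trmx_conv_exp (x : 'M[R]_d) l i j :
  ((x^T : 'M[R^c]_d) ^+ l) i j = (x ^+ l) j i.
Proof.
elim: l i j => [|l IHl] i j; first by rewrite !expr0 !mxE eq_sym.
rewrite exprS exprSr !mxE; apply: eq_bigr => h _.
by rewrite IHl mxE.
Qed.

Lemma prod_conv k (F : 'I_k -> R) :
  \prod_(a < k) (F a : R^c) = \prod_(a < k) F (rev_ord a).
Proof.
elim: k F => [|k IHk] F; first by rewrite !big_ord0.
rewrite big_ord_recl big_ord_recr /= IHk.
rewrite -[LHS]/((\prod_(a < k) F (lift ord0 (rev_ord a))) * F ord0); congr (_ * F _).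
  apply: eq_bigr => a _; congr F; apply: val_inj => /=.
  by rewrite /bump /=; have := ltn_ord a; lia.
by apply: val_inj => /=; rewrite subnn.
Qed.

(** Both sides are the parity of the second elementary symmetric function of the same bits. Counting
    in [nat] through e_1^2 = 2 e_2 + e_1, valid for bits, avoids tracking the pairs. *)
Lemma pairs_perm k (s : 'S_k) (p : 'I_k -> bool) :
  \big[addb/false]_(a < k) \big[addb/false]_(b < k | (a < b)%N) (p (s a) && p (s b))
  = \big[addb/false]_(a < k) \big[addb/false]_(b < k | (a < b)%N) (p a && p b).
Proof.
have natE (q : 'I_k -> bool) :
    ((\sum_(a < k) q a) ^ 2
     = 2 * (\sum_(a < k) \sum_(b < k | (a < b)%N) (q a && q b)) + \sum_(a < k) q a)%N.
  rewrite expnS expn1 big_distrl /=.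
  transitivity (\sum_(a < k) (\sum_(b < k | (a < b)%N) (q a && q b)
      + \sum_(b < k | (b < a)%N) (q a && q b) + q a))%N.
    apply: eq_bigr => a _; rewrite big_distrr /= (bigD1 a) //= addnC.
    have -> : (q a * q a = q a)%N by case: (q a).
    congr (_ + _)%N; rewrite (bigID (fun b : 'I_k => (a < b)%N)) /=; congr (_ + _)%N.
      apply: eq_big => b; last by rewrite mulnb.
      by rewrite -val_eqE /=; case: ltngtP.
    apply: eq_big => b; last by rewrite mulnb.
    by rewrite -val_eqE /=; case: ltngtP.
  rewrite !big_split /= mul2n -addnn; congr (_ + _ + _)%N.
  rewrite (exchange_big_dep xpredT) //=; apply: eq_bigr => a _.
  by apply: eq_bigr => b _; rewrite andbC.
have oddE (q : 'I_k -> bool) :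
    \big[addb/false]_(a < k) \big[addb/false]_(b < k | (a < b)%N) (q a && q b)
    = odd (\sum_(a < k) \sum_(b < k | (a < b)%N) (q a && q b)).
  rewrite (big_morph odd oddD (erefl _ : odd 0 = false)); apply: eq_bigr => a _.
  rewrite (big_morph odd oddD (erefl _ : odd 0 = false)); apply: eq_bigr => b _.
  by case: (_ && _).
rewrite (oddE (p \o s)) (oddE p); congr odd.
have := natE p; have := natE (p \o s).
have -> : (\sum_(a < k) (p \o s) a = \sum_(a < k) p a)%N.
  by rewrite [RHS](reindex_inj (@perm_inj _ s)).
move=> -> /eqP; rewrite eqn_add2r eqn_pmul2l // => /eqP; exact.
Qed.
End PermStr.

Section Conv.
Variables (R : pzRingType) (d : nat) (par : 'I_d -> bool).
Local Notation I := 'I_d.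

Definition rev_perm k : 'S_k := perm (@rev_ord_inj k).

Lemma rev_permK k : involutive (@rev_perm k).
Proof. by move=> a; rewrite !permE rev_ordK. Qed.

Lemma rev_perm_lt k (a b : 'I_k) : (rev_perm k a < rev_perm k b)%N = (b < a)%N.
Proof. by rewrite !permE /=; have := ltn_ord a; have := ltn_ord b; lia. Qed.

(** Transposing the matrix inverts s, and the opposite ring reverses the order of the factors, which
    conjugates by [rev_perm]. *)
Definition conv_perm k (s : 'S_k) : 'S_k := (rev_perm k * s^-1 * rev_perm k)%g.

Lemma conv_permE k (s : 'S_k) a : conv_perm s a = rev_perm k (s^-1%g (rev_perm k a)).
Proof. by rewrite !permM. Qed.

Lemma inv_sign_conv k (s : 'S_k) (p : 'I_k -> bool) :
  inv_sign (conv_perm s) (fun a => p (s (rev_perm k a))) = inv_sign s p.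
Proof.
rewrite /inv_sign (reindex_inj (@perm_inj _ (s * rev_perm k)%g)).
apply: eq_bigr => a _; rewrite (reindex_inj (@perm_inj _ (s * rev_perm k)%g)).
apply: eq_big => b.
  by rewrite !conv_permE !permM !rev_permK !permK !rev_perm_lt andbC.
by rewrite !conv_permE !permM !rev_permK !permK.
Qed.

Lemma cross_sign_conv k (s : 'S_k) (p : 'I_k -> bool) :
  let q a := p (s (rev_perm k a)) in
  cross_sign (conv_perm s) q q = cross_sign s p p.
Proof.
move=> q.
have -> : cross_sign (conv_perm s) q q
  = \big[addb/false]_(a < k) \big[addb/false]_(b < k | (b < a)%N)
      ((p a (+) p (s a)) && p b).
  rewrite /cross_sign (reindex_inj (@perm_inj _ (rev_perm k))); apply: eq_bigr => a _.
  rewrite (reindex_inj (@perm_inj _ (rev_perm k))); apply: eq_big => b.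
    by rewrite rev_perm_lt.
  by rewrite /q !conv_permE !rev_permK !permKV.
have E1 : \big[addb/false]_(a < k) \big[addb/false]_(b < k | (b < a)%N)
      ((p a (+) p (s a)) && p b)
    = \big[addb/false]_(a < k) \big[addb/false]_(b < k | (a < b)%N)
      (p a && p b (+) p a && p (s b)).
  rewrite (exchange_big_dep xpredT) //=; apply: eq_bigr => a _.
  by apply: eq_bigr => b _; rewrite andb_addl andbC [p (s b) && _]andbC.
have E2 : cross_sign s p p
    = \big[addb/false]_(a < k) \big[addb/false]_(b < k | (a < b)%N)
      (p (s a) && p (s b) (+) p a && p (s b)).
  by apply: eq_bigr => a _; apply: eq_bigr => b _; rewrite andb_addl.
rewrite E1 E2; under eq_bigr => a _ do rewrite big_split.
under [RHS]eq_bigr => a _ do rewrite big_split.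
by rewrite !big_split /= pairs_perm.
Qed.

Lemma perm_str_conv k (x : 'M[R]_d) :
  @perm_str R^c d par k false (x^T : 'M[R^c]_d) = perm_str par k false x.
Proof.
have sgc b : (sg b : R^c) = (sg b : R) by case: b; rewrite !(sg0, sg1).
rewrite /perm_str exchange_big [RHS]exchange_big /=.
have cI : injective (@conv_perm k).
  by move=> s t /mulIg /mulgI /invg_inj.
rewrite (reindex_inj cI); apply: eq_bigr => s _.
pose tr (p : {ffun 'I_k -> I}) : {ffun 'I_k -> I} := [ffun a => p (s (rev_perm k a))].
have trI : injective tr.
  move=> p q /ffunP E; apply/ffunP => a; have := E (rev_perm k (s^-1%g a)).
  by rewrite !ffunE rev_permK permKV.
rewrite (reindex_inj trI); apply: eq_bigr => p _.
have stepc u (A : R) : (sg u : R^c) * (A : R^c) = sg u * A :> R.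
  by rewrite sgc -[LHS]/((A : R) * (sg u : R)) sgC.
rewrite stepc prod_conv; congr (_ * _); last first.
  congr sg; rewrite /perm_sign !andFb !addbF; congr (_ (+) _ (+) _).
  - rewrite [RHS](reindex_inj (@perm_inj _ (rev_perm k * s)%g)).
    by apply: eq_bigr => a _; rewrite ffunE permM.
  - rewrite -[RHS]inv_sign_conv; congr inv_sign.
    by apply/funext => a /=; rewrite ffunE.
  - rewrite -[RHS]cross_sign_conv; congr cross_sign; apply/funext => a /=; by rewrite ffunE.
apply: eq_bigr => a _; rewrite mxE !ffunE conv_permE -[rev_ord a](permE (@rev_ord_inj k)).
by rewrite !rev_permK permKV.
Qed.

Hypothesis two_reg : forall z : R, z + z = 0 -> z = 0.
Hypothesis torsion_free : forall (z : R) n, z *+ n.+1 = 0 -> z = 0.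
Variable x : 'M[R]_d.
Hypothesis xM : smanin par x.

Lemma newton_ext (c : nat -> R) : (forall k, perm_str par k true x = c k *+ k`!) ->
  forall k, c k.+1 *+ k.+1
  = \sum_(l < k.+1) sg (odd l) * c (k - l)%N * strx par (x ^+ l.+1).
Proof.
move=> cE; apply: (newton (colrel_smanin xM) torsion_free) => k.
by rewrite wstr_perm cE.
Qed.

(** [newton] over [R^c] for the transposed matrix. The products are reversed on returning to R,
    which puts the supertraces of powers on the left of c. *)
Lemma newton_sym (c : nat -> R) : (forall k, perm_str par k false x = c k *+ k`!) ->
  forall k, c k.+1 *+ k.+1 = \sum_(l < k.+1) strx par (x ^+ l.+1) * c (k - l)%N.
Proof.
move=> cE k.
have sgc b : (sg b : R^c) = (sg b : R) by case: b; rewrite !(sg0, sg1).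
have mulrn_c (z : R) n : ((z : R^c) *+ n) = (z *+ n : R).
  by elim: n => // n IHn; rewrite !mulrS IHn.
have := @newton R^c d par false (x^T : 'M[R^c]_d) (colrel_conv xM) _ c _ k.
rewrite mulrn_c => ->.
- apply: eq_bigr => l _; rewrite sg0 mul1r.
  rewrite -[LHS]/((@strx R^c d par ((x^T : 'M[R^c]_d) ^+ l.+1) : R) * c (k - l)%N).
  congr (_ * _).
  apply: eq_bigr => i _; rewrite trmx_conv_exp sgc.
  by rewrite -[LHS]/((x ^+ l.+1) i i * sg (par i)) sgC.
- by move=> z n' zn; apply: (torsion_free (n := n')); rewrite -mulrn_c.
- by move=> n'; rewrite wstr_perm perm_str_conv cE mulrn_c.
Qed.

End Conv.

Lemma alt_perm (S : pzRingType) (T : Type) k (v : 'I_k -> T -> S) (p : 'I_k -> T) :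
  alt [seq v a | a <- enum 'I_k] [seq p a | a <- enum 'I_k]
  = \sum_(s : 'S_k) sg s * \prod_(a < k) v a (p (s a)).
Proof.
rewrite altE -map_comp (wprod_perm (fun _ => false) true (fun _ => false)).
apply: eq_bigr => s _; congr (sg _ * _); rewrite /inv_sign /cross_sign.
rewrite !big1 ?addbF // => a _; rewrite big1 // => b _.
Qed.

Lemma berezinian_perm (R : pzRingType) m n (x : 'M[R]_(m + n)) :
  berezinian x
  = (\sum_(s : 'S_m) sg s * \prod_(i < m) plin_mx (ulsubmx x) (s i) i)
  * (\sum_(s : 'S_n) sg s * \prod_(i < n) res_mx x (rshift m i) (rshift m (s i))).
Proof.
rewrite /berezinian -[X in alt _ X * _]map_id alt_perm.
by rewrite -[X in _ * alt _ X]map_id alt_perm.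
Qed.

Lemma newton_unique (R : pzRingType) (s c c' : nat -> R) :
  (forall (z : R) n, z *+ n.+1 = 0 -> z = 0) -> c 0%N = c' 0%N ->
  (forall k, c k.+1 *+ k.+1 = \sum_(l < k.+1) sg (odd l) * c (k - l)%N * s l) ->
  (forall k, c' k.+1 *+ k.+1 = \sum_(l < k.+1) sg (odd l) * c' (k - l)%N * s l) ->
  c =1 c'.
Proof.
move=> tf c0 cE c'E; elim/ltn_ind => -[//|k] IHk.
apply/eqP; rewrite -subr_eq0; apply/eqP; apply: (tf _ k).
rewrite mulrnBl cE c'E -sumrB big1 // => l _.
by rewrite IHk ?subrr // ltnS leq_subr.
Qed.

Lemma perm_str0 (R : pzRingType) d (par : 'I_d -> bool) eps (x : 'M[R]_d) :
  perm_str par 0 eps x = 1.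
Proof.
rewrite -wstr_perm /wstr /= wpar_nil sg0 mul1r /wdet /wprod /=.
by rewrite /unitf.
Qed.

From mathcomp Require Import finmap monalg.

(** * Linear extension and evaluation on the free algebra *)

Section Lext.
Variables (C : fieldType) (X : choiceType) (L : lmodType C).
Implicit Types (x y : free_alg C X) (h : seq X -> L).

Definition lext h x : L := \sum_(w <- msupp x) x@_w *: h w.

Lemma lextEw h (d : {fset {fmonom X}}) x : (msupp x `<=` d)%fset ->
  lext h x = \sum_(w <- d) x@_w *: h w.
Proof.
move=> le; rewrite /lext (big_fset_incl _ le) => //= w wd /mcoeff_outdom ->.
by rewrite scale0r.
Qed.

Lemma lextU h c (w : {fmonom X}) : lext h << c *g w >> = c *: h w.
Proof. by rewrite (lextEw _ msuppU_le) big_seq_fset1 mcoeffUU. Qed.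

Lemma lext_is_linear h : linear (lext h).
Proof.
move=> c x y; pose d := (msupp x `|` msupp y)%fset.
rewrite (@lextEw _ d) ?(@lextEw h d x) ?(@lextEw h d y) ?fsubsetUl ?fsubsetUr //.
  rewrite scaler_sumr -big_split; apply: eq_bigr => w _ /=.
  by rewrite mcoeffD mcoeffZ scalerDl scalerA.
apply: fsubset_trans (msuppD_le _ _) _; apply: fsetSU; exact: msuppZ_le.
Qed.
HB.instance Definition _ h :=
  GRing.isLinear.Build C (free_alg C X) L _ (lext h) (lext_is_linear h).

End Lext.

Section Words.
Variables (C : fieldType) (X : choiceType).

Definition word (w : seq X) : free_alg C X := \prod_(a <- w) letter C a.

Lemma malgUM (c c' : C) (v w : {fmonom X}) :
  << c *g v >> * << c' *g w >> = << c * c' *g mmul v w >> :> free_alg C X.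
Proof. by rewrite malgM_def fgmulUU. Qed.

Lemma wordE (w : {fmonom X}) : << w >> = word w :> free_alg C X.
Proof.
case: w => w; rewrite /word /=; elim: w => [|a w IHw].
  by rewrite big_nil -fmoneE.
rewrite big_cons -IHw /letter malgUM mulr1; congr << _ *g _ >>.
by apply: val_inj; rewrite /= fmM fmU.
Qed.

Lemma malgZU (c d : C) (w : {fmonom X}) :
  c *: << d *g w >> = << c * d *g w >> :> {malg C[{fmonom X}]}.
Proof. by apply/malgP => k; rewrite mcoeffZ !mcoeffU mulrnAr. Qed.

Lemma scale_word c w : c *: word w = << c *g FMonom w >> :> free_alg C X.
Proof.
rewrite -[word w](wordE (FMonom w)); apply: etrans (malgZU c 1 (FMonom w)) _.
by rewrite mulr1.
Qed.

Lemma free_algE (x : free_alg C X) : x = \sum_(w <- msupp x) x@_w *: word w.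
Proof.
rewrite [LHS]monalgE; apply: eq_bigr => w _; rewrite scale_word.
by case: w.
Qed.

(** Linearity is asked as an explicit identity so that the lemma applies to maps such as products or
    composites that carry no packaged structure. *)
Lemma free_alg_ext (L : lmodType C) (F G : free_alg C X -> L) :
  (forall c x y, F (c *: x + y) = c *: F x + F y) ->
  (forall c x y, G (c *: x + y) = c *: G x + G y) ->
  (forall w, F (word w) = G (word w)) -> F =1 G.
Proof.
move=> FL GL FG x.
have z0 (H : free_alg C X -> L) :
    (forall c x y, H (c *: x + y) = c *: H x + H y) -> H 0 = 0.
  move=> HL; have := HL (-1) 0 0; rewrite scaler0 addr0 scaleN1r => E.
  by rewrite {1}E addNr.
rewrite (free_algE x); elim/big_rec: _ => [|w y _ IHy]; first by rewrite !z0.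
by rewrite (FL _ (word w) y) (GL _ (word w) y) IHy FG.
Qed.

Lemma wordM v w : word v * word w = word (v ++ w).
Proof. by rewrite /word big_cat. Qed.

Lemma word_mulZ w c y : word w * (c *: y) = c *: (word w * y).
Proof.
rewrite -[word w](wordE (FMonom w)); move: (FMonom w) y => {}w.
suff H (y : {malg C[{fmonom X}]}) :
    (<< w >> : {malg C[{fmonom X}]}) * (c *: y) = c *: (<< w >> * y) by exact: H.
rewrite [y]monalgE scaler_sumr !mulr_sumr scaler_sumr; apply: eq_bigr => w' _.
by rewrite malgZU !malgUM malgZU !mul1r.
Qed.

Lemma word_cons a w : word (a :: w) = letter C a * word w.
Proof. exact: big_cons. Qed.

Lemma letterE a : letter C a = word [:: a].
Proof. by rewrite /word big_seq1. Qed.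

Lemma word_nil : word [::] = 1.
Proof. exact: big_nil. Qed.

Lemma lext_word (L : lmodType C) (h : seq X -> L) w : lext h (word w) = h w.
Proof. by rewrite -[word w](wordE (FMonom w)) lextU scale1r. Qed.

End Words.

Section Evaluation.
Variables (C : fieldType) (X : choiceType) (M : lmodType C).
Variable A : X -> endo M.
Hypothesis A_lin : forall a c v, A a (c *: v) = c *: A a v.

Definition wop (w : seq X) : M -> M := foldr (fun a f v => A a (f v)) id w.

Lemma wop_lin w c u v : wop w (c *: u + v) = c *: wop w u + wop w v.
Proof.
by elim: w => //= a w ->; rewrite endoDr A_lin.
Qed.

Lemma wop_cat v w u : wop (v ++ w) u = wop v (wop w u).
Proof. by elim: v => //= a v ->. Qed.

Definition evf (x : free_alg C X) (v : M) : M := lext (fun w => wop w v) x.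

Lemma evf_linr x c u v : evf x (c *: u + v) = c *: evf x u + evf x v.
Proof.
rewrite /evf /lext scaler_sumr -big_split; apply: eq_bigr => w _ /=.
by rewrite wop_lin scalerDr !scalerA mulrC.
Qed.

Fact evf_subproof x : zmod_morphism (evf x).
Proof.
by move=> u v; rewrite addrC -scaleN1r evf_linr scaleN1r addrC.
Qed.
Definition ev x : endo M := Endo (evf_subproof x).

Lemma ev_word w v : ev (word C w) v = wop w v.
Proof. exact: lext_word. Qed.

Lemma ev_letter a : ev (letter C a) = A a.
Proof. by apply: endoP => v; rewrite letterE ev_word. Qed.

Lemma evP c x y v : ev (c *: x + y) v = c *: ev x v + ev y v.
Proof. exact: (linearP (lext (fun w => wop w v))). Qed.

Lemma ev1 : ev 1 = 1.
Proof.
by apply: endoP => v; rewrite -(word_nil C X); apply: ev_word.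
Qed.

Lemma evM x y : ev (x * y) = ev x * ev y.
Proof.
apply: endoP => v; rewrite endoM.
apply: (free_alg_ext (F := fun x => ev (x * y) v) (G := fun x => ev x (ev y v))).
- move=> c x1 x2; have -> : (c *: x1 + x2) * y = c *: (x1 * y) + x2 * y.
    by rewrite mulrDl -scalerAl.
  exact: evP.
- move=> c x1 x2; exact: evP.
move=> {x} w; rewrite (ev_word w (ev y v)).
apply: (free_alg_ext (F := fun y => ev (word C w * y) v) (G := fun y => wop w (ev y v))).
- move=> c y1 y2.
  have -> : word C w * (c *: y1 + y2) = c *: (word C w * y1) + word C w * y2.
    rewrite mulrDr; congr (_ + _).
    exact: word_mulZ.
  exact: evP.
- move=> c y1 y2; rewrite (evP c y1 y2 v); exact: wop_lin.
by move=> w'; rewrite wordM (ev_word (w ++ w') v) (ev_word w' v) wop_cat.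
Qed.

Fact ev_zmod_morphism : zmod_morphism ev.
Proof.
move=> x y; apply: endoP => v.
have E : x - y = -1 *: y + x by rewrite addrC; congr (_ + _); exact: esym (scaleN1r y).
by rewrite [x - y]E [LHS](evP (-1) y x v) scaleN1r addrC endoE.
Qed.
Fact ev_monoid_morphism : GRing.monoid_morphism ev.
Proof. by split; [exact: ev1 | exact: evM]. Qed.
End Evaluation.

Module EvaluationMorphism.
Section Packing.
Variables (C : fieldType) (X : choiceType) (M : lmodType C).
Variable A : X -> endo M.
Hypothesis A_lin : forall a c v, A a (c *: v) = c *: A a v.

HB.instance Definition _ :=
  GRing.isZmodMorphism.Build (free_alg C X) (endo M) (ev A_lin) (ev_zmod_morphism A_lin).
HB.instance Definition _ :=
  GRing.isMonoidMorphism.Build (free_alg C X) (endo M) (ev A_lin) (ev_monoid_morphism A_lin).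

Definition ev_rmorphism : {rmorphism free_alg C X -> endo M} := ev A_lin.

End Packing.
End EvaluationMorphism.

(** * Supertraces of tensors *)

Section BoolSums.
Variable k : nat.
Implicit Types (p q : 'I_k -> bool).

Lemma bool_sum_split (F : 'I_k -> 'I_k -> bool) a :
  \big[addb/false]_(b < k) F a b
  = \big[addb/false]_(b < k | (b < a)%N) F a b (+) F a a
    (+) \big[addb/false]_(b < k | (a < b)%N) F a b.
Proof.
rewrite (bigID (fun b : 'I_k => (b < a)%N)) /= -addbA; congr (_ (+) _).
rewrite (bigD1 a) ?ltnn //=; congr (_ (+) _); apply: eq_bigl => b.
by rewrite -val_eqE /=; case: ltngtP.
Qed.

Lemma cross_sign_flip (s : 'S_k) p :
  let q a := p (s a) in
  \big[addb/false]_(a < k) \big[addb/false]_(b < k | (b < a)%N) ((p a (+) q a) && q b)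
  (+) \big[addb/false]_(a < k) (q a && p a (+) p a)
  = \big[addb/false]_(a < k) \big[addb/false]_(b < k | (a < b)%N) ((q a (+) p a) && q b).
Proof.
move=> q.
have qp : \big[addb/false]_(a < k) (p a (+) q a) = false.
  rewrite big_split /= [X in X (+) _](reindex_inj (@perm_inj _ s)).
  exact: addbb.
have all0 : \big[addb/false]_(a < k) \big[addb/false]_(b < k) ((p a (+) q a) && q b) = false.
  under eq_bigr => a _ do rewrite -big_distrr.
  by rewrite -big_distrl /= qp.
have {all0} : \big[addb/false]_(a < k) \big[addb/false]_(b < k | (b < a)%N) ((p a (+) q a) && q b)
    (+) \big[addb/false]_(a < k) ((p a (+) q a) && q a)
    (+) \big[addb/false]_(a < k) \big[addb/false]_(b < k | (a < b)%N) ((p a (+) q a) && q b)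
  = false.
  rewrite -!big_split -[RHS]all0 /=; apply: eq_bigr => a _.
  by rewrite (bool_sum_split (fun a b => (p a (+) q a) && q b)).
have -> : \big[addb/false]_(a < k) ((p a (+) q a) && q a)
   = \big[addb/false]_(a < k) (q a && p a (+) p a).
  have -> : \big[addb/false]_(a < k) ((p a (+) q a) && q a)
    = \big[addb/false]_(a < k) ((q a && p a (+) p a) (+) (p a (+) q a)).
    by apply: eq_bigr => a _; case: (p a) (q a) => [] [].
  by rewrite [LHS]big_split /= qp addbF.
have -> : \big[addb/false]_(a < k) \big[addb/false]_(b < k | (a < b)%N) ((q a (+) p a) && q b)
  = \big[addb/false]_(a < k) \big[addb/false]_(b < k | (a < b)%N) ((p a (+) q a) && q b).
  by apply: eq_bigr => a _; apply: eq_bigr => b _; rewrite [q a (+) _]addbC.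
have K (A B D : bool) : A (+) B (+) D = false -> A (+) B = D by case: A B D => [] [] [].
exact: K.
Qed.

End BoolSums.

Section AbstractTensors.
Variables (E : pzRingType) (m n k : nat) (tw : bool -> E -> E) (T : 'M[E]_(m + n)).
Local Notation I := 'I_(m + n).
Local Notation par := (@par m n).
Local Notation multi := (multi m n k).
Implicit Types (p q s : multi).

(** These are the tensor operations over an arbitrary ring with an arbitrary twist [tw]; about [tw]
    only its effect on signed entries of T and on the coefficients of A_k or H_k is assumed. *)
Definition gtensor_mul (X Y : multi -> multi -> E) : multi -> multi -> E := fun p s =>
  \sum_q (-1) ^+ unit_sign p q s * (tw (multi_par q (+) multi_par s) (X p q) * Y q s).
Definition gtensor1 : multi -> multi -> E := fun p q => (p == q)%:R.
Definition gTslot (a : 'I_k) : multi -> multi -> E := fun p q =>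
  [forall b : 'I_k, (b != a) ==> (p b == q b)]%:R *
    ((-1) ^+ ((par (p a) && par (q a)) (+) par (q a)) * T (p a) (q a)).
Definition gTprod := \big[gtensor_mul/gtensor1]_(a < k) gTslot a.
Definition gtensor_str (X : multi -> multi -> E) : E :=
  \sum_p (-1) ^+ multi_par p * X p p.
Definition gPperm (s : 'S_k) : multi -> multi -> E := fun p q =>
  [forall a : 'I_k, p (s a) == q a]%:R * (-1) ^+ (koszul s q (+) unit_act_sign p q).

Hypothesis twT : forall b (c : bool) e i j,
  tw b (c%:R * ((-1) ^+ nat_of_bool e * T i j))
  = (-1) ^+ (b && (par i (+) par j)) * (c%:R * ((-1) ^+ e * T i j)).

(** Each slot contributes the sign in the definition of T_a and the sign for moving its entry past
    the matrix units of the later slots. *)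
Fixpoint slot_sign p s (r : seq 'I_k) : bool :=
  if r is a :: r' then
    ((par (p a) && par (s a)) (+) par (s a))
    (+) ((par (p a) (+) par (s a)) && \big[addb/false]_(b <- r') (par (p b) (+) par (s b)))
    (+) slot_sign p s r'
  else false.

Lemma eq_slot_sign p q s r : (forall b, b \in r -> p b = q b) ->
  slot_sign p s r = slot_sign q s r.
Proof.
elim: r => //= a r IHr pq; rewrite IHr => [|b br]; last by rewrite pq ?in_cons ?br ?orbT.
rewrite pq ?mem_head //; congr (_ (+) (_ && _) (+) _); apply: eq_big_seq => b br.
by rewrite pq ?in_cons ?br ?orbT.
Qed.

Lemma big_gTslot r p s : pairwise (fun a b : 'I_k => (a < b)%N) r ->
  (\big[gtensor_mul/gtensor1]_(a <- r) gTslot a) p s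
  = [forall b : 'I_k, (b \notin r) ==> (p b == s b)]%:R
    * (sg (slot_sign p s r) * \prod_(a <- r) T (p a) (s a)).
Proof.
elim: r p s => [|a r IHr] p s.
  move=> _; rewrite !big_nil /= sg0 !mulr1 /gtensor1; congr ((nat_of_bool _)%:R).
  apply/eqP/forallP => [-> b|H]; first by rewrite eqxx ?implybT.
  by apply/ffunP => b; apply/eqP; exact: (H b).
rewrite pairwise_cons => /andP[/allP ar rS]; rewrite !big_cons /gtensor_mul.
have anr : a \notin r by apply/negP => /ar; rewrite ltnn.
(* Slot a changes coordinate a only and the slots of r leave it alone, so this is the only
   intermediate index with a nonzero contribution. *)
pose q0 : multi := [ffun b => if b == a then s a else p b].
rewrite (bigD1 q0) //= big1 ?addr0 => [|q qq0]; last first.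
  rewrite IHr // twT.
  case: forallP => [Hp|]; last by rewrite mul0r mulr0 mul0r mulr0.
  case: forallP => [Hq|]; last by rewrite mul0r !mulr0.
  case/eqP: qq0; apply/ffunP => b; rewrite ffunE; case: eqP => [->|/eqP ba].
    by apply/eqP; have := Hq a; rewrite anr.
  by apply/eqP; rewrite eq_sym; have := Hp b; rewrite ba.
have q0a : q0 a = s a by rewrite ffunE eqxx.
have q0b b : b != a -> q0 b = p b by move=> ba; rewrite ffunE (negPf ba).
rewrite IHr // twT q0a.
have -> : [forall b : 'I_k, (b != a) ==> (p b == q0 b)] = true.
  by apply/forallP => b; apply/implyP => ba; rewrite q0b.
have -> : [forall b : 'I_k, (b \notin r) ==> (q0 b == s b)]
    = [forall b : 'I_k, (b \notin a :: r) ==> (p b == s b)].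
  apply: eq_forallb => b; rewrite in_cons; case: (eqVneq b a) => [->|ba] /=.
    by rewrite q0a eqxx implybT.
  by rewrite q0b.
case: forallP => [Hp|]; last by rewrite !mul0r !mulr0.
rewrite !mul1r -!sgE.
have -> : unit_sign p q0 s = false.
  rewrite /unit_sign big1 // => b _; rewrite big1 // => c cb.
  case: (eqVneq b a) => [ba|ba]; last by rewrite q0b // addbb.
  have ca : c != a by apply: contraTneq cb => ->; rewrite ba ltnn.
  rewrite (q0b c) //.
  have cr : c \notin a :: r.
    rewrite in_cons negb_or ca /=; apply/negP => /ar.
    by rewrite -ba ltnNge ltnW.
  by have := Hp c; rewrite cr => /eqP ->; rewrite addbb andbF.
rewrite sg0 mul1r.
have -> : slot_sign q0 s r = slot_sign p s r.
  by apply: eq_slot_sign => b br; rewrite q0b //; apply: contraNneq anr => <-.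
have -> : \prod_(b <- r) T (q0 b) (s b) = \prod_(b <- r) T (p b) (s b).
  by apply: eq_big_seq => b br; rewrite q0b //; apply: contraNneq anr => <-.
rewrite -!mulrA !(sgMMl, sgCA) !mulrA; congr (sg _ * _ * _).
have -> : multi_par q0 (+) multi_par s = \big[addb/false]_(b <- r) (par (p b) (+) par (s b)).
  rewrite /multi_par -big_split /= (bigID (mem r)) /= addbC big1 => [|b br]; last first.
    case: (eqVneq b a) => [->|ba]; first by rewrite q0a addbb.
    rewrite q0b //; have := Hp b; rewrite in_cons (negPf ba) br => /eqP ->.
    exact: addbb.
  rewrite addFb -big_uniq /=; last first.
    by apply: (sorted_uniq (leT := fun a b : 'I_k => (a < b)%N)); [exact: ltn_trans| exact: ltnn | exact: pairwise_sorted].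
  by apply: eq_big_seq => b br; rewrite q0b //; apply: contraNneq anr => <-.
by rewrite /= [_ && (par (p a) (+) _)]andbC; congr (_ (+) _); rewrite addbC.
Qed.

Lemma slot_sign_sum p s r : pairwise (fun a b : 'I_k => (a < b)%N) r ->
  slot_sign p s r
  = \big[addb/false]_(a <- r) ((par (p a) && par (s a)) (+) par (s a))
    (+) \big[addb/false]_(a <- r) \big[addb/false]_(b <- r | (a < b)%N)
      ((par (p a) (+) par (s a)) && (par (p b) (+) par (s b))).
Proof.
elim: r => [|a r IHr] /=; first by rewrite !big_nil.
case/andP=> /allP ar rS; rewrite IHr // !big_cons ltnn.
have -> : \big[addb/false]_(b <- r | (a < b)%N)
     ((par (p a) (+) par (s a)) && (par (p b) (+) par (s b)))
   = (par (p a) (+) par (s a)) && \big[addb/false]_(b <- r) (par (p b) (+) par (s b)).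
  rewrite big_distrr /= [LHS]big_seq_cond [RHS]big_seq; apply: eq_bigl => b.
  by case br: (b \in r) => //=; rewrite ar.
have -> : \big[addb/false]_(c <- r) \big[addb/false]_(b <- a :: r | (c < b)%N)
      ((par (p c) (+) par (s c)) && (par (p b) (+) par (s b)))
   = \big[addb/false]_(c <- r) \big[addb/false]_(b <- r | (c < b)%N)
      ((par (p c) (+) par (s c)) && (par (p b) (+) par (s b))).
  apply: eq_big_seq => c cr; rewrite big_cons ltnNge.
  by rewrite (ltnW (ar c cr)).
by rewrite addbACA.
Qed.

Lemma gTprodE p s : gTprod p s
  = sg (\big[addb/false]_(a < k) ((par (p a) && par (s a)) (+) par (s a))
      (+) \big[addb/false]_(a < k) \big[addb/false]_(b < k | (a < b)%N)
      ((par (p a) (+) par (s a)) && (par (p b) (+) par (s b))))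
    * \prod_(a < k) T (p a) (s a).
Proof.
have rS : pairwise (fun a b : 'I_k => (a < b)%N) (index_enum 'I_k).
  rewrite -sorted_pairwise; last exact: ltn_trans.
  rewrite /index_enum -enumT.
  have := iota_ltn_sorted 0 k; rewrite -val_enum_ord sorted_map.
  exact.
rewrite /gTprod big_gTslot // slot_sign_sum //.
have -> : [forall b : 'I_k, (b \notin index_enum 'I_k) ==> (p b == s b)] = true.
  by apply/forallP => b; rewrite mem_index_enum.
by rewrite mul1r.
Qed.

(** For each s the only surviving intermediate index is q = p o s. The sign for multiplying matrix
    units then cancels the one in [gTprodE], and [cross_sign_flip] turns what remains into
    [perm_sign]. *)
Lemma gtensor_strE (z : E) eps (A : multi -> multi -> E) :
  (forall p q, A p q = z * \sum_(s : 'S_k) sg (eps && s) * gPperm s p q) ->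
  (forall b p q, tw b (A p q) = A p q) ->
  gtensor_str (gtensor_mul A gTprod) = z * perm_str par k eps T.
Proof.
move=> AE twA; rewrite /perm_str mulr_sumr; apply: eq_bigr => p _.
pose ts q := \big[addb/false]_(a < k) ((par (q a) && par (p a)) (+) par (p a))
  (+) \big[addb/false]_(a < k) \big[addb/false]_(b < k | (a < b)%N)
      ((par (q a) (+) par (p a)) && (par (q b) (+) par (p b))).
pose tot q (s : 'S_k) := multi_par p (+) unit_sign p q p (+) (eps && s)
  (+) (koszul s q (+) unit_act_sign p q) (+) ts q.
have E1 q : (-1) ^+ multi_par p * ((-1) ^+ unit_sign p q p
      * (tw (multi_par q (+) multi_par p) (A p q) * gTprod q p))
    = \sum_(s : 'S_k) z * ([forall a : 'I_k, p (s a) == q a]%:R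
        * (sg (tot q s) * \prod_(a < k) T (q a) (p a))).
  rewrite twA AE gTprodE -!sgE sgMMl -mulr_sumr -(mulrA z) -(sgCA _ z).
  congr (z * _); rewrite mulr_suml mulr_sumr.
  apply: eq_bigr => s _; rewrite /gPperm -!sgE; case: forallP => _.
    by rewrite !mul1r -/(ts q) !mulrA -!sgD /tot !addbA.
  by rewrite !mul0r !mulr0 !mul0r mulr0.
rewrite mulr_sumr (eq_bigr _ (fun q _ => E1 q)) exchange_big mulr_sumr /=.
apply: eq_bigr => s _; rewrite -mulr_sumr; congr (z * _).
pose q0 : multi := [ffun a => p (s a)].
rewrite (bigD1 q0) //= [X in _ + X]big1 ?addr0 => [|q qq0]; last first.
  case: (boolP [forall a : 'I_k, p (s a) == q a]) => [/forallP Hp|]; last by rewrite mul0r.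
  by case/eqP: qq0; apply/ffunP => a; rewrite ffunE; apply/eqP; rewrite eq_sym Hp.
have -> : [forall a : 'I_k, p (s a) == q0 a] = true.
  by apply/forallP => a; rewrite ffunE.
rewrite mul1r; congr (sg _ * _); last by apply: eq_bigr => a _; rewrite ffunE.
rewrite /tot /perm_sign -/(multi_par p).
have -> : koszul s q0 = inv_sign s (par \o p).
  by apply: eq_bigr => a _; apply: eq_bigr => b _; rewrite !ffunE.
have us : unit_sign p q0 p = \big[addb/false]_(a < k) \big[addb/false]_(b < k | (a < b)%N)
      ((par (q0 a) (+) par (p a)) && (par (q0 b) (+) par (p b))).
  rewrite /unit_sign (exchange_big_dep xpredT) //=; apply: eq_bigr => a _.
  by apply: eq_bigr => b _; rewrite andbC [par (p b) (+) _]addbC.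
have cs := cross_sign_flip s (par \o p).
have -> : cross_sign s (par \o p) (par \o p) = unit_act_sign p q0
    (+) \big[addb/false]_(a < k) ((par (q0 a) && par (p a)) (+) par (p a)).
  rewrite /cross_sign -[LHS]cs; congr (_ (+) _).
    by apply: eq_bigr => a _; apply: eq_bigr => b _; rewrite !ffunE.
  by apply: eq_bigr => a _; rewrite !ffunE.
have K (a b c d e f g : bool) : a (+) b (+) c (+) (d (+) e) (+) (f (+) b)
    = a (+) c (+) d (+) (e (+) f) by case: a b c d e f => [] [] [] [] [] [].
by rewrite /ts us; exact: (K _ _ _ _ _ _ true).
Qed.

End AbstractTensors.

Section LinearTwist.
Variables (C : fieldType) (E : lalgType C) (tw : bool -> E -> E).
Hypothesis twP : forall b c x y, tw b (c *: x + y) = c *: tw b x + tw b y.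

Lemma tw0 b : tw b 0 = 0.
Proof.
have := twP b (-1) 0 0; rewrite scaler0 addr0 scaleN1r => H.
by rewrite {1}H addNr.
Qed.

Lemma twZ b c x : tw b (c *: x) = c *: tw b x.
Proof. by have := twP b c x 0; rewrite !addr0 tw0 addr0. Qed.

Lemma signZ (b : bool) (x : E) : (-1) ^+ b *: x = (-1) ^+ b * x.
Proof. by case: b; rewrite ?expr0 ?expr1 ?scale1r ?mul1r ?scaleN1r ?mulN1r. Qed.

Lemma boolZ (b : bool) (x : E) : b%:R *: x = b%:R * x.
Proof. by case: b; rewrite ?scale1r ?mul1r ?scale0r ?mul0r. Qed.

Lemma tw_entry b (e s p : bool) x y : tw b x = x -> tw b y = (-1) ^+ (b && p) *: y ->
  (e -> p = false) ->
  tw b (e%:R * x + (-1) ^+ s * y) = (-1) ^+ (b && p) * (e%:R * x + (-1) ^+ s * y).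
Proof.
move=> Ex Ey ep; rewrite -!boolZ -!signZ twP twZ Ex Ey scalerDr !scalerA.
rewrite [(-1) ^+ s * _]mulrC; congr (_ *: _ + _).
by case: e ep => [->//|_]; rewrite ?mulr0 // andbF expr0 mul1r.
Qed.

Lemma tw_signs b (c e p : bool) x : tw b x = (-1) ^+ (b && p) * x ->
  tw b (c%:R * ((-1) ^+ e * x)) = (-1) ^+ (b && p) * (c%:R * ((-1) ^+ e * x)).
Proof.
move=> Ex; rewrite -!boolZ -!signZ !twZ Ex -signZ !scalerA.
by rewrite mulrC mulrA.
Qed.

Lemma sum_scalar (I : finType) (F : I -> E) c :
  (forall s, exists a : C, F s = a *: 1) -> exists a : C, c *: \sum_s F s = a *: 1.
Proof.
move=> /choice [f fE]; exists (c * \sum_s f s).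
by rewrite (eq_bigr _ (fun s _ => fE s)) -scaler_suml scalerA.
Qed.

Lemma scalar_signs (b c : bool) : b%:R * (-1) ^+ c = (b%:R * (-1) ^+ c) *: (1 : E).
Proof. by rewrite -scalerA signZ boolZ mulr1. Qed.

Lemma signed_scalar (b : bool) a x : x = a *: (1 : E) -> (-1) ^+ b * x = ((-1) ^+ b * a) *: 1.
Proof. by move=> ->; rewrite -signZ scalerA. Qed.

Lemma scale_factor c (x : E) : c *: x = (c *: 1) * x.
Proof. by rewrite -scalerAl mul1r. Qed.

End LinearTwist.

Section ParityTwist.
Variables (C : fieldType) (m n : nat).
Local Notation X := (opletter m n).
Local Notation par := (@par m n).

Definition opar (w : seq X) : bool := \big[addb/false]_(y <- w) opletter_par y.

Lemma parity_twistE b (x : free_alg C X) :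
  parity_twist b x = lext (fun w => (-1) ^+ (b && opar w) *: word C w) x.
Proof.
apply: eq_bigr => w _; rewrite scalerA scale_word mulrC.
by case: w.
Qed.

Lemma parity_twistP b c (x y : free_alg C X) :
  parity_twist b (c *: x + y) = c *: parity_twist b x + parity_twist b y.
Proof. rewrite !parity_twistE; exact: linearP. Qed.

Lemma parity_twist_word b w :
  parity_twist b (word C w) = (-1) ^+ (b && opar w) *: word C w.
Proof. by rewrite parity_twistE lext_word. Qed.

Lemma parity_twist_letter b (a : X) :
  parity_twist b (letter C a) = (-1) ^+ (b && opletter_par a) *: letter C a.
Proof. by rewrite letterE parity_twist_word /opar big_seq1. Qed.

Lemma parity_twist_Tmat b i j :
  parity_twist b (Tmat C m n i j)
  = (-1) ^+ (b && (par i (+) par j)) * Tmat C m n i j.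
Proof.
rewrite mxE; apply: (tw_entry (tw := @parity_twist C m n) parity_twistP).
- by rewrite parity_twist_letter /= andbF scale1r.
- exact: parity_twist_letter.
by move=> /eqP ->; rewrite addbb.
Qed.

Lemma parity_twist1 b : parity_twist b (1 : free_alg C X) = 1.
Proof.
by rewrite -(word_nil C X) parity_twist_word /opar big_nil andbF scale1r.
Qed.

Lemma parity_twist_scalar b (a : C) : parity_twist b (a *: (1 : free_alg C X)) = a *: 1.
Proof.
by apply: etrans (twZ (tw := @parity_twist C m n) parity_twistP _ _ _) _; rewrite parity_twist1.
Qed.

Variable k : nat.

Definition zfact : free_alg C X := (k`!%:R^-1 : C) *: 1.

Lemma tensor_str_Ak :
  tensor_str (tensor_mul (@Ak C m n k) (@Tprod C m n k))
  = zfact * perm_str par k true (Tmat C m n).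
Proof.
apply: (gtensor_strE (tw := @parity_twist C m n)).
- move=> b c e i j.
  exact: (tw_signs (tw := @parity_twist C m n) parity_twistP _ _ (parity_twist_Tmat b i j)).
- move=> p q; apply: etrans (@scale_factor C (free_alg C X) (k`!%:R^-1)
    (\sum_(s : 'S_k) (-1) ^+ s * Pperm C s p q)) _; congr (_ * _).
  by apply: eq_bigr => s _; rewrite sgE.
move=> b p q; have [|a Ea] := @sum_scalar C (free_alg C X) _ (fun s : 'S_k => (-1) ^+ s * Pperm C s p q) (k`!%:R^-1).
  by move=> s; eexists; apply: signed_scalar; apply: scalar_signs.
exact: (etrans (congr1 (parity_twist b) Ea) (etrans (parity_twist_scalar b a) (esym Ea))).
Qed.

Lemma tensor_str_Hk :
  tensor_str (tensor_mul (@Hk C m n k) (@Tprod C m n k))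
  = zfact * perm_str par k false (Tmat C m n).
Proof.
apply: (gtensor_strE (tw := @parity_twist C m n)).
- move=> b c e i j.
  exact: (tw_signs (tw := @parity_twist C m n) parity_twistP _ _ (parity_twist_Tmat b i j)).
- move=> p q; apply: etrans (@scale_factor C (free_alg C X) (k`!%:R^-1)
    (\sum_(s : 'S_k) Pperm C s p q)) _; congr (_ * _).
  by apply: eq_bigr => s _; rewrite sg0; apply: esym; exact: mul1r.
move=> b p q; have [|a Ea] := @sum_scalar C (free_alg C X) _ (fun s : 'S_k => Pperm C s p q) (k`!%:R^-1).
  by move=> s; eexists; apply: scalar_signs.
exact: (etrans (congr1 (parity_twist b) Ea) (etrans (parity_twist_scalar b a) (esym Ea))).
Qed.

End ParityTwist.

(** * Berezinians and supertraces under ring morphisms *)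

Module RingMorphisms.

Section Berezinian.
Variables (E : pzRingType) (m n : nat).
Implicit Types (f g : nat -> E) (X : 'M[E]_(m + n)).

Definition gseries1 : nat -> E := fun k => (k == 0%N)%:R.
Definition gseries_mul f g : nat -> E :=
  fun k => \sum_(i < k.+1) f i * g (k - i)%N.

Definition gone_plus_u X i j : nat -> E := fun k =>
  match k with 0 => (i == j)%:R | 1 => X i j | _ => 0 end.
Definition gone_plus_u_inv X i j : nat -> E :=
  fun k => (-1) ^+ k * (X ^+ k) i j.

(** [ber] over an arbitrary ring: the comparison with [berezinian] is made here and specialised to
    the free algebra by conversion in [berE]. *)
Definition gber X : nat -> E :=
  gseries_mul
    (fun k => \sum_(s : 'S_m) (-1) ^+ s *
       (\big[gseries_mul/gseries1]_(i < m)
          gone_plus_u X (lshift n (s i)) (lshift n i)) k)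
    (fun k => \sum_(s : 'S_n) (-1) ^+ s *
       (\big[gseries_mul/gseries1]_(i < n)
          gone_plus_u_inv X (rshift m i) (rshift m (s i))) k).

Lemma gseries_prod d (F : 'I_d -> nat -> E) k :
  (\big[gseries_mul/gseries1]_(i < d) F i) k = pcoef (\prod_(i < d) PSer (F i)) k.
Proof.
elim: d F k => [|d IHd] F k; first by rewrite !big_ord0.
by rewrite !big_ord_recl pcoefM; apply: eq_bigr => i _; rewrite IHd.
Qed.

Lemma gseries_perm_sum d (F : 'S_d -> 'I_d -> nat -> E) (G : 'S_d -> 'I_d -> pser E) k :
  (forall s i l, F s i l = pcoef (G s i) l) ->
  \sum_(s : 'S_d) (-1) ^+ s * (\big[gseries_mul/gseries1]_(i < d) F s i) k
  = pcoef (\sum_(s : 'S_d) sg s * \prod_(i < d) G s i) k.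
Proof.
move=> FG; rewrite pcoef_sum; apply: eq_bigr => s _; rewrite pcoef_sgM sgE.
rewrite gseries_prod; congr (_ * pcoef _ k); apply: eq_bigr => i _.
by apply: pserP => l; apply: FG.
Qed.

Lemma gberE X k : gber X k = pcoef (berezinian X) k.
Proof.
rewrite berezinian_perm pcoefM; apply: eq_bigr => l _; congr (_ * _).
  apply: (gseries_perm_sum (G := fun s i => plin_mx (ulsubmx X) (s i) i)) => s i.
  move=> j; rewrite !mxE; case: j => [|[|j]] //=.
apply: (gseries_perm_sum (G := fun s i => res_mx X (rshift m i) (rshift m (s i)))).
by move=> s i j; rewrite !mxE /= geom_mxE sgE signr_odd.
Qed.

End Berezinian.

Section Morphism.
Variables (E R : pzRingType) (phi : {rmorphism E -> R}).

Definition pser_map (f : pser E) : pser R := PSer (fun k => phi (pcoef f k)).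

Fact pser_map_zmod_morphism : zmod_morphism pser_map.
Proof. by move=> f g; apply: pserP => k; rewrite /= rmorphB. Qed.
HB.instance Definition _ :=
  GRing.isZmodMorphism.Build (pser E) (pser R) pser_map pser_map_zmod_morphism.

Fact pser_map_monoid_morphism : GRing.monoid_morphism pser_map.
Proof.
split; first by apply: pserP => k; rewrite /= rmorph_nat.
by move=> f g; apply: pserP => k; rewrite /= rmorph_sum; apply: eq_bigr => i _; rewrite rmorphM.
Qed.
HB.instance Definition _ :=
  GRing.isMonoidMorphism.Build (pser E) (pser R) pser_map pser_map_monoid_morphism.

Lemma rmorph_sg b : phi (sg b) = sg b.
Proof. by rewrite !sgE rmorph_sign. Qed.

Lemma strx_map d (par : 'I_d -> bool) (x : 'M[E]_d) :
  phi (strx par x) = strx par (map_mx phi x).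
Proof.
by rewrite /strx rmorph_sum; apply: eq_bigr => i _; rewrite rmorphM rmorph_sg mxE.
Qed.

Lemma map_mx_exp d (x : 'M[E]_d) k : map_mx phi (x ^+ k) = map_mx phi x ^+ k.
Proof.
elim: k => [|k IHk]; first exact: map_mx1.
by rewrite !exprS -IHk; exact: map_mxM.
Qed.

Lemma geom_mx_map d (x : 'M[E]_d) k i j :
  phi (geom_mx x k i j) = geom_mx (map_mx phi x) k i j.
Proof. by rewrite !geom_mxE rmorphM rmorph_sg -map_mx_exp mxE. Qed.

Lemma perm_str_map d (par : 'I_d -> bool) k eps (x : 'M[E]_d) :
  phi (perm_str par k eps x) = perm_str par k eps (map_mx phi x).
Proof.
rewrite /perm_str rmorph_sum; apply: eq_bigr => p _.
rewrite rmorph_sum; apply: eq_bigr => s _; rewrite rmorphM rmorph_sg rmorph_prod.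
by congr (_ * _); apply: eq_bigr => i _; rewrite mxE.
Qed.

End Morphism.

Section BerezinianMap.
Variables (E R : pzRingType) (phi : {rmorphism E -> R}) (m n : nat).

Lemma berezinian_map (X : 'M[E]_(m + n)) k :
  phi (pcoef (berezinian X) k) = pcoef (berezinian (map_mx phi X)) k.
Proof.
suff : pser_map phi (berezinian X) = berezinian (map_mx phi X) by move=> <-.
rewrite !berezinian_perm rmorphM !rmorph_sum; congr (_ * _); apply: eq_bigr => s _;
  rewrite rmorphM rmorph_sg rmorph_prod; congr (_ * _); apply: eq_bigr => i _;
  apply: pserP => j; rewrite !mxE /=.
  case: j => [|[|j]] //=; rewrite ?mxE ?rmorph_nat ?rmorph0 //.
by rewrite geom_mx_map.
Qed.

End BerezinianMap.

Lemma berE (C : fieldType) m n k :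
  ber (Tmat C m n) k = pcoef (berezinian (Tmat C m n)) k.
Proof. exact: (gberE (Tmat C m n) k). Qed.

Lemma strE (C : fieldType) m n (X : 'M[free_alg C (opletter m n)]_(m + n)) :
  str X = strx (@par m n) X.
Proof. by apply: eq_bigr => i _; rewrite sgE. Qed.

End RingMorphisms.
Import RingMorphisms.

(** * Manin relations deduced from commutators of currents *)

Section Manin.
Variable R : pzRingType.

Fact lincomb2 (s s' u v x : R) : u = 0 -> v = 0 -> x = s * u - s' * v -> x = 0.
Proof. by move=> -> -> ->; rewrite !mulr0 subr0. Qed.

(** The difference of the two sides is a combination of the two commutator relations, in which the
    terms with t cancel. Indices enter only through parities and Kronecker deltas, subject to the
    four implications, so finitely many Boolean cases suffice. *)
Fact manin_entries (bi bj bk bl dij dkl dkj dil : bool) (t e1 e2 e3 e4 : R) :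
  (dij -> bi = bj) -> (dkl -> bk = bl) -> (dkj -> bk = bj) -> (dil -> bi = bl) ->
  scom (bi (+) bj) (bk (+) bl) e1 e2
  = dkj%:R * (t * e4 - e4 * t)
    - sg ((bi (+) bj) && (bk (+) bl)) * (dil%:R * (t * e3 - e3 * t)) ->
  scom (bk (+) bj) (bi (+) bl) e3 e4
  = dij%:R * (t * e2 - e2 * t)
    - sg ((bk (+) bj) && (bi (+) bl)) * (dkl%:R * (t * e1 - e1 * t)) ->
  scom (bi (+) bj) (bk (+) bl) (dij%:R * t + sg bi * e1) (dkl%:R * t + sg bk * e2)
  = sg ((bi && bj) (+) (bi && bk) (+) (bj && bk))
  * scom (bk (+) bj) (bi (+) bl) (dkj%:R * t + sg bk * e3) (dil%:R * t + sg bi * e4).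
Proof.
move=> Hij Hkl Hkj Hil /eqP; rewrite -subr_eq0 => /eqP H1 /eqP; rewrite -subr_eq0 => /eqP H2.
apply/eqP; rewrite -subr_eq0; apply/eqP.
(* The product of the factors (-1)^i and (-1)^k of the two entries of T; [s'] carries in addition
   the sign of the Manin relation. *)
apply: (lincomb2 (s := sg (bi (+) bk))
  (s' := sg ((bi && bj) (+) (bi && bk) (+) (bj && bk) (+) (bi (+) bk))) H1 H2).
move: {H1 H2} Hij Hkl Hkj Hil; rewrite /scom.
by case: dij dkl dkj dil bi bj bk bl => [] [] [] [] [] [] [] [] Hij Hkl Hkj Hil;
  try solve [have := Hij isT => // | have := Hkl isT => // | have := Hkj isT => //
    | have := Hil isT => //]; rewrite /= ?sg0 ?sg1 ?mulr1n ?mulr0n; nring.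
Qed.

End Manin.

Lemma smanin_entries (R : pzRingType) d (par : 'I_d -> bool) (t : R) (e : 'I_d -> 'I_d -> R) :
  (forall i j k l, scom (par i (+) par j) (par k (+) par l) (e i j) (e k l)
     = (k == j)%:R * (t * e i l - e i l * t)
       - sg ((par i (+) par j) && (par k (+) par l)) * ((i == l)%:R * (t * e k j - e k j * t))) ->
  smanin par (fun i j => (i == j)%:R * t + sg (par i) * e i j).
Proof.
move=> eE i j k l; have r1 := eE i j k l; have r2 := eE k j i l.
by apply: manin_entries => //; case: eqP => // ->.
Qed.

From mathcomp Require Import functions.

Module DifferentialModules.

(** * Differential modules *)

Fact rmorph_entry (E R : pzRingType) (phi : {rmorphism E -> R}) (d s : bool) a b :
  phi (d%:R * a + (-1) ^+ s * b) = d%:R * phi a + sg s * phi b.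
Proof. by rewrite rmorphD !rmorphM rmorph_nat rmorph_sign sgE. Qed.

Section DiffModule.
Variables (C : fieldType) (m n : nat) (W : lmodType C).
Variables (A : dletter m n -> endo W) (D : endo W) (w0 : W).
Hypothesis A_lin : forall x c w, A x (c *: w) = c *: A x w.
Hypothesis D_lin : forall c w, D (c *: w) = c *: D w.
Hypothesis DA : forall ij s w, D (A (ij, s) w) = A (ij, s) (D w) + A (ij, s.+1) w.
Hypothesis Dw0 : D w0 = 0.
Local Notation par := (@par m n).
Local Notation M := (nat -> W).
Local Notation expr := (free_alg C (opletter m n)).

Definition dwop (w : seq (dletter m n)) : W := foldr (fun x v => A x v) w0 w.

Lemma D_dwop w : D (dwop w) = \sum_(v <- leibniz w) dwop v.
Proof.
elim: w => [|[ij s] w IHw]; first by rewrite big_nil.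
rewrite [LHS]DA [leibniz _]/= big_cons addrC; congr (_ + _).
by rewrite -/(dwop w) big_map IHw endo_sumr.
Qed.

(** Left multiplication by d_z on sum_p f_p d_z^p, through d_z f = f d_z + D(f). *)
Definition dshift_fun (f : M) : M := fun p => (if p is q.+1 then f q else 0) + D (f p).
Fact dshift_subproof : zmod_morphism dshift_fun.
Proof.
move=> f g; apply/funext => p; rewrite /dshift_fun !fctE endoBr.
by case: p => [|p]; rewrite ?fctE ?add0r // opprD addrACA.
Qed.
Definition dshift : endo M := Endo dshift_subproof.

Definition pointwise_fun (X : endo W) (f : M) : M := fun p => X (f p).
Fact pointwise_subproof X : zmod_morphism (pointwise_fun X).
Proof. by move=> f g; apply/funext => p; rewrite /pointwise_fun !fctE endoBr. Qed.
Definition pointwise X : endo M := Endo (pointwise_subproof X).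

Definition opact (a : opletter m n) : endo M :=
  if a is Some ij then pointwise (A (ij, 0%N)) else dshift.

Lemma opact_lin a c f : opact a (c *: f) = c *: opact a f.
Proof.
apply/funext => p; case: a => [ij|]; first exact: A_lin.
change (dshift_fun (c *: f) p = c *: dshift_fun f p); rewrite /dshift_fun scalerDr -D_lin; congr (_ + _).
by case: p => //; rewrite scaler0.
Qed.

Definition opeval : {rmorphism expr -> endo M} := EvaluationMorphism.ev_rmorphism opact_lin.

Definition const0 : M := fun p => if p == 0%N then w0 else 0.

Lemma opeval_word w p :
  opeval (word C w) const0 p = \sum_(t <- move_right w | t.2 == p) dwop t.1.
Proof.
rewrite [opeval _ _]ev_word; elim: w p => [|[ij|] w IHw] p.
- by rewrite /= big_mkcond big_seq1 /const0 eq_sym.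
- by rewrite /= /pointwise_fun IHw big_map endo_sumr.
rewrite /= /dshift_fun !IHw big_flatten big_map.
rewrite [RHS](eq_bigr (fun t => (if t.2.+1 == p then dwop t.1 else 0)
  + (if t.2 == p then D (dwop t.1) else 0))); last first.
  move=> t _; rewrite big_cons big_map D_dwop /=.
  by case: (t.2 == p); rewrite ?big_pred0_eq; case: (_ == p); rewrite ?add0r.
rewrite big_split /= -!big_mkcond endo_sumr; congr (_ + _).
by case: p => [|p]; rewrite ?big_pred0_eq // IHw.
Qed.

(** The right-hand side has the shape of [normal_coef]. With W = V it gives the state of the
    coefficient of d_z^p, with W a space of fields the coefficient itself. *)
Lemma opevalE (x : expr) p :
  opeval x const0 p
  = \sum_(w <- msupp x) x@_w *: \sum_(t <- move_right w | t.2 == p) dwop t.1.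
Proof.
rewrite [opeval _ _]/(lext _ _) /lext fct_sumE; apply: eq_bigr => w _.
apply: (congr1 (GRing.scale x@_w)).
exact: etrans (esym (congr1 (@^~ p) (ev_word opact_lin w const0))) (opeval_word w p).
Qed.

Hypothesis AA : forall i j k l,
  scom (par i (+) par j) (par k (+) par l) (A ((i, j), 0%N)) (A ((k, l), 0%N))
  = (k == j)%:R * A ((i, l), 1%N)
    - sg ((par i (+) par j) && (par k (+) par l)) * ((i == l)%:R * A ((k, j), 1%N)).

Definition Topr i j : endo M :=
  (i == j)%:R * dshift + sg (par i) * pointwise (A ((i, j), 0%N)).

Lemma opeval_Tmat : map_mx opeval (Tmat C m n) = \matrix_(i, j) Topr i j.
Proof.
apply/matrixP => i j; rewrite !mxE.
apply: etrans (rmorph_entry opeval (i == j) (par i) _ _) _.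
by rewrite /Topr; congr (_ * _ + _ * _); apply: ev_letter.
Qed.

Fact pointwise_zmod_morphism : zmod_morphism pointwise.
Proof. by move=> X Y; apply: endoP => f; apply/funext => p; rewrite endoE. Qed.
HB.instance Definition _ :=
  GRing.isZmodMorphism.Build (endo W) (endo M) pointwise pointwise_zmod_morphism.
Fact pointwise_monoid_morphism : GRing.monoid_morphism pointwise.
Proof. by split => [|X Y]; apply: endoP => f; apply/funext => p; rewrite endoE. Qed.
HB.instance Definition _ :=
  GRing.isMonoidMorphism.Build (endo W) (endo M) pointwise pointwise_monoid_morphism.

Lemma pointwise_scom a b X Y : pointwise (scom a b X Y) = scom a b (pointwise X) (pointwise Y).
Proof. by rewrite /scom rmorphB !rmorphM rmorph_sg. Qed.

Lemma dshift_pointwise ij s :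
  dshift * pointwise (A (ij, s)) - pointwise (A (ij, s)) * dshift = pointwise (A (ij, s.+1)).
Proof.
apply: endoP => f; apply/funext => p; rewrite endoE !endoM.
change (dshift_fun (pointwise_fun (A (ij, s)) f) p - A (ij, s) (dshift_fun f p)
  = A (ij, s.+1) (f p)).
rewrite /dshift_fun /pointwise_fun DA endoDr addrA [X in X - _]addrC.
by case: p => [|p]; rewrite ?endo0r addrK.
Qed.

(** Commutators of currents are derived letters by [AA], and derived letters are commutators with
    d_z by [dshift_pointwise]; combining the two gives the hypothesis of [smanin_entries]. *)
Lemma Topr_manin : smanin par Topr.
Proof.
apply: smanin_entries => i j k l; rewrite !dshift_pointwise -pointwise_scom AA.
by rewrite rmorphB !rmorphM rmorph_sg !rmorph_nat.
Qed.

End DiffModule.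

End DifferentialModules.
Import DifferentialModules.

Section Coef0.
Variable R : pzRingType.

Lemma pcoef0_prod d (F : 'I_d -> pser R) :
  pcoef (\prod_(i < d) F i) 0 = \prod_(i < d) pcoef (F i) 0.
Proof.
elim: d F => [|d IHd] F; first by rewrite !big_ord0.
by rewrite !big_ord_recl pcoefM big_ord1 subn0 IHd.
Qed.

Lemma perm_sum_delta d (F : 'S_d -> 'I_d -> R) :
  (forall s i, F s i = (s i == i)%:R) -> \sum_(s : 'S_d) sg s * \prod_(i < d) F s i = 1.
Proof.
move=> FE; rewrite (bigD1 1%g) //= [X in X + _](_ : _ = 1) ?[X in _ + X]big1 ?addr0 //.
  move=> s s1; have [i si] : exists i, s i != i.
    by apply/existsP; apply: contraNT s1 => /existsPn s1; apply/eqP/permP => i;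
      rewrite perm1; apply/eqP; rewrite -[_ == _]negbK.
  rewrite (_ : \prod_(j < d) _ = 0) ?mulr0 //.
  have : i \in index_enum 'I_d by rewrite mem_index_enum.
  elim: (index_enum _) => // j r IHr; rewrite inE big_cons FE => /predU1P[<-|/IHr ->].
    by rewrite (negbTE si) mul0r.
  by rewrite mulr0.
by rewrite odd_perm1 sg0 mul1r big1 // => i _; rewrite FE perm1 eqxx.
Qed.

Lemma berezinian0 m n (x : 'M[R]_(m + n)) : pcoef (berezinian x) 0 = 1.
Proof.
rewrite berezinian_perm pcoefM big_ord1 !pcoef_sum.
rewrite (eq_bigr (fun s : 'S_m => sg s * \prod_(i < m) pcoef (plin_mx (ulsubmx x) (s i) i) 0)); last first.
  by move=> s _; rewrite pcoef_sgM pcoef0_prod.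
rewrite perm_sum_delta => [|s i]; last by rewrite mxE.
rewrite mul1r (eq_bigr (fun s : 'S_n => sg s * \prod_(i < n) pcoef (res_mx x (rshift m i) (rshift m (s i))) 0)); last first.
  by move=> s _; rewrite pcoef_sgM pcoef0_prod.
apply: perm_sum_delta => s i; rewrite mxE /= geom_mx0 mxE.
by rewrite (inj_eq (@rshift_inj _ _)) eq_sym.
Qed.

End Coef0.

Fact scale_inv_muln (C : fieldType) (E : lalgType C) k :
  k%:R != 0 :> C -> ((k%:R^-1 : C) *: (1 : E)) *+ k = 1.
Proof. by move=> k0; rewrite -scaler_nat scalerA divff // scale1r. Qed.

(** * Newton identities for the images of the formal expressions *)

Section Newton.
Variables (C : fieldType) (m n : nat) (R : pzRingType).
Variable phi : {rmorphism free_alg C (opletter m n) -> R}.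
Hypothesis char0 : forall k, k.+1%:R != 0 :> C.
Hypothesis torsion_free : forall (z : R) k, z *+ k.+1 = 0 -> z = 0.
Local Notation par := (@par m n).
Let x := map_mx phi (Tmat C m n).
Hypothesis xM : smanin par x.
Let two_reg (z : R) : z + z = 0 -> z = 0. Proof. exact: (torsion_free (k := 1)). Qed.

Lemma phi_str k : phi (str (Tmat C m n ^+ k)) = strx par (x ^+ k).
Proof. by rewrite -map_mx_exp -strx_map -strE. Qed.

Lemma phi_ber k : phi (ber (Tmat C m n) k) = pcoef (berezinian x) k.
Proof. by rewrite -berezinian_map -berE. Qed.

Lemma ber_newton_phi k : phi (ber (Tmat C m n) k.+1) *+ k.+1
  = \sum_(l < k.+1) sg (odd l) * phi (ber (Tmat C m n) (k - l)%N) * strx par (x ^+ l.+1).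
Proof.
rewrite phi_ber (ber_newton two_reg xM).
by apply: eq_bigr => l _; rewrite [in RHS]phi_ber.
Qed.

Lemma phi_zfact (k : nat) (y : free_alg C (opletter m n)) :
  phi y = phi (zfact C m n k * y) *+ k`!.
Proof.
rewrite rmorphM -mulrnAl -raddfMn.
have k0 : k`!%:R != 0 :> C by have := fact_gt0 k; case: k`!.
have -> : zfact C m n k *+ k`! = 1 by exact: (@scale_inv_muln C (free_alg C (opletter m n)) _ k0).
exact: etrans (esym (mul1r _)) (congr1 (fun z => z * phi y) (esym (rmorph1 phi))).
Qed.

Definition sigma_expr k := tensor_str (tensor_mul (@Ak C m n k) (@Tprod C m n k)).
Definition h_expr k := tensor_str (tensor_mul (@Hk C m n k) (@Tprod C m n k)).

Lemma sigma_newton_phi k : phi (sigma_expr k.+1) *+ k.+1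
  = \sum_(l < k.+1) sg (odd l) * phi (sigma_expr (k - l)%N) * strx par (x ^+ l.+1).
Proof.
apply: (newton_ext torsion_free xM (c := fun k => phi (sigma_expr k))) => {}k.
by rewrite /sigma_expr tensor_str_Ak -phi_zfact perm_str_map.
Qed.

Lemma h_newton_phi k : phi (h_expr k.+1) *+ k.+1
  = \sum_(l < k.+1) strx par (x ^+ l.+1) * phi (h_expr (k - l)%N).
Proof.
apply: (newton_sym torsion_free xM (c := fun k => phi (h_expr k))) => {}k.
by rewrite /h_expr tensor_str_Hk -phi_zfact perm_str_map.
Qed.

Lemma ber0_phi : phi (ber (Tmat C m n) 0) = 1.
Proof. by rewrite phi_ber berezinian0. Qed.

Lemma sigma0_phi : phi (sigma_expr 0) = 1.
Proof.
by rewrite -[LHS]mulr1n -[1%N]/(0`!) /sigma_expr tensor_str_Ak -phi_zfact perm_str_map perm_str0.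
Qed.

Lemma h0_phi : phi (h_expr 0) = 1.
Proof.
by rewrite -[LHS]mulr1n -[1%N]/(0`!) /h_expr tensor_str_Hk -phi_zfact perm_str_map perm_str0.
Qed.

(** Both sequences start at 1 and satisfy one recurrence, with the supertraces on the right; it has
    a single solution once k + 1 can be cancelled. *)
Lemma sigma_ber_phi k : phi (sigma_expr k) = phi (ber (Tmat C m n) k).
Proof.
apply: (newton_unique torsion_free (s := fun l => strx par (x ^+ l.+1))
  (c := fun k => phi (sigma_expr k)) (c' := fun k => phi (ber (Tmat C m n) k))).
- by rewrite sigma0_phi ber0_phi.
- exact: sigma_newton_phi.
exact: ber_newton_phi.
Qed.

End Newton.

Lemma endo_torsion_free (C : fieldType) (M : lmodType C) :
  (forall k, k.+1%:R != 0 :> C) -> forall (z : endo M) k, z *+ k.+1 = 0 -> z = 0.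
Proof.
move=> char0 z k zk; apply: endoP => v.
have /eqP : (k.+1%:R : C) *: z v = 0.
  rewrite scaler_nat -[RHS]/((0 : endo M) v) -zk.
  by elim: k.+1 => // l IHl; rewrite !mulrS endoD IHl.
by rewrite scaler_eq0 (negbTE (char0 k)) => /eqP.
Qed.

From mathcomp Require Import generic_quotient ring_quotient.
From mathcomp Require Import ring.
Local Open Scope quotient_scope.

Lemma free_mulZr (C : fieldType) (X : choiceType) (c : C) (x y : free_alg C X) :
  x * (c *: y) = c *: (x * y).
Proof.
apply: (free_alg_ext (F := fun x => x * (c *: y)) (G := fun x => c *: (x * y))).
- move=> a x1 x2; exact: etrans (mulrDl _ _ _) (congr1 (fun z => z + _) (esym (scalerAl _ _ _))).
- move=> a x1 x2; have E : (a *: x1 + x2) * y = a *: (x1 * y) + x2 * y.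
    exact: etrans (mulrDl _ _ _) (congr1 (fun z => z + _) (esym (scalerAl _ _ _))).
  have F (L : lmodType C) (u v : L) : c *: (a *: u + v) = a *: (c *: u) + c *: v.
    by rewrite scalerDr !scalerA mulrC.
  exact: etrans (congr1 (GRing.scale c) E) (F _ _ _).
move=> w; exact: word_mulZ.
Qed.

(** * The derivations e_ij[r] |-> - r e_ij[r + s] and the defining relations *)

Section Derivation.
Variables (C : fieldType) (m n : nat) (E : lalgType C).
Variables (g : gen m n -> E) (d : E -> E) (s : int).
Local Notation par := (@par m n).
Hypothesis mulZr : forall (c : C) (x y : E), x * (c *: y) = c *: (x * y).
Hypothesis dP : forall c x y, d (c *: x + y) = c *: d x + d y.
Hypothesis dM : forall x y, d (x * y) = d x * y + x * d y.

Definition gshift (x : gen m n) : gen m n :=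
  if x is Some (i, j, r) then Some (i, j, r + s) else None.
Definition gmode (x : gen m n) : C := if x is Some (_, _, r) then (- r)%:~R else 0.
Hypothesis dg : forall x, d (g x) = gmode x *: g (gshift x).

Definition gbr (x y : gen m n) : E :=
  match x, y with
  | Some (i, j, r), Some (k, l, s) =>
      (k == j)%:R *: g (Some (i, l, r + s))
      - ((i == l)%:R * (-1) ^+ ((par i (+) par j) && (par k (+) par l)))
          *: g (Some (k, j, r + s))
      + (((n%:R - m%:R) * (k == j)%:R * (i == l)%:R * (-1) ^+ par i
          + (i == j)%:R * (k == l)%:R * (-1) ^+ (par i (+) par k))
         * r%:~R * (r == - s)%:R) *: g None
  | _, _ => 0
  end.

Definition grel x y : E :=
  g x * g y - (-1) ^+ (gen_par x && gen_par y) * (g y * g x) - gbr x y.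

Fact dB x y : d (x - y) = d x - d y.
Proof. by rewrite addrC -scaleN1r dP scaleN1r addrC. Qed.

Fact d0 : d 0 = 0. Proof. by have := dB 0 0; rewrite !subrr. Qed.

Fact dD x y : d (x + y) = d x + d y.
Proof. by rewrite -[x]scale1r dP !scale1r. Qed.

Fact dZ c x : d (c *: x) = c *: d x.
Proof. by rewrite -[c *: x]addr0 dP d0 addr0. Qed.

Fact gen_par_shift x : gen_par (gshift x) = gen_par x.
Proof. by case: x => [[[i j] r]|]. Qed.

Fact d_gbr x y :
  d (gbr x y) = gmode x *: gbr (gshift x) y + gmode y *: gbr x (gshift y).
Proof.
case: x => [[[i j] r]|]; last by rewrite /= d0 !scaler0 addr0.
case: y => [[[k l] r']|]; last by rewrite /= d0 !scaler0 addr0.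
rewrite /= dD dB !dZ !dg /= scale0r scaler0 addr0.
rewrite [r + (r' + s)]addrA [r + s + r']addrAC.
move: (g (Some _)) (g (Some _)) (g None) => u v w.
have -> : (r + s == - r') = (r == - (r' + s)).
  by rewrite -[LHS]subr_eq0 -[RHS]subr_eq0 !opprK addrA [r + r' + s]addrAC.
set t := (r == _).
(* On the right the central terms add up to a multiple of r (r + s + r') t, while on the left the
   derivation kills the central element. *)
have tE : t%:R * (r + s + r')%:~R = 0 :> C.
  rewrite /t; case: eqP => [->|_]; last by rewrite mul0r.
  by rewrite mul1r opprD addrNK addNr.
rewrite !scalerDr !scalerN !scalerA.
move: ((k == j)%:R : C) => a; move: ((i == l)%:R * _) => b.
move: (_ + _ : C) => kap.
rewrite [RHS]addrACA -[X in _ = _ + X]scalerDl [X in _ = X + _]addrACA -opprD -!scalerDl.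
rewrite [X in X *: w](_ : _ = - (kap * r%:~R * (t%:R * (r + s + r')%:~R))); last by ring.
by rewrite tE mulr0 oppr0 scale0r addr0; congr (_ *: _ - _ *: _); ring.
Qed.

Lemma d_grel x y :
  d (grel x y) = gmode x *: grel (gshift x) y + gmode y *: grel x (gshift y).
Proof.
rewrite /grel !dB d_gbr !gen_par_shift.
have -> z : d ((-1) ^+ (gen_par x && gen_par y) * z) = (-1) ^+ (gen_par x && gen_par y) * d z.
  by case: (_ && _); rewrite ?expr0 ?expr1 ?mul1r // !mulN1r -[- z]sub0r dB d0 sub0r.
rewrite !dM !dg !scalerDr !scalerN.
move: (gmode x) (gmode y) (gbr _ _) (gbr _ _) => a b u v.
rewrite -!scalerAl !mulZr.
by rewrite mulrDr !mulZr; nring.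
Qed.

End Derivation.

Section Bilinear.
Variables (C : fieldType) (E : lalgType C) (d : E -> E).
Hypothesis mulZr : forall (c : C) (x y : E), x * (c *: y) = c *: (x * y).
Hypothesis dP : forall c x y, d (c *: x + y) = c *: d x + d y.

Fact lin_mull c (x1 x2 y : E) : (c *: x1 + x2) * y = c *: (x1 * y) + x2 * y.
Proof. by rewrite mulrDl scalerAl. Qed.

Fact lin_mulr c (y x1 x2 : E) : y * (c *: x1 + x2) = c *: (y * x1) + y * x2.
Proof. by rewrite mulrDr mulZr. Qed.

Fact lin_dmull c (x1 x2 y : E) : d ((c *: x1 + x2) * y) = c *: d (x1 * y) + d (x2 * y).
Proof. by rewrite lin_mull dP. Qed.

Fact lin_dmulr c (y x1 x2 : E) : d (y * (c *: x1 + x2)) = c *: d (y * x1) + d (y * x2).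
Proof. by rewrite lin_mulr dP. Qed.

Fact lin_leibnizl c (x1 x2 y : E) :
  d (c *: x1 + x2) * y + (c *: x1 + x2) * d y
  = c *: (d x1 * y + x1 * d y) + (d x2 * y + x2 * d y).
Proof. by rewrite dP !lin_mull scalerDr addrACA. Qed.

Fact lin_leibnizr c (y x1 x2 : E) :
  d y * (c *: x1 + x2) + y * d (c *: x1 + x2)
  = c *: (d y * x1 + y * d x1) + (d y * x2 + y * d x2).
Proof. by rewrite dP !lin_mulr scalerDr addrACA. Qed.

Fact leibniz_cons c (x x' v w dv dw : E) :
  c *: (x' * (v * w)) + x * (dv * w + v * dw)
  = (c *: (x' * v) + x * dv) * w + (x * v) * dw.
Proof. by rewrite mulrDr mulrDl !mulrA -scalerAl addrA. Qed.

End Bilinear.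

Section Mode.
Variables (C : fieldType) (m n : nat) (s : int).
Local Notation alg := (free_alg C (gen m n)).

Fixpoint mode_word (w : seq (gen m n)) : alg :=
  if w is x :: w' then
    gmode C x *: (letter C (gshift s x) * word C w') + letter C x * mode_word w'
  else 0.

(* The derivation t^(s+1) d/dt up to the sign: e_ij[r] |-> - r e_ij[r + s]. *)
Definition mode_shift : alg -> alg := lext mode_word.

Lemma mode_shiftP c x y : mode_shift (c *: x + y) = c *: mode_shift x + mode_shift y.
Proof. exact: linearP. Qed.

Lemma mode_word_cat v w :
  mode_word (v ++ w) = mode_word v * word C w + word C v * mode_word w.
Proof.
elim: v => [|x v IHv] /=.
  by rewrite word_nil; apply: esym; exact: etrans (congr1 (fun z => z + _) (mul0r _))
    (etrans (add0r _) (mul1r _)).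
rewrite IHv -wordM word_cons; exact: leibniz_cons.
Qed.

Lemma mode_shiftM x y : mode_shift (x * y) = mode_shift x * y + x * mode_shift y.
Proof.
apply: (free_alg_ext (F := fun x => mode_shift (x * y))
  (G := fun x => mode_shift x * y + x * mode_shift y)).
- move=> c x1 x2; exact: (lin_dmull mode_shiftP).
- move=> c x1 x2; exact: (lin_leibnizl mode_shiftP).
move=> v; apply: (free_alg_ext (F := fun y => mode_shift (word C v * y))
  (G := fun y => mode_shift (word C v) * y + word C v * mode_shift y)).
- move=> c x1 x2; exact: (lin_dmulr (@free_mulZr _ _) mode_shiftP).
- move=> c x1 x2; exact: (lin_leibnizr (@free_mulZr _ _) mode_shiftP).
move=> w; rewrite wordM /mode_shift !lext_word; exact: mode_word_cat.
Qed.

Lemma mode_shift_letter x : mode_shift (letter C x) = gmode C x *: letter C (gshift s x).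
Proof.
rewrite letterE /mode_shift lext_word /= word_nil.
exact: (etrans (congr2 (fun u v => gmode C x *: u + v) (mulr1 _) (mulr0 _)) (addr0 _)).
Qed.

Lemma mode_shift1 : mode_shift 1 = 0.
Proof. by rewrite -(word_nil C (gen m n)) /mode_shift lext_word. Qed.

End Mode.

Import GRing.Theory Order.TTheory.

(** * Modes, centre and derivations on the vacuum module *)

Module VacuumOps.

Section Scalars.
Variables (C : fieldType) (M : lmodType C).

Fact scalar_op_subproof c : zmod_morphism (fun v : M => c *: v).
Proof. by move=> u v; rewrite scalerBr. Qed.
Definition scalar_op c : endo M := Endo (scalar_op_subproof c).

Fact scalar_op_zmod_morphism : zmod_morphism scalar_op.
Proof. by move=> a b; apply: endoP => v; rewrite endoE /= scalerBl. Qed.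
HB.instance Definition _ :=
  GRing.isZmodMorphism.Build C (endo M) scalar_op scalar_op_zmod_morphism.

Fact scalar_op_monoid_morphism : GRing.monoid_morphism scalar_op.
Proof.
split=> [|a b]; apply: endoP => v; rewrite endoE /= ?scale1r //.
by rewrite scalerA.
Qed.
HB.instance Definition _ :=
  GRing.isMonoidMorphism.Build C (endo M) scalar_op scalar_op_monoid_morphism.

End Scalars.

Fact level_lin (C : fieldType) (E : lalgType C)
  (mulZr : forall (c : C) (x y : E), x * (c *: y) = c *: (x * y)) c (k y z : E) :
  k * (c *: y + z) - (c *: y + z) = c *: (k * y - y) + (k * z - z).
Proof. by rewrite (lin_mulr mulZr) scalerBr opprD addrACA. Qed.

Fact level_step (E : pzRingType) (k a w : E) :
  k * (a * w) - a * w = (k * a - (-1) ^+ false * (a * k) - 0) * w + a * (k * w - w).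
Proof. nring. Qed.

Fact rmorph_rel (E R : pzRingType) (phi : {rmorphism E -> R}) (s : bool) a b c :
  phi (a * b - (-1) ^+ s * (b * a) - c) = phi a * phi b - sg s * (phi b * phi a) - phi c.
Proof. by rewrite !rmorphB !rmorphM rmorph_sign sgE. Qed.

Section VacuumModule.
Variables (C : fieldType) (m n : nat).
Local Notation V := (vacmod C m n).
Local Notation alg := (free_alg C (gen m n)).
Local Notation I := 'I_(m + n).
Local Notation par := (@par m n).
Local Notation ideal := (@vac_ideal C m n).

Lemma vac_idealZ c (x : alg) : ideal x -> ideal (c *: x).
Proof.
move=> Jx; have -> : c *: x = (c *: 1) * x.
  by exact: etrans (congr1 _ (esym (mul1r x))) (scalerAl c 1 x).
exact: vac_idealM.
Qed.

Lemma vac_idealP c (x y : alg) : ideal x -> ideal y -> ideal (c *: x + y).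
Proof. by move=> Jx Jy; apply: vac_idealD => //; apply: vac_idealZ. Qed.

(** The bound on s is used for the annihilating modes: e_ij[0] has coefficient 0, and e_ij[r + 1]
    goes to a multiple of e_ij[r + 1 + s], whose mode is again nonnegative. Relators are preserved
    by [d_grel], so the derivation descends to V. *)
Lemma mode_shift_ideal (s : int) (x : alg) :
  (-1 <= s)%R -> ideal x -> ideal (mode_shift s x).
Proof.
move=> s1; elim=> {x}.
- rewrite (_ : mode_shift s 0 = 0); first exact: vac_ideal0.
  exact: (d0 (mode_shiftP s)).
- move=> x y _ Jx _ Jy; rewrite (_ : mode_shift s (x + y) = mode_shift s x + mode_shift s y).
    exact: vac_idealD.
  exact: (dD (mode_shiftP s)).
- move=> a x Jx Jdx; rewrite mode_shiftM; apply: vac_idealD; exact: vac_idealM.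
- move=> x y b; rewrite mode_shiftM; apply: vac_idealD; last exact: vac_ideal_rel.
  have E : mode_shift s (env_relator C x y) = gmode C x *: env_relator C (gshift s x) y
      + gmode C y *: env_relator C x (gshift s y).
    exact: (d_grel (@free_mulZr _ _) (mode_shiftP s) (mode_shiftM s) (@mode_shift_letter _ _ _ s)).
  rewrite E (lin_mull (gmode C x) _ (_ *: _) b) -(scalerAl (gmode C y)).
  by apply: vac_idealP; [exact: vac_ideal_rel | apply: vac_idealZ; exact: vac_ideal_rel].
- move=> i j r; rewrite mode_shift_letter; case: r => [|r].
    rewrite (_ : _ *: _ = 0); first exact: vac_ideal0.
    exact: scale0r.
  apply: vac_idealZ; rewrite /gshift; have [k ->] : exists k : nat, r.+1%:Z + s = k%:Z.
    by exists (absz (r.+1%:Z + s)); lia.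
  exact: vac_ideal_ann.
- rewrite (_ : mode_shift s _ = 0); first exact: vac_ideal0.
  apply: etrans (@dB C alg (mode_shift s) (mode_shiftP s) (K' C m n) 1) _.
  apply: etrans (congr2 (fun u v => u - v) (mode_shift_letter C s None) (mode_shift1 C m n s)) _.
  exact: etrans (subr0 _) (scale0r _).
Qed.

Local Notation pi := (\pi_(vacmod C m n)).

Lemma vac_piZ c (x : alg) : pi (c *: x) = c *: pi x.
Proof.
apply: esym; apply: etrans (act_pi _ _) _; congr (pi _).
exact: etrans (esym (scalerAl c 1 x)) (congr1 _ (mul1r x)).
Qed.

Lemma vac_piP2 c (x y : alg) : pi (c *: x + y) = c *: pi x + pi y.
Proof. by rewrite vac_piD vac_piZ. Qed.

Fact vac_piN (x : alg) : pi (- x) = - pi x.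
Proof. by rewrite -scaleN1r vac_piZ scaleN1r. Qed.

Fact act_subproof (a : alg) : zmod_morphism (act a : V -> V).
Proof.
move=> u v; rewrite -[u]reprK -[v]reprK -vac_piN -vac_piD !act_pi.
by rewrite mulrBr vac_piD vac_piN.
Qed.
Definition act_op (a : alg) : endo V := Endo (act_subproof a).

Lemma act_opE a v : act_op a v = act a v. Proof. by []. Qed.

Lemma act_linl c (a b : alg) v : act (c *: a + b) v = c *: act a v + act b v.
Proof.
rewrite -[v]reprK !act_pi -vac_piP2; congr (pi _); exact: lin_mull.
Qed.

Lemma act_opZr (a : alg) c v : act_op a (c *: v) = c *: act_op a v.
Proof.
rewrite /= -[v]reprK -vac_piZ !act_pi -vac_piZ; congr (pi _); exact: free_mulZr.
Qed.

Fact act_op_zmod_morphism : zmod_morphism act_op.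
Proof.
move=> a b; apply: endoP => v; rewrite endoE /= -[v]reprK !act_pi -vac_piN -vac_piD.
by congr (pi _); exact: mulrBl.
Qed.
HB.instance Definition _ :=
  GRing.isZmodMorphism.Build alg (endo V) act_op act_op_zmod_morphism.

Fact act_op_monoid_morphism : GRing.monoid_morphism act_op.
Proof.
split=> [|a b]; apply: endoP => v; rewrite endoE /= -[v]reprK.
  by rewrite act_pi; exact: (congr1 (fun x => pi x) (mul1r (repr v))).
rewrite act_pi (act_pi b (repr v)) (act_pi a (b * repr v)).
exact: (congr1 (fun x => pi x) (esym (mulrA a b (repr v)))).
Qed.
HB.instance Definition _ :=
  GRing.isMonoidMorphism.Build alg (endo V) act_op act_op_monoid_morphism.

Lemma act_opZ c (a : alg) : act_op (c *: a) = scalar_op V c * act_op a.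
Proof.
apply: endoP => v; rewrite endoE /= -[v]reprK !act_pi -vac_piZ; congr (pi _).
exact: esym (scalerAl _ _ _).
Qed.

Lemma act_rel x y : act_op (env_relator C x y) = 0.
Proof.
apply: endoP => v; rewrite endoE /= -[v]reprK act_pi.
have /(vac_piP _ 0) -> : ideal (env_relator C x y * repr v - 0).
  rewrite (_ : _ - 0 = env_relator C x y * repr v); first exact: vac_ideal_rel.
  exact: subr0.
by have := vac_piZ 0 0; rewrite !scale0r.
Qed.

Local Notation ga i j r := (act_op (e_ C i j r)).

(** K' - 1 generates only a left ideal, so K' has to be moved to the right through every letter of a
    word by means of the relators of K'. *)
Lemma act_central : act_op (K' C m n) = 1.
Proof.
apply: endoP => v; rewrite -[v]reprK act_opE act_pi; apply/vac_piP; move: (repr v) => x.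
pose J (x : alg) := ideal (K' C m n * x - x).
have JP c (y z : alg) : J y -> J z -> J (c *: y + z).
  move=> Jy Jz; rewrite /J; have -> : K' C m n * (c *: y + z) - (c *: y + z)
      = c *: (K' C m n * y - y) + (K' C m n * z - z).
    exact: (level_lin (@free_mulZr C (gen m n)) c (K' C m n) y z).
  exact: vac_idealP.
have J0 : J 0.
  by rewrite /J (_ : _ - _ = 0); [exact: vac_ideal0 | exact: etrans (subr0 _) (mulr0 _)].
rewrite [X in vac_ideal X](_ : _ = K' C m n * x - x) //; rewrite -/(J x) (free_algE x).
apply: (big_ind J) => [|y z Jy Jz|w _]; first exact: J0.
  by rewrite -[y]scale1r; apply: JP.
rewrite -[_ *: _](addr0); apply: JP J0; elim: (w : seq _) => [|a {}w IHw] /=.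
  rewrite /J word_nil (_ : _ - 1 = K' C m n - 1); first exact: vac_ideal_level.
  by congr (_ - 1); exact: mulr1.
rewrite /J word_cons (_ : _ - _ = env_relator C None a * word C w
    + letter C a * (K' C m n * word C w - word C w)).
  by apply: vac_idealD; [exact: vac_ideal_rel | exact: vac_idealM].
exact: level_step.
Qed.

Definition cocycle (i j k l : I) : C :=
  (n%:R - m%:R) * (k == j)%:R * (i == l)%:R * (-1) ^+ par i
  + (i == j)%:R * (k == l)%:R * (-1) ^+ (par i (+) par k).

Lemma act_comm i j r k l s :
  scom (par i (+) par j) (par k (+) par l) (ga i j r) (ga k l s)
  = (k == j)%:R * ga i l (r + s)
    - sg ((par i (+) par j) && (par k (+) par l)) * ((i == l)%:R * ga k j (r + s))
    + scalar_op V (cocycle i j k l * r%:~R * (r == - s)%:R).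
Proof.
have := act_rel (Some (i, j, r)) (Some (k, l, s)).
have E : act_op (gen_bracket C (Some (i, j, r)) (Some (k, l, s))) =
    (k == j)%:R * ga i l (r + s)
    - sg ((par i (+) par j) && (par k (+) par l)) * ((i == l)%:R * ga k j (r + s))
    + scalar_op V (cocycle i j k l * r%:~R * (r == - s)%:R).
  apply: etrans (raddfD act_op _ _) _.
  apply: etrans (congr2 (fun u v => u + v) (raddfB act_op _ _) (act_opZ _ _)) _.
  rewrite act_central mulr1; congr (_ - _ + _).
    by apply: etrans (act_opZ _ _) _; rewrite rmorph_nat.
  apply: etrans (act_opZ _ _) _; rewrite rmorphM rmorph_nat rmorph_sign sgE.
  by rewrite mulrA; case: (i == l); rewrite ?mulr1 ?mul1r // mulr0 !mul0r.
move=> H; apply/eqP; rewrite -subr_eq0 -E /scom; apply/eqP; rewrite -[RHS]H.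
exact: esym (rmorph_rel act_op _ (e_ C i j r) (e_ C k l s)
  (gen_bracket C (Some (i, j, r)) (Some (k, l, s)))).
Qed.

Section ModeOp.
Variable s : int.
Hypothesis s1 : (-1 <= s)%R.

Definition mode_fun (v : V) : V := pi (mode_shift s (repr v)).

Lemma mode_fun_pi (x : alg) : mode_fun (pi x) = pi (mode_shift s x).
Proof.
apply/vac_piP; rewrite -[X in vac_ideal X](dB (mode_shiftP s)).
by apply: mode_shift_ideal => //; apply/vac_piP; rewrite reprK.
Qed.

Fact mode_subproof : zmod_morphism mode_fun.
Proof.
move=> u v; rewrite -[u]reprK -[v]reprK -vac_piN -vac_piD !mode_fun_pi -vac_piN -vac_piD.
by congr (pi _); exact: (dB (mode_shiftP s)).
Qed.
Definition mode_op : endo V := Endo mode_subproof.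

Lemma mode_opZ c v : mode_op (c *: v) = c *: mode_op v.
Proof.
rewrite /= -[v]reprK -vac_piZ !mode_fun_pi -vac_piZ; congr (pi _).
exact: (dZ (mode_shiftP s)).
Qed.

Lemma mode_op_vac : mode_op (vac C m n) = 0.
Proof.
rewrite /= /vac mode_fun_pi mode_shift1.
by have := vac_piZ 0 0; rewrite !scale0r.
Qed.

Lemma mode_op_act i j r :
  mode_op * ga i j r = ga i j r * mode_op + scalar_op V (- r)%:~R * ga i j (r + s).
Proof.
apply: endoP => v; rewrite endoE /= -[v]reprK act_pi !mode_fun_pi !act_pi.
rewrite -vac_piZ -vac_piD mode_shiftM mode_shift_letter; congr (pi _).
exact: etrans (addrC _ _) (congr1 _ (esym (scalerAl _ _ _))).
Qed.

End ModeOp.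

End VacuumModule.

End VacuumOps.
Import VacuumOps.

Lemma sum_if1 (V : nmodType) (I : finType) (j : I) (f : I -> V) :
  \sum_a (if a == j then f a else 0) = f j.
Proof. by rewrite -big_mkcond big_pred1_eq. Qed.

Lemma sum_if1r (V : nmodType) (I : finType) (j : I) (f : I -> V) :
  \sum_a (if j == a then f a else 0) = f j.
Proof. by rewrite -[RHS]sum_if1; apply: eq_bigr => a _; rewrite eq_sym. Qed.

Lemma addb_mid a b c : b (+) c = (b (+) a) (+) (a (+) c).
Proof. by case: a b c => [] [] []. Qed.

Section IfRing.
Variable R : pzRingType.
Implicit Types x y : R.

Lemma if_mull (b : bool) x y : (if b then x else 0) * y = if b then x * y else 0.
Proof. by case: b; rewrite ?mul0r. Qed.

Lemma if_mulr (b : bool) x y : x * (if b then y else 0) = if b then x * y else 0.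
Proof. by case: b; rewrite ?mulr0. Qed.

Lemma scom_mulr a b c x y z :
  scom a (b (+) c) x (y * z) = scom a b x y * z + sg (a && b) * (y * scom a c x z) :> R.
Proof.
rewrite /scom; case: a b c => [] [] [] /=; rewrite ?sg0 ?sg1; nring.
Qed.

Lemma scom_mulE a b x y : x * y = scom a b x y + sg (a && b) * (y * x) :> R.
Proof. by rewrite /scom addrNK. Qed.

Lemma scom_sum (I : finType) a b x (f : I -> R) :
  scom a b x (\sum_i f i) = \sum_i scom a b x (f i).
Proof. by rewrite /scom mulr_sumr mulr_suml mulr_sumr -sumrB. Qed.

End IfRing.

(** * Zero modes and powers of T *)

Section ZeroModes.
Variables (R : pzRingType) (d : nat) (par : 'I_d -> bool).
Variables (x : 'M[R]_d) (G : 'I_d -> 'I_d -> R).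
Hypothesis GT : forall i j k l,
  scom (par i (+) par j) (par k (+) par l) (G i j) (x k l)
  = (if k == j then sg (par j) * x i l else 0)
    - (if l == i then sg (((par i (+) par j) && (par k (+) par l)) (+) par i) * x k j else 0).

Lemma exprS_mxE p i j : (x ^+ p.+1) i j = \sum_a x i a * (x ^+ p) a j.
Proof. by rewrite exprS mxE. Qed.

(** In the Leibniz rule for x times x^p, the second term for the first factor and the first term for
    the second factor are supported at a = i and a = j; after summation over a they cancel. *)
Lemma zero_mode_pow p i j k l :
  scom (par i (+) par j) (par k (+) par l) (G i j) ((x ^+ p) k l)
  = (if k == j then sg (par j) * (x ^+ p) i l else 0)
    - (if l == i then sg (((par i (+) par j) && (par k (+) par l)) (+) par i) * (x ^+ p) k j else 0).
Proof.
elim: p i j k l => [|p IHp] i j k l.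
  rewrite expr0 !mxE [l == i]eq_sym; case: (eqVneq k l) => [->|kl].
    rewrite addbb /scom andbF sg0 mul1r mulr1 mul1r subrr.
    case: (eqVneq i l) => [->|il]; rewrite ?mulr0 ?mulr1.
      by rewrite /=; case: eqP => [->|_]; rewrite ?mulr1 ?mulr0 !subrr.
    by case: (l == j); rewrite subr0.
  rewrite /scom mulr0 mul0r mulr0 subrr; case: (eqVneq i l) => [<-|il]; rewrite ?mulr0.
    case: (eqVneq k j) => [->|_]; last by rewrite mulr0 subrr.
    rewrite (_ : _ (+) par i = par j) ?subrr //.
    by case: (par i) (par j) => [] [].
  by case: (k == j); rewrite subrr.
rewrite exprS_mxE scom_sum.
rewrite (eq_bigr (fun a =>
   (if k == j then sg (par j) * x i a * (x ^+ p) a l else 0)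
   - (if a == i then sg (((par i (+) par j) && (par k (+) par i)) (+) par i)
        * x k j * (x ^+ p) i l else 0)
   + (if a == j then sg (((par i (+) par j) && (par k (+) par i)) (+) par i)
        * x k j * (x ^+ p) i l else 0)
   - (if l == i then sg (((par i (+) par j) && (par k (+) par l)) (+) par i)
        * (x k a * (x ^+ p) a j) else 0))); last first.
  move=> a _; rewrite [par k (+) par l](addb_mid (par a)) scom_mulr GT IHp.
  rewrite mulrBl !if_mull mulrBr mulrBr !if_mulr -!addrA; congr (_ + (_ + (_ + _))).
  - by congr (- _); case: eqP => [->|].
  - case: eqP => // ->; rewrite sgCA !mulrA -sgD -!mulrA.
    by congr (sg _ * _); case: (par i) (par j) (par k) => [] [] [].
  - congr (- _); case: (l == i) => //; rewrite sgCA !mulrA -sgD -!mulrA.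
    by congr (sg _ * _); case: (par i) (par j) (par k) (par a) (par l) => [] [] [] [] [].
rewrite sumrB big_split sumrB /= !sum_if1 addrNK; congr (_ - _).
  case: (k == j); last by rewrite big1.
  by rewrite exprS_mxE mulr_sumr; apply: eq_bigr => a _; rewrite mulrA.
by case: (l == i); [rewrite exprS_mxE mulr_sumr | rewrite big1].
Qed.

Lemma zero_mode_strx p i j : G i j * strx par (x ^+ p) = strx par (x ^+ p) * G i j.
Proof.
apply/eqP; rewrite -subr_eq0; apply/eqP.
transitivity (scom (par i (+) par j) false (G i j) (strx par (x ^+ p))).
  by rewrite /scom andbF sg0 mul1r.
rewrite /strx scom_sum (eq_bigr (fun k =>
  (if k == j then (x ^+ p) i j else 0) - (if k == i then (x ^+ p) i j else 0))).
  by rewrite sumrB !sum_if1 subrr.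
move=> k _; rewrite [LHS](_ : _ = sg (par k) * scom (par i (+) par j)
  (par k (+) par k) (G i j) ((x ^+ p) k k)); last first.
  by rewrite /scom addbb andbF sg0 !mul1r mulrBr sgCA -!mulrA.
rewrite zero_mode_pow mulrBr !if_mulr; congr (_ - _).
  by case: eqP => // ->; rewrite sgK.
by case: eqP => // ->; rewrite addbb andbF sgK.
Qed.

End ZeroModes.

Fact ann_congr (N : zmodType) (a b c a' b' c' s t e f : endo N) (v : N) :
  a v = a' v -> b v = b' v -> c v = c' v ->
  (a + s * b - t * c - e + f) v = (a' + s * b' - t * c' - e + f) v.
Proof. by move=> Ea Eb Ec; rewrite !endoE Ea Eb Ec. Qed.

(** * First modes at the critical level *)

Section Annihilation.
Variables (N : zmodType) (d : nat) (par : 'I_d -> bool).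
Local Notation R := (endo N).
Variables (x : 'M[R]_d) (G F : 'I_d -> 'I_d -> R).
Hypothesis two_reg : forall z : R, z + z = 0 -> z = 0.
Hypothesis xM : smanin par x.
Hypothesis GT : forall i j k l,
  scom (par i (+) par j) (par k (+) par l) (G i j) (x k l)
  = (if k == j then sg (par j) * x i l else 0)
    - (if l == i then sg (((par i (+) par j) && (par k (+) par l)) (+) par i) * x k j else 0).
(* The superdimension is the critical level. *)
Definition sdim : R := \sum_i sg (par i).
Hypothesis FT : forall i j k l,
  scom (par i (+) par j) (par k (+) par l) (F i j) (x k l)
  = (if l == k then G i j else 0) + (if k == j then sg (par j) * G i l else 0)
    - (if l == i then sg (((par i (+) par j) && (par k (+) par l)) (+) par i) * G k j else 0)
    - (if k == j then if l == i then sg (par k) * sdim else 0 else 0)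
    + (if i == j then if l == k then 1 else 0 else 0).

Variable v : N.
Hypothesis Gv : forall i j, G i j v = 0.
Hypothesis Fv : forall i j, F i j v = 0.

Lemma zero_mode_v p i j k l : (G i j * (x ^+ p) k l) v
  = ((if k == j then sg (par j) * (x ^+ p) i l else 0)
    - (if l == i then sg (((par i (+) par j) && (par k (+) par l)) (+) par i) * (x ^+ p) k j else 0)) v.
Proof.
rewrite [G i j * _](scom_mulE (par i (+) par j) (par k (+) par l)) (zero_mode_pow GT).
by rewrite [LHS]endoD !endoM Gv !endo0r addr0.
Qed.

(** The value on v of the part of F i j x^(p+1) where F supercommutes with the leading factor x and
    x^p stands to the right. *)
Definition first_term p i j k l : R :=
  (if k == j then sg (par j) * (x ^+ p) i l else 0)
  - (if l == i then sg (((par i (+) par j) && (par k (+) par l)) (+) par i) * (x ^+ p) k j else 0)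
  - (if k == j then if l == i then sg (par j) * strx par (x ^+ p) else 0 else 0)
  + (if l == k then (x ^+ p) i j else 0).

Lemma trace_mode p i l : (\sum_a G i a * (x ^+ p) a l) v
  = (sdim * (x ^+ p) i l - (if l == i then strx par (x ^+ p) else 0)) v.
Proof.
rewrite endo_sum (eq_bigr (fun a => (sg (par a) * (x ^+ p) i l
  - (if l == i then sg (par a) * (x ^+ p) a a else 0)) v)) => [|a _].
  rewrite -endo_sum sumrB -mulr_suml; apply: (congr1 (fun z : R => (_ - z) v)).
  by case: (l == i) => //; rewrite big1.
rewrite zero_mode_v eqxx; case: eqP => [->|//]; apply: (congr1 (fun z : R => (_ - z) v)).
congr (sg _ * _); by case: (par i) (par a) => [] [].
Qed.

(** This is where the level enters: the superdimension from the trace of zero modes ([trace_mode])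
    cancels the central term of [FT]. The summand of [FT] with i = j likewise cancels against a zero
    mode term. *)
Lemma first_termE p i j k l :
  (\sum_a scom (par i (+) par j) (par k (+) par a) (F i j) (x k a) * (x ^+ p) a l) v
  = first_term p i j k l v.
Proof.
rewrite (_ : \sum_a _ = G i j * (x ^+ p) k l
    + (if k == j then sg (par j) else 0) * (\sum_a G i a * (x ^+ p) a l)
    - sg (((par i (+) par j) && (par k (+) par i)) (+) par i) * (G k j * (x ^+ p) i l)
    - (if k == j then sg (par k) * sdim * (x ^+ p) i l else 0)
    + (if i == j then (x ^+ p) k l else 0)); last first.
  rewrite mulr_sumr -[G i j * _](sum_if1 k (fun a => G i j * (x ^+ p) a l)).
  rewrite -[sg _ * _](sum_if1 i (fun a => sg (((par i (+) par j) && (par k (+) par a))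
    (+) par i) * (G k j * (x ^+ p) a l))).
  rewrite -[if k == j then _ * _ else _](sum_if1 i (fun a =>
    if k == j then sg (par k) * sdim * (x ^+ p) a l else 0)).
  rewrite -[if i == j then _ else _](sum_if1 k (fun a => if i == j then (x ^+ p) a l else 0)).
  rewrite -!(big_split, sumrB) /=; apply: eq_bigr => a _; rewrite FT.
  rewrite mulrDl !mulrBl mulrDl !if_mull mul1r -!mulrA.
  by congr (_ + _ - _ - _ + _); case: (k == j); case: (a == i); case: (i == j); case: (a == k).
apply: etrans (ann_congr _ _ _ _ (zero_mode_v p i j k l) (trace_mode p i l)
  (zero_mode_v p k j i l)) _.
apply: (congr1 (fun z : R => z v)); rewrite /first_term.
set t := sg ((_ && (_ (+) par i)) (+) par i).
have -> : (if k == j then sg (par k) * sdim * (x ^+ p) i l else 0)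
    = (if k == j then sg (par j) * sdim * (x ^+ p) i l else 0) by case: eqP => // ->.
rewrite [t * _]mulrBr !if_mulr /t !sgMMl.
have -> : (if i == j then sg (((par i (+) par j) && (par k (+) par i)) (+) par i (+) par j)
    * (x ^+ p) k l else 0) = (if i == j then (x ^+ p) k l else 0).
  by case: eqP => // ->; rewrite addbb addbb sg0 mul1r.
have -> : (if l == k then sg (((par i (+) par j) && (par k (+) par i)) (+) par i
      (+) (((par k (+) par j) && (par i (+) par l)) (+) par k)) * (x ^+ p) i j else 0)
    = (if l == k then (x ^+ p) i j else 0).
  case: eqP => // ->; rewrite (_ : _ (+) _ = false) ?sg0 ?mul1r //.
  by case: (par i) (par j) (par k) => [] [] [].
move: (if i == j then _ else _) (if l == k then _ else _) => X Y.
case: (k == j); rewrite ?mul0r; last by nring.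
by rewrite mulrBr; case: (l == i); nring.
Qed.

Lemma mode_pow p i j k l : (F i j * (x ^+ p) k l) v
  = (\sum_(q < p) \sum_a sg ((par i (+) par j) && (par k (+) par a))
      * ((x ^+ q) k a * first_term (p - q.+1) i j a l)) v.
Proof.
elim: p k => [|p IHp] k.
  rewrite big_ord0 expr0 mxE; case: (k == l); by rewrite ?mulr1 ?mulr0 ?Fv.
rewrite exprS_mxE mulr_sumr.
have -> : \sum_a F i j * (x k a * (x ^+ p) a l)
    = \sum_a scom (par i (+) par j) (par k (+) par a) (F i j) (x k a) * (x ^+ p) a l
    + \sum_a sg ((par i (+) par j) && (par k (+) par a)) * x k a * (F i j * (x ^+ p) a l).
  rewrite -big_split; apply: eq_bigr => a _ /=.
  by rewrite /scom mulrBl !mulrA subrK.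
rewrite endoD first_termE endo_sum (eq_bigr (fun a => (\sum_(q < p) \sum_b
    sg ((par i (+) par j) && (par k (+) par b)) *
    (x k a * (x ^+ q) a b * first_term (p - q.+1) i j b l)) v)); last first.
  move=> a _; rewrite endoM IHp -endoM mulr_sumr; apply: (congr1 (fun z : R => z v)).
  apply: eq_bigr => q _; rewrite mulr_sumr; apply: eq_bigr => b _.
  rewrite -!mulrA sgCA !mulrA -sgD -!mulrA; congr (sg _ * _).
  by case: (par i) (par j) (par k) (par a) (par b) => [] [] [] [] [].
rewrite big_ord_recl [RHS]endoD; congr (_ + _).
  apply: (congr1 (fun z : R => z v)).
  rewrite -[LHS](sum_if1r k (fun a => first_term p i j a l)); apply: eq_bigr => a _.
  rewrite expr0 mxE subn1; case: eqP => [->|_]; last by rewrite mul0r mulr0.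
  by rewrite addbb andbF sg0 !mul1r.
rewrite -endo_sum exchange_big; apply: (congr1 (fun z : R => z v)).
apply: eq_bigr => q _; rewrite exchange_big; apply: eq_bigr => b _ /=.
by rewrite -mulr_sumr -mulr_suml exprS_mxE.
Qed.

Lemma scom_swap (a b : bool) (y z : R) : scom a b y z = - (sg (a && b) * scom b a z y).
Proof. by rewrite /scom; case: a b => [] []; rewrite ?sg0 ?sg1; nring. Qed.

Lemma rev_sum n (f : nat -> nat -> R) :
  \sum_(q < n.+1) f q (n - q)%N = \sum_(q < n.+1) f (n - q)%N q.
Proof.
rewrite (reindex_inj rev_ord_inj) /=; apply: eq_bigr => q _.
by rewrite subSS subKn // -ltnS.
Qed.

(** For each k the sum regroups into supercommutators A of (x^q)_kk with (x^(n-q))_ij and B of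
    (x^q)_kj with (x^(n-q))_ik. The Manin relations for powers exchange the rows k and i and turn
    the A terms into the negatives of the B terms. *)
Lemma trace_first_term n i j :
  \sum_(q < n.+1) \sum_k \sum_a sg (par k (+) ((par i (+) par j) && (par k (+) par a)))
    * ((x ^+ q) k a * first_term (n - q) i j a k) = 0.
Proof.
pose A q k := scom (par k (+) par k) (par i (+) par j) ((x ^+ q) k k) ((x ^+ (n - q)) i j).
pose B q k := scom (par k (+) par j) (par i (+) par k) ((x ^+ q) k j) ((x ^+ (n - q)) i k).
transitivity (\sum_(q < n.+1) \sum_k
    (sg (par k) * A q k + sg ((par k (+) par j) && (par i (+) par k)) * B q k)); last first.
  rewrite exchange_big big1 //= => k _; rewrite big_split /= -!mulr_sumr.
  rewrite (smanin_expr two_reg xM) sgMMl (_ : _ (+) _ = false); last first.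
    by case: (par i) (par k) => [] [].
  rewrite sg0 mul1r mulr_sumr /B.
  rewrite (rev_sum n (fun q p => sg _ * scom (par k (+) par j) (par i (+) par k) ((x ^+ q) k j) ((x ^+ p) i k))).
  rewrite -big_split big1 //= => q _.
  by rewrite [X in _ + _ * X]scom_swap mulrN sgMMl addbb sg0 mul1r subrr.
(* After the reversal q |-> n - q, these two sums supply the products in opposite order inside B and
   A respectively. *)
pose T2 q p := \sum_a (x ^+ q) i a * (x ^+ p) a j.
pose T3 q p := (x ^+ q) i j * strx par (x ^+ p).
transitivity (\sum_(q < n.+1)
    (\sum_k (sg (par k (+) ((par i (+) par j) && (par k (+) par j)) (+) par j)
        * ((x ^+ q) k j * (x ^+ (n - q)) i k)
      + sg (par k) * ((x ^+ q) k k * (x ^+ (n - q)) i j))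
    - (T2 q (n - q)%N + T3 q (n - q)%N))).
  apply: eq_bigr => q _; move: (n - q)%N => p.
  rewrite -[T2 q p + T3 q p](sum_if1 i (fun k => T2 q p + T3 q p)) -sumrB.
  apply: eq_bigr => k _.
  transitivity (\sum_a (
      (if a == j then sg (par k (+) ((par i (+) par j) && (par k (+) par j)) (+) par j)
         * ((x ^+ q) k j * (x ^+ p) i k) else 0)
      - (if k == i then (x ^+ q) i a * (x ^+ p) a j else 0)
      - (if a == j then if k == i then T3 q p else 0 else 0)
      + (if k == a then sg (par k) * ((x ^+ q) k k * (x ^+ p) i j) else 0))).
    apply: eq_bigr => a _; rewrite /first_term mulrDr !mulrBr mulrDr !mulrBr !if_mulr.
    congr (_ - _ - _ + _).
    - by case: eqP => // ->; rewrite sgCA sgMMl.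
    - case: eqP => // ->; rewrite sgCA sgMMl (_ : _ (+) _ = false) ?sg0 ?mul1r //.
      by case: (par i) (par j) (par a) => [] [] [].
    - case: eqP => // ->; case: eqP => // ->; rewrite sgCA sgMMl (_ : _ (+) _ = false).
        by rewrite sg0 mul1r.
      by case: (par i) (par j) => [] [].
    by case: eqP => // <-; rewrite addbb andbF addbF.
  rewrite big_split !sumrB /= !sum_if1 sum_if1r.
  case: (k == i); last by rewrite (big1 _ (fun _ => true)) // !subr0.
  by rewrite -/(T2 q p); nring.
rewrite sumrB (rev_sum n (fun q p => T2 q p + T3 q p)) -sumrB; apply: eq_bigr => q _.
rewrite /T2 /T3 /strx mulr_sumr -big_split -sumrB; apply: eq_bigr => k _ /=.
rewrite /A /B /scom.
by case: (par i) (par j) (par k) => [] [] []; rewrite /= ?sg0 ?sg1; nring.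
Qed.

Lemma mode_strx n i j : (F i j * strx par (x ^+ n)) v = 0.
Proof.
have E : (F i j * strx par (x ^+ n)) v = \sum_k (sg (par k) : endo N) ((F i j * (x ^+ n) k k) v).
  rewrite /strx mulr_sumr endo_sum; apply: eq_bigr => k _.
  by rewrite sgCA endoM.
rewrite {}E; case: n => [|n].
  by rewrite big1 // => k _; rewrite expr0 mxE eqxx mulr1 Fv endo0r.
rewrite (eq_bigr (fun k => (\sum_(q < n.+1) \sum_a
    sg (par k (+) ((par i (+) par j) && (par k (+) par a)))
    * ((x ^+ q) k a * first_term (n - q) i j a k)) v)) => [|k _].
  by rewrite -endo_sum exchange_big (trace_first_term n i j).
rewrite mode_pow -endoM mulr_sumr; apply: (congr1 (fun z : R => z v)).
apply: eq_bigr => q _; rewrite mulr_sumr; apply: eq_bigr => a _.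
by rewrite sgMMl subSS.
Qed.

End Annihilation.

Fact ann_add3 (N : zmodType) (a a' b c c' : endo N) (v : N) :
  a v = a' v -> c v = c' v -> (a + b + c) v = (a' + b + c') v.
Proof. by move=> Ea Ec; rewrite !endoE Ea Ec. Qed.

Lemma sdimC (N : zmodType) d (par : 'I_d -> bool) (y : endo N) : y * sdim N par = sdim N par * y.
Proof. by rewrite /sdim mulr_sumr mulr_suml; apply: eq_bigr => i _; rewrite sgC. Qed.

(** * Grading and lowering operators on powers of T *)

Section Lowering.
Variables (N : zmodType) (d : nat) (par : 'I_d -> bool).
Local Notation R := (endo N).
Variables (x : 'M[R]_d) (G : 'I_d -> 'I_d -> R) (h l : R).
Hypothesis GT : forall i j k l,
  scom (par i (+) par j) (par k (+) par l) (G i j) (x k l)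
  = (if k == j then sg (par j) * x i l else 0)
    - (if l == i then sg (((par i (+) par j) && (par k (+) par l)) (+) par i) * x k j else 0).
Hypothesis hT : forall i j, h * x i j = x i j * h + x i j.
Hypothesis lT : forall i j, l * x i j = x i j * l + (if j == i then h + h else 0) + G i j.

Lemma grading_pow p i j : h * (x ^+ p) i j = (x ^+ p) i j * h + (x ^+ p) i j *+ p.
Proof.
elim: p i => [|p IHp] i.
  by rewrite expr0 mxE addr0; case: (i == j); rewrite ?mulr1 ?mul1r ?mulr0 ?mul0r.
rewrite exprS_mxE mulr_sumr mulr_suml -sumrMnl -big_split; apply: eq_bigr => a _ /=.
rewrite mulrS -mulrnAr mulrA hT mulrDl -(mulrA (x i a) h) IHp; nring.
Qed.

Lemma grading_strx p : h * strx par (x ^+ p) = strx par (x ^+ p) * h + strx par (x ^+ p) *+ p.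
Proof.
rewrite /strx mulr_sumr mulr_suml -sumrMnl -big_split; apply: eq_bigr => i _ /=.
by rewrite sgCA grading_pow mulrDr mulrA mulrnAr.
Qed.

Variable v : N.
Hypothesis Gv : forall i j, G i j v = 0.

(** (h + h) x^p plus the sum of the products of zero modes with x^p, as it acts on v, after h has
    been moved to the right and the zero modes evaluated by [trace_mode]. *)
Definition low_term p i j : R :=
  (x ^+ p) i j * h *+ 2 + (x ^+ p) i j *+ (p.*2) + sdim N par * (x ^+ p) i j
  - (if j == i then strx par (x ^+ p) else 0).

Fact low_termE p i j : (h + h) * (x ^+ p) i j
  + (sdim N par * (x ^+ p) i j - (if j == i then strx par (x ^+ p) else 0)) = low_term p i j.
Proof. rewrite /low_term -addnn mulrnDr mulr2n mulrDl grading_pow; nring. Qed.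

Lemma lowering_pow p i j : (l * (x ^+ p) i j) v
  = ((x ^+ p) i j * l + \sum_(q < p) \sum_a (x ^+ q) i a * low_term (p - q.+1) a j) v.
Proof.
elim: p i => [|p IHp] i.
  by rewrite big_ord0 addr0 expr0 mxE; case: (i == j);
    rewrite ?mulr1 ?mul1r ?mulr0 ?mul0r.
rewrite exprS_mxE mulr_sumr.
have -> : \sum_a l * (x i a * (x ^+ p) a j)
    = \sum_a x i a * (l * (x ^+ p) a j) + (h + h) * (x ^+ p) i j
      + \sum_a G i a * (x ^+ p) a j.
  rewrite -[(h + h) * _](sum_if1 i (fun a => (h + h) * (x ^+ p) a j)) -!big_split /=.
  by apply: eq_bigr => a _; rewrite [LHS]mulrA lT !(mulrDl, if_mull) -!mulrA.
have HA : (\sum_a x i a * (l * (x ^+ p) a j)) v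
    = (\sum_a (x i a * ((x ^+ p) a j * l)
       + \sum_(q < p) \sum_b x i a * (x ^+ q) a b * low_term (p - q.+1) b j)) v.
  rewrite !endo_sum; apply: eq_bigr => a _; rewrite endoM IHp -endoM.
  apply: (congr1 (fun z : R => z v)); rewrite mulrDr; congr (_ + _).
  rewrite mulr_sumr; apply: eq_bigr => q _; rewrite mulr_sumr; apply: eq_bigr => b _.
  by rewrite mulrA.
apply: etrans (ann_add3 _ HA (trace_mode GT Gv p i j)) _.
apply: (congr1 (fun z : R => z v)); rewrite big_split /= [X in _ = X + _]mulr_suml big_ord_recl subn1 /=.
rewrite -addrA low_termE -addrA; congr (_ + _); first by apply: eq_bigr => a _; rewrite mulrA.
rewrite addrC; congr (_ + _).
  rewrite (eq_bigr (fun a => if i == a then low_term p a j else 0)); last first.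
    by move=> a _; rewrite expr0 mxE; case: eqP => _; rewrite ?mul1r ?mul0r.
  by rewrite sum_if1r.
rewrite exchange_big; apply: eq_bigr => q _; rewrite exchange_big; apply: eq_bigr => b _ /=.
by rewrite -mulr_suml exprS_mxE subSS.
Qed.

Fact strx_mulr (y : 'M[R]_d) z : strx par y * z = \sum_i sg (par i) * (y i i * z).
Proof. by rewrite /strx mulr_suml; apply: eq_bigr => i _; rewrite mulrA. Qed.

Fact low_sum (y : 'M[R]_d) r i : \sum_a y i a * low_term r a i
  = ((y *m x ^+ r) i i * h) *+ 2 + (y *m x ^+ r) i i *+ r.*2
    + sdim N par * (y *m x ^+ r) i i - y i i * strx par (x ^+ r).
Proof.
rewrite -[y i i * _](sum_if1r i (fun a => y i a * strx par (x ^+ r))) mxE.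
rewrite [X in _ = X *+ 2 + _ + _ - _]mulr_suml -!sumrMnl.
rewrite [X in _ = _ + X - _]mulr_sumr -!big_split -sumrB; apply: eq_bigr => a _ /=.
rewrite /low_term mulrBr !mulrDr !mulrnAr if_mulr !mulrA.
by rewrite sdimC.
Qed.

(** Only the shape matters later: everything on the right is built from supertraces of powers,
    signs, and h or l applied directly to v. This gives stability of the span of supertraces under
    l. *)
Lemma lowering_strx p : (l * strx par (x ^+ p)) v
  = (strx par (x ^+ p) * l + \sum_(q < p) (strx par (x ^+ p.-1) * h *+ 2
      + strx par (x ^+ p.-1) *+ ((p - q.+1).*2)
      + sdim N par * strx par (x ^+ p.-1)
      - strx par (x ^+ q) * strx par (x ^+ (p - q.+1)))) v.
Proof.
have -> : (l * strx par (x ^+ p)) v = \sum_i (sg (par i) : R) ((l * (x ^+ p) i i) v).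
  by rewrite /strx mulr_sumr endo_sum; apply: eq_bigr => i _; rewrite sgCA endoM.
rewrite (eq_bigr (fun i => (sg (par i) * ((x ^+ p) i i * l)
   + \sum_(q < p) sg (par i) * (\sum_a (x ^+ q) i a * low_term (p - q.+1) a i)) v)) => [|i _].
  rewrite -[LHS]endo_sum; apply: (congr1 (fun z : R => z v)); rewrite big_split exchange_big /=.
  congr (_ + _); first by rewrite mulr_suml; apply: eq_bigr => i _; rewrite mulrA.
  apply: eq_bigr => q _; have -> : p.-1 = (q + (p - q.+1))%N.
    by case: p q => [[]//|p] q; rewrite subSS /= subnKC // -ltnS.
  move: (p - q.+1)%N => r; rewrite exprD.
  under eq_bigr do rewrite low_sum mulrBr !mulrDr !mulrnAr -(sgCA _ (sdim N par)).
  by rewrite sumrB !big_split /= !sumrMnl -mulr_sumr -!strx_mulr.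
rewrite lowering_pow -endoM mulrDr mulr_sumr.
by apply: (congr1 (fun z : R => z v)).
Qed.

End Lowering.

(** * The span generated from the vacuum by supertraces of powers *)

Section Span.
Variables (C : fieldType) (N : lmodType C) (d : nat) (par : 'I_d -> bool).
Local Notation R := (endo N).
Hypothesis char0 : forall k, k.+1%:R != 0 :> C.
Variables (x : 'M[R]_d) (e : nat -> 'I_d -> 'I_d -> R) (h l : R) (v0 : N).
Let G i j := sg (par i) * e 0 i j.
Let F i j := sg (par i) * e 1 i j.
Hypothesis two_reg : forall z : R, z + z = 0 -> z = 0.
Hypothesis xM : smanin par x.
Hypothesis GT : forall i j k l,
  scom (par i (+) par j) (par k (+) par l) (G i j) (x k l)
  = (if k == j then sg (par j) * x i l else 0)
    - (if l == i then sg (((par i (+) par j) && (par k (+) par l)) (+) par i) * x k j else 0).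
Hypothesis FT : forall i j k l,
  scom (par i (+) par j) (par k (+) par l) (F i j) (x k l)
  = (if l == k then G i j else 0) + (if k == j then sg (par j) * G i l else 0)
    - (if l == i then sg (((par i (+) par j) && (par k (+) par l)) (+) par i) * G k j else 0)
    - (if k == j then if l == i then sg (par k) * sdim N par else 0 else 0)
    + (if i == j then if l == k then 1 else 0 else 0).
Hypothesis hT : forall i j, h * x i j = x i j * h + x i j.
Hypothesis lT : forall i j, l * x i j = x i j * l + (if j == i then h + h else 0) + G i j.
Hypothesis le : forall r i j, e r i j * l - l * e r i j = e r.+1 i j *+ r.
Hypothesis eZ : forall r i j c v, e r i j (c *: v) = c *: e r i j v.
Hypothesis hZ : forall c v, h (c *: v) = c *: h v.
Hypothesis lZ : forall c v, l (c *: v) = c *: l v.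
Hypothesis ev0 : forall r i j, e r i j v0 = 0.
Hypothesis hv0 : h v0 = 0.
Hypothesis lv0 : l v0 = 0.

Inductive str_span : N -> Prop :=
| str_span0 : str_span 0
| str_span_base : str_span v0
| str_spanP c u v : str_span u -> str_span v -> str_span (c *: u + v)
| str_span_strx p v : str_span v -> str_span (strx par (x ^+ p) v).

Lemma str_spanD u v : str_span u -> str_span v -> str_span (u + v).
Proof. by move=> Su Sv; rewrite -[u]scale1r; apply: str_spanP. Qed.

Lemma str_spanZ c u : str_span u -> str_span (c *: u).
Proof. by move=> Su; rewrite -[_ *: _]addr0; apply: str_spanP => //; apply: str_span0. Qed.

Lemma str_spanMn k u : str_span u -> str_span (u *+ k).
Proof. by rewrite -scaler_nat; apply: str_spanZ. Qed.

Lemma str_spanN u : str_span u -> str_span (- u).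
Proof. by rewrite -scaleN1r; apply: str_spanZ. Qed.

Lemma str_span_sg b u : str_span u -> str_span ((sg b : R) u).
Proof.
case: b; rewrite ?sg0 ?sg1 // => Su.
by rewrite endoN endo1; apply: str_spanN.
Qed.

Lemma str_span_sum (I : Type) (r : seq I) (f : I -> N) :
  (forall i, str_span (f i)) -> str_span (\sum_(i <- r) f i).
Proof. by move=> Sf; apply: big_ind => //; [exact: str_span0 | exact: str_spanD]. Qed.

Lemma endoMn (z : R) k v : (z *+ k) v = z v *+ k.
Proof. by elim: k => // k IHk; rewrite !mulrS endoD IHk. Qed.

Lemma str_span_modes v : str_span v -> forall i j, e 0 i j v = 0 /\ e 1 i j v = 0.
Proof.
have sg_eq0 b (z : R) u : (sg b * z) u = 0 -> z u = 0.
  by move=> zu; rewrite -(sgK b z) endoM zu endo0r.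
elim=> {v} [||c u v _ IHu _ IHv|p v _ IHv] i j; rewrite ?endo0r //.
  by rewrite !endoDr !eZ; have [-> ->] := IHu i j; have [-> ->] := IHv i j; rewrite !scaler0 addr0.
have Gv i' j' : G i' j' v = 0 by rewrite /G endoM; have [-> _] := IHv i' j'; rewrite endo0r.
have Fv i' j' : F i' j' v = 0 by rewrite /F endoM; have [_ ->] := IHv i' j'; rewrite endo0r.
split; apply: (@sg_eq0 (par i)); rewrite -[LHS]endoM.
  by rewrite -/(G i j) (zero_mode_strx GT) endoM Gv endo0r.
exact: (mode_strx two_reg xM GT FT Gv Fv).
Qed.

Lemma str_span_zero v : str_span v -> forall i j, G i j v = 0.
Proof. by move=> Sv i j; rewrite /G endoM; have [-> _] := str_span_modes Sv i j; rewrite endo0r. Qed.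

Lemma str_span_grading v : str_span v -> str_span (h v).
Proof.
elim=> {v} [||c u v _ IHu _ IHv|p v Sv IHv]; rewrite ?endo0r ?hv0; try exact: str_span0.
  by rewrite endoDr hZ; apply: str_spanP.
rewrite -endoM (grading_strx _ hT) endoD endoM endoMn; apply: str_spanD.
  exact: str_span_strx.
by apply: str_spanMn; apply: str_span_strx.
Qed.

Lemma str_span_lowering v : str_span v -> str_span (l v).
Proof.
elim=> {v} [||c u v _ IHu _ IHv|p v Sv IHv]; rewrite ?endo0r ?lv0; try exact: str_span0.
  by rewrite endoDr lZ; apply: str_spanP.
rewrite -endoM (lowering_strx GT hT lT) ?endoD; last exact: str_span_zero.
rewrite endoM; apply: str_spanD; first exact: str_span_strx.
rewrite endo_sum; apply: str_span_sum => q; rewrite !endoD endoN !endoMn !endoM.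
apply: str_spanD; last by apply/str_spanN; do 2!apply: str_span_strx.
apply: str_spanD; first apply: str_spanD.
- by apply: str_spanD; apply/str_span_strx/str_span_grading.
- by apply/str_spanMn/str_span_strx.
by rewrite /sdim endo_sum; apply: str_span_sum => i; apply/str_span_sg/str_span_strx.
Qed.

(** The commutator of e_r with l is r e_(r+1), which yields nothing for r = 0; hence the separate
    base cases r = 0 and r = 1. The induction uses that l preserves the span. *)
Lemma str_span_killed v : str_span v -> forall r i j, e r i j v = 0.
Proof.
move=> + r; elim: r v => [|[|r] IHr] v Sv i j.
- by have [] := str_span_modes Sv i j.
- by have [] := str_span_modes Sv i j.
have : e r.+2 i j v *+ r.+1 = 0.
  rewrite -endoMn -le endoD endoN !endoM (IHr v Sv) (IHr _ (str_span_lowering Sv)).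
  by rewrite endo0r subrr.
by rewrite -scaler_nat => /eqP; rewrite scaler_eq0 (negbTE (char0 _)) => /eqP.
Qed.

Fact str_span_divn k u : str_span (u *+ k.+1) -> str_span u.
Proof.
move=> Su; have -> : u = k.+1%:R^-1 *: (u *+ k.+1).
  by rewrite -scaler_nat scalerA mulVf ?scale1r.
exact: str_spanZ.
Qed.

(** The supertrace acts before c here, so the induction hypothesis has to cover all vectors of the
    span. *)
Lemma str_span_newton_left (c : nat -> R) : c 0%N = 1 ->
  (forall k, c k.+1 *+ k.+1 = \sum_(l < k.+1) sg (odd l) * c (k - l)%N * strx par (x ^+ l.+1)) ->
  forall k v, str_span v -> str_span (c k v).
Proof.
move=> c0 cS; elim/ltn_ind => -[_ v Sv|k IHk v Sv]; first by rewrite c0 endo1.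
apply: (@str_span_divn k); rewrite -endoMn cS endo_sum; apply: str_span_sum => q.
rewrite !endoM; apply: str_span_sg; apply: IHk; first by rewrite ltnS leq_subr.
exact: str_span_strx.
Qed.

Lemma str_span_newton_right (c : nat -> R) : c 0%N = 1 ->
  (forall k, c k.+1 *+ k.+1 = \sum_(l < k.+1) strx par (x ^+ l.+1) * c (k - l)%N) ->
  forall k v, str_span v -> str_span (c k v).
Proof.
move=> c0 cS; elim/ltn_ind => -[_ v Sv|k IHk v Sv]; first by rewrite c0 endo1.
apply: (@str_span_divn k); rewrite -endoMn cS endo_sum; apply: str_span_sum => q.
rewrite endoM; apply: str_span_strx; apply: IHk => //; by rewrite ltnS leq_subr.
Qed.

End Span.

(** * Supercommutators of zero and first modes with the entries of T *)

Section Entries.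
Variable R : pzRingType.

Fact zero_mode_entries (bi bj bk bl dkl dkj dil : bool) (t g e1 e2 e3 : R) :
  (dkl -> bk = bl) -> (dkj -> bk = bj) -> (dil -> bi = bl) ->
  g * t = t * g ->
  scom (bi (+) bj) (bk (+) bl) g e1
  = dkj%:R * e2 - sg ((bi (+) bj) && (bk (+) bl)) * (dil%:R * e3) ->
  scom (bi (+) bj) (bk (+) bl) (sg bi * g) (dkl%:R * t + sg bk * e1)
  = (if dkj then sg bj * (dil%:R * t + sg bi * e2) else 0)
    - (if dil then sg (((bi (+) bj) && (bk (+) bl)) (+) bi) * (dkj%:R * t + sg bk * e3) else 0).
Proof.
move=> Hkl Hkj Hil /eqP; rewrite -subr_eq0 => /eqP H1 /eqP; rewrite -subr_eq0 => /eqP H2.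
apply/eqP; rewrite -subr_eq0; apply/eqP.
apply: (lincomb2 (s := dkl%:R * sg bi) (s' := - sg (bi (+) bk)) H1 H2).
move: {H1 H2} Hkl Hkj Hil; rewrite /scom.
by case: dkl dkj dil bi bj bk bl => [] [] [] [] [] [] [] Hkl Hkj Hil;
  try solve [have := Hkl isT => // | have := Hkj isT => //
    | have := Hil isT => //]; rewrite /= ?sg0 ?sg1 ?mulr1n ?mulr0n; nring.
Qed.

Fact one_mode_entries (bi bj bk bl dij dkl dkj dil : bool) (t f g e1 e2 e3 sd : R) :
  (dij -> bi = bj) -> (dkl -> bk = bl) -> (dkj -> bk = bj) -> (dil -> bi = bl) ->
  f * t - t * f = g ->
  scom (bi (+) bj) (bk (+) bl) f e1
  = dkj%:R * e2 - sg ((bi (+) bj) && (bk (+) bl)) * (dil%:R * e3)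
    + (- (dkj%:R * dil%:R * sg bi * sd) + dij%:R * dkl%:R * sg (bi (+) bk)) ->
  scom (bi (+) bj) (bk (+) bl) (sg bi * f) (dkl%:R * t + sg bk * e1)
  = (if dkl then sg bi * g else 0) + (if dkj then sg bj * (sg bi * e2) else 0)
    - (if dil then sg (((bi (+) bj) && (bk (+) bl)) (+) bi) * (sg bk * e3) else 0)
    - (if dkj then if dil then sg bk * sd else 0 else 0)
    + (if dij then if dkl then 1 else 0 else 0).
Proof.
move=> Hij Hkl Hkj Hil /eqP; rewrite -subr_eq0 => /eqP H1 /eqP; rewrite -subr_eq0 => /eqP H2.
apply/eqP; rewrite -subr_eq0; apply/eqP.
apply: (lincomb2 (s := dkl%:R * sg bi) (s' := - sg (bi (+) bk)) H1 H2).
move: {H1 H2} Hij Hkl Hkj Hil; rewrite /scom.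
by case: dij dkl dkj dil bi bj bk bl => [] [] [] [] [] [] [] [] Hij Hkl Hkj Hil;
  try solve [have := Hij isT => // | have := Hkl isT => // | have := Hkj isT => //
    | have := Hil isT => //]; rewrite /= ?sg0 ?sg1 ?mulr1n ?mulr0n; nring.
Qed.

End Entries.

Section LinearOp.
Variables (C : fieldType) (M : lmodType C).
Implicit Types y z : endo M.

Definition linear_op z := forall (c : C) v, z (c *: v) = c *: z v.

Lemma linear_opM y z : linear_op y -> linear_op z -> linear_op (y * z).
Proof. by move=> ly lz c v; rewrite !endoM lz ly. Qed.

Lemma linear_opB y z : linear_op y -> linear_op z -> linear_op (y - z).
Proof. by move=> ly lz c v; rewrite !(endoD, endoN) ly lz scalerBr. Qed.

Lemma linear_op_int k : linear_op k%:~R.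
Proof. by move=> c v; rewrite -(rmorph_int (scalar_op M)) /= !scalerA mulrC. Qed.

End LinearOp.

Fact comm_step (R : pzRingType) (a b g gs gt gst k ks kt : R) :
  (forall y z, y * (k * z) = k * (y * z)) ->
  a * g = g * a + k * gs -> b * g = g * b + k * gt ->
  a * gt = gt * a + kt * gst -> b * gs = gs * b + ks * gst ->
  a * (b * g) - b * (a * g) = g * (a * b - b * a) + k * ((kt - ks) * gst).
Proof.
move=> kC E1 E2 E3 E4; rewrite E1 E2 !mulrDr !kC E3 E4 !mulrA E1 E2; nring.
Qed.

Fact lie_step (R : pzRingType) (a b c g gst k u : R) :
  (forall y z, y * (u * z) = u * (y * z)) -> (forall y z, y * (k * z) = k * (y * z)) ->
  a * (b * g) - b * (a * g) = g * (a * b - b * a) + k * (u * gst) ->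
  c * g = g * c + k * gst ->
  (a * b - b * a - u * c) * g = g * (a * b - b * a - u * c).
Proof.
move=> uC kC E1 E2; rewrite [LHS]mulrBl -(mulrA u) E2 mulrBl -!(mulrA _ _ g) E1.
by rewrite mulrDr (uC k) mulrBr (uC g) [_ + k * _]addrC; nring.
Qed.

Fact dstep (R : pzRingType) (a s : nat) (d g g' : R) :
  d * g = g * d + s%:R * g' -> d * (a%:R * g) = a%:R * g * d + s%:R * a%:R * g'.
Proof.
move=> E; rewrite mulrA (commr_nat d a) -[LHS]mulrA E mulrDr !mulrA; congr (_ + _ * _).
exact: commr_nat.
Qed.

(** * Translation, grading and lowering on the vacuum module *)

Section VacuumOperators.
Variables (C : fieldType) (m n : nat).
Local Notation V := (vacmod C m n).
Local Notation I := 'I_(m + n).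
Local Notation par := (@par m n).
Local Notation ga i j r := (act_op (e_ C i j r)).

Lemma vac_ind (P : V -> Prop) : (forall c u v, P u -> P v -> P (c *: u + v)) ->
  P (vac C m n) -> (forall i j r v, P v -> P (ga i j r v)) -> forall v, P v.
Proof.
move=> Plin Pvac Pact v; rewrite -[v]reprK; move: (repr v) => x.
have P0 : P 0 by rewrite -(subrr (vac C m n)) addrC -scaleN1r; apply: Plin.
have Pword w : P (\pi_V (word C w)).
  elim: w => [|a w IHw]; first by rewrite word_nil.
  rewrite word_cons -act_pi; case: a => [[[i j] r]|]; first exact: (Pact i j r).
  by rewrite -[act _ _]/(act_op (K' C m n) _) act_central.
pose Q (y : free_alg C (gen m n)) := P (\pi_V y).
rewrite -/(Q x) (free_algE x); apply: (big_ind Q).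
- rewrite /Q (_ : \pi_V 0 = 0 :> V) //; by have := vac_piZ 0 (0 : free_alg C (gen m n)); rewrite !scale0r.
- by move=> y z Qy Qz; rewrite /Q vac_piD -[\pi_V y]scale1r; apply: Plin.
by move=> w _; rewrite /Q vac_piZ -[_ *: _]addr0; apply: Plin.
Qed.

Lemma act_vac_pos i j (r : nat) : ga i j r%:Z (vac C m n) = 0.
Proof.
rewrite act_opE /vac act_pi; have J : vac_ideal (e_ C i j r%:Z * 1 - 0).
  rewrite (_ : _ - 0 = e_ C i j r%:Z); first exact: vac_ideal_ann.
  exact: etrans (subr0 _) (mulr1 _).
apply: etrans ((vac_piP (e_ C i j r%:Z * 1) 0).2 J) _.
by have := vac_piZ 0 (0 : free_alg C (gen m n)); rewrite !scale0r.
Qed.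

(** V is generated from the vacuum by modes, so a linear operator that kills the vacuum and commutes
    with all modes is zero. *)
Lemma vac_endo_eq0 (Z : endo V) : (forall c v, Z (c *: v) = c *: Z v) ->
  Z (vac C m n) = 0 -> (forall i j r, Z * ga i j r = ga i j r * Z) -> Z = 0.
Proof.
move=> Zlin Zvac Zg; apply: endoP; apply: vac_ind => //.
  by move=> c u v Zu Zv; rewrite endoDr Zlin Zu Zv scaler0 addr0.
by move=> i j r v Zv; rewrite -endoM Zg endoM Zv endo0r.
Qed.

Lemma mode_op_int s (s1 : (-1 <= s)%R) i j r :
  mode_op C m n s1 * ga i j r = ga i j r * mode_op C m n s1 + (- r)%:~R * ga i j (r + s).
Proof. by rewrite mode_op_act rmorph_int. Qed.

Fact leN1N1 : (-1 <= -1 :> int)%R. Proof. by []. Qed.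
Fact leN10 : (-1 <= 0 :> int)%R. Proof. by []. Qed.
Fact leN11 : (-1 <= 1 :> int)%R. Proof. by []. Qed.
Local Notation D := (mode_op C m n leN1N1).
Local Notation H := (mode_op C m n leN10).
Local Notation L := (mode_op C m n leN11).

Fact intC (k : int) (y z : endo V) : y * (k%:~R * z) = k%:~R * (y * z).
Proof. by rewrite !mulrA (commr_int y k). Qed.

Fact mode_comm s t (s1 : (-1 <= s)%R) (t1 : (-1 <= t)%R) i j r :
  mode_op C m n s1 * (mode_op C m n t1 * ga i j r)
    - mode_op C m n t1 * (mode_op C m n s1 * ga i j r)
  = ga i j r * (mode_op C m n s1 * mode_op C m n t1 - mode_op C m n t1 * mode_op C m n s1)
    + (- r)%:~R * ((s - t)%:~R * ga i j (r + s + t)).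
Proof.
have E1 := mode_op_int s1 i j r; have E2 := mode_op_int t1 i j r.
have E3 := mode_op_int s1 i j (r + t); have E4 := mode_op_int t1 i j (r + s).
rewrite addrAC in E3.
have -> : (s - t)%:~R = (- (r + t))%:~R - (- (r + s))%:~R :> endo V.
  by rewrite -rmorphB; congr (_%:~R); lia.
exact: (comm_step (intC (- r)) E1 E2 E3 E4).
Qed.

(** The two sides have the same commutators with all modes and kill the vacuum, so [vac_endo_eq0]
    applies to their difference. *)
Fact mode_op_lie s t u (s1 : (-1 <= s)%R) (t1 : (-1 <= t)%R) (u1 : (-1 <= u)%R) :
  s + t = u ->
  mode_op C m n s1 * mode_op C m n t1 - mode_op C m n t1 * mode_op C m n s1
  = (s - t)%:~R * mode_op C m n u1.
Proof.
move=> stu; apply/eqP; rewrite -subr_eq0; apply/eqP; apply: vac_endo_eq0.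
- have lD s' (s1' : (-1 <= s')%R) : linear_op (mode_op C m n s1') by exact: mode_opZ.
  by apply: linear_opB; [apply: linear_opB; apply: linear_opM | apply/linear_opM => //; exact: linear_op_int].
- by rewrite !(endoD, endoN, endoM) !mode_op_vac !endo0r !subr0.
move=> i j r; have E5 : mode_op C m n u1 * ga i j r
    = ga i j r * mode_op C m n u1 + (- r)%:~R * ga i j (r + s + t).
  by rewrite -(addrA r) stu; exact: mode_op_int.
exact: (lie_step (intC (s - t)) (intC (- r)) (mode_comm s1 t1 i j r) E5).
Qed.

Lemma grading_D : H * D - D * H = D.
Proof. by rewrite (mode_op_lie leN10 leN1N1 leN1N1) // opprK add0r mul1r. Qed.

Lemma lowering_D : L * D - D * L = H + H.
Proof. by rewrite (mode_op_lie leN11 leN1N1 leN10) // opprK rmorphD mulrDl !mul1r. Qed.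

(** The state of the s-th derivative of e_ij(z) is s! e_ij[-s-1], whence the factorial. *)
Definition dact (x : dletter m n) : endo V :=
  (x.2)`!%:R * ga x.1.1 x.1.2 (- x.2.+1%:Z).

Lemma dact_lin x c v : dact x (c *: v) = c *: dact x v.
Proof.
by move: c v; apply: linear_opM; [exact: (linear_op_int (_`!)) | exact: act_opZr].
Qed.

Lemma dact0 i j : dact ((i, j), 0%N) = ga i j (-1).
Proof. by rewrite /dact fact0 mul1r. Qed.

Lemma dact1 i j : dact ((i, j), 1%N) = ga i j (-1 + -1).
Proof. by rewrite /dact mul1r. Qed.

Lemma D_dact ij s v : D (dact (ij, s) v) = dact (ij, s) (D v) + dact (ij, s.+1) v.
Proof.
rewrite -!endoM -[RHS]endoD; apply: (congr1 (fun z : endo V => z v)); rewrite /dact /=.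
have E := mode_op_int leN1N1 ij.1 ij.2 (- s.+1%:Z).
have E1 : - s.+1%:Z + -1 = - s.+2%:Z by lia.
rewrite E1 opprK in E; rewrite factS natrM; exact: (@dstep _ (s`!) s.+1 _ _ _ E).
Qed.

Lemma dact_comm i j k l :
  scom (par i (+) par j) (par k (+) par l) (dact ((i, j), 0%N)) (dact ((k, l), 0%N))
  = (k == j)%:R * dact ((i, l), 1%N)
    - sg ((par i (+) par j) && (par k (+) par l)) * ((i == l)%:R * dact ((k, j), 1%N)).
Proof. by rewrite !dact0 !dact1 act_comm mulr0 rmorph0 addr0. Qed.

End VacuumOperators.

(** * Segal-Sugawara vectors *)

Section ShiftOperators.
Variables (C : fieldType) (W : lmodType C).
Local Notation M := (nat -> W).

Fact endo_rMn (X : endo W) k v : X (v *+ k) = X v *+ k.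
Proof. by elim: k => [|k IHk]; rewrite ?endo0r // !mulrS endoDr IHk. Qed.

Lemma dshift_comm (D X : endo W) :
  dshift D * pointwise X - pointwise X * dshift D = pointwise (D * X - X * D).
Proof.
apply: endoP => f; apply/funext => p; rewrite !(endoD, endoN, endoM).
change (dshift_fun D (pointwise_fun X f) p - X (dshift_fun D f p)
  = D (X (f p)) - X (D (f p))).
rewrite /dshift_fun /pointwise_fun endoDr opprD addrACA.
by case: p => [|p]; rewrite ?endo0r subrr add0r.
Qed.

Fact deg_subproof : zmod_morphism (fun (f : M) p => f p *+ p).
Proof. by move=> f g; apply/funext => p; rewrite fctE mulrnBl. Qed.
(** Counts powers of d_z. Added to the grading of V it makes [Vh] a grading for which d_z has degree
    one. *)
Definition deg_op : endo M := Endo deg_subproof.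

Fact low_subproof : zmod_morphism (fun (f : M) p => f p.+1 *+ (p.+1 * p)).
Proof. by move=> f g; apply/funext => p; rewrite fctE mulrnBl. Qed.
(** d_z^q goes to q (q - 1) d_z^(q-1). This weight makes its commutator with d_z equal to 2 [deg_op]
    and so matches [lowering_D]: the commutator of [Vl] with d_z is 2 [Vh]. *)
Definition low_op : endo M := Endo low_subproof.

Lemma deg_pointwise X : deg_op * pointwise X = pointwise X * deg_op.
Proof.
apply: endoP => f; apply/funext => p; rewrite !endoM.
by change (X (f p) *+ p = X (f p *+ p)); rewrite endo_rMn.
Qed.

Lemma low_pointwise X : low_op * pointwise X = pointwise X * low_op.
Proof.
apply: endoP => f; apply/funext => p; rewrite !endoM.
by change (X (f p.+1) *+ (p.+1 * p) = X (f p.+1 *+ (p.+1 * p))); rewrite endo_rMn.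
Qed.

Lemma deg_dshift D : deg_op * dshift D = dshift D * deg_op + dshift D - pointwise D.
Proof.
apply: endoP => f; apply/funext => p; rewrite !(endoD, endoN, endoM).
change (dshift_fun D f p *+ p = dshift_fun D (fun p => f p *+ p) p + dshift_fun D f p - D (f p)).
rewrite /dshift_fun endo_rMn mulrnDl addrA addrK [RHS]addrAC.
by case: p => [|p]; rewrite ?mul0rn ?addr0 // -mulrSr.
Qed.

Lemma low_dshift D : low_op * dshift D = dshift D * low_op + deg_op + deg_op.
Proof.
apply: endoP => f; apply/funext => p; rewrite !(endoD, endoN, endoM).
change (dshift_fun D f p.+1 *+ (p.+1 * p)
  = dshift_fun D (fun p => f p.+1 *+ (p.+1 * p)) p + f p *+ p + f p *+ p).
rewrite /dshift_fun endo_rMn mulrnDl -addrA [RHS]addrAC; congr (_ + _).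
case: p => [|p]; first by rewrite muln0 !mulr0n !addr0.
by rewrite -!mulrnDr; congr (_ *+ _); lia.
Qed.

End ShiftOperators.

Section Annihilators.
Variables (C : fieldType) (m n : nat).
Hypothesis char0 : forall k, k.+1%:R != 0 :> C.
Local Notation V := (vacmod C m n).
Local Notation M := (nat -> V).
Local Notation I := 'I_(m + n).
Local Notation par := (@par m n).
Local Notation ga i j r := (act_op (e_ C i j r)).
Local Notation D := (mode_op C m n leN1N1).
Local Notation tau := (dshift D).

Definition Vx : 'M[endo M]_(m + n) := \matrix_(i, j) Topr (@dact C m n) D i j.
Definition Ve (r : nat) i j : endo M := pointwise (ga i j r%:Z).
Definition Vh : endo M := pointwise (mode_op C m n leN10) + deg_op V.
Definition Vl : endo M := pointwise (mode_op C m n leN11) + low_op V.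
Definition V0 : M := const0 (vac C m n).

Lemma VxE i j : Vx i j = (i == j)%:R * tau + sg (par i) * pointwise (ga i j (-1)).
Proof. by rewrite mxE /Topr dact0. Qed.

Lemma mode_dshift r i j :
  pointwise (ga i j r) * tau = tau * pointwise (ga i j r) + r%:~R * pointwise (ga i j (r - 1)).
Proof.
have := dshift_comm D (ga i j r); rewrite mode_op_int addrAC subrr add0r.
rewrite rmorphM rmorph_int rmorphN /= mulNr => /eqP; rewrite subr_eq => /eqP ->.
by rewrite addrAC addNr add0r.
Qed.

Fact V_two_reg (z : endo M) : z + z = 0 -> z = 0.
Proof. exact: (endo_torsion_free char0 (k := 1)). Qed.

Fact Vx_manin : smanin par Vx.
Proof.
have Mn := Topr_manin (@D_dact C m n) (@dact_comm C m n).
by move=> i j k l; rewrite ![Vx _ _]mxE; apply: Mn.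
Qed.

Lemma Vcomm r i j k l :
  scom (par i (+) par j) (par k (+) par l) (pointwise (ga i j r)) (pointwise (ga k l (-1)))
  = (k == j)%:R * pointwise (ga i l (r - 1))
    - sg ((par i (+) par j) && (par k (+) par l)) * ((i == l)%:R * pointwise (ga k j (r - 1)))
    + pointwise (scalar_op V (cocycle C i j k l * r%:~R * (r == 1)%:R)).
Proof.
rewrite -pointwise_scom act_comm opprK rmorphD rmorphB; congr (_ - _ + _).
  by rewrite rmorphM rmorph_nat.
by rewrite !rmorphM rmorph_sg rmorph_nat.
Qed.

Lemma sdimE : sdim M par = m%:R - n%:R.
Proof.
rewrite /sdim big_split_ord /= (eq_bigr (fun _ => 1)) => [|i _]; last first.
  by rewrite /Defs.par /= leqNgt ltn_ord sg0.
rewrite [X in _ + X](eq_bigr (fun _ => - 1)) => [|i _]; last first.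
  by rewrite /Defs.par /= leq_addr sg1.
by rewrite !sumr_const !card_ord mulNrn.
Qed.

Lemma V_zero i j k l :
  scom (par i (+) par j) (par k (+) par l) (sg (par i) * Ve 0 i j) (Vx k l)
  = (if k == j then sg (par j) * Vx i l else 0)
    - (if l == i then sg (((par i (+) par j) && (par k (+) par l)) (+) par i) * Vx k j else 0).
Proof.
rewrite !VxE [l == i]eq_sym; apply: zero_mode_entries; try by [move/eqP->].
  by rewrite /Ve mode_dshift mulr0z mul0r addr0.
by rewrite Vcomm sub0r mulr0z mulr0 ?mul0r raddf0 raddf0 addr0.
Qed.

(** At K' = 1 the first part of the cocycle has the coefficient n - m, which is minus the
    superdimension; the second part becomes a bare product of deltas once the signs of the two rows
    are multiplied in. *)
Lemma V_one i j k l :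
  scom (par i (+) par j) (par k (+) par l) (sg (par i) * Ve 1 i j) (Vx k l)
  = (if l == k then sg (par i) * Ve 0 i j else 0)
    + (if k == j then sg (par j) * (sg (par i) * Ve 0 i l) else 0)
    - (if l == i then sg (((par i (+) par j) && (par k (+) par l)) (+) par i)
         * (sg (par k) * Ve 0 k j) else 0)
    - (if k == j then if l == i then sg (par k) * sdim M par else 0 else 0)
    + (if i == j then if l == k then 1 else 0 else 0).
Proof.
rewrite !VxE [l == i]eq_sym [l == k]eq_sym.
apply: (one_mode_entries (t := tau)); try by [move/eqP->].
  by rewrite /Ve mode_dshift mulr1z mul1r addrAC subrr add0r.
rewrite Vcomm; congr (_ + _); rewrite sdimE mulr1z !mulr1 /cocycle.
rewrite !(rmorphB, rmorphD, rmorphM, rmorph_nat, rmorph_sign) !sgE.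
congr (_ + _).
move: (n%:R) (m%:R) => cn cm.
case: (k == j); last by rewrite !(mul0r, mulr0, oppr0).
case: (i == l); last by rewrite !(mul0r, mulr0, oppr0).
by case: (par i); rewrite /= !mulr1n ?expr0 ?expr1; nring.
Qed.

Lemma V_grading i j : Vh * Vx i j = Vx i j * Vh + Vx i j.
Proof.
have Et : Vh * tau = tau * Vh + tau.
  have := dshift_comm D (mode_op C m n leN10); have := deg_dshift D.
  rewrite /Vh mulrDl mulrDr => ->.
  have -> : pointwise (D * mode_op C m n leN10 - mode_op C m n leN10 * D) = - pointwise D.
    by rewrite -[X in - pointwise X]grading_D -rmorphN opprB.
  move/eqP; rewrite subr_eq => /eqP ->; nring.
have Eg : Vh * pointwise (ga i j (-1))
    = pointwise (ga i j (-1)) * Vh + pointwise (ga i j (-1)).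
  rewrite /Vh mulrDl mulrDr deg_pointwise -!rmorphM mode_op_int opprK mul1r addr0.
  by rewrite rmorphD addrAC.
move: Vh Et Eg => h Et Eg; rewrite VxE; case: (i == j); rewrite ?mulr1n ?mulr0n ?mul1r ?mul0r ?add0r.
  by rewrite mulrDr mulrDl sgCA Et Eg mulrDr -!mulrA addrACA.
by rewrite sgCA Eg mulrDr !mulrA.
Qed.

Lemma V_lowering i j :
  Vl * Vx i j = Vx i j * Vl + (if j == i then Vh + Vh else 0) + sg (par i) * Ve 0 i j.
Proof.
have Et : Vl * tau = tau * Vl + (Vh + Vh).
  have := dshift_comm D (mode_op C m n leN11); have := low_dshift D.
  rewrite /Vl mulrDl mulrDr => ->.
  have -> : pointwise (D * mode_op C m n leN11 - mode_op C m n leN11 * D)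
      = - (pointwise (mode_op C m n leN10) + pointwise (mode_op C m n leN10)).
    by rewrite -rmorphD -lowering_D -rmorphN opprB.
  move/eqP; rewrite subr_eq => /eqP ->; rewrite /Vh; nring.
have Eg : Vl * pointwise (ga i j (-1)) = pointwise (ga i j (-1)) * Vl + Ve 0 i j.
  rewrite /Vl mulrDl mulrDr low_pointwise -!rmorphM mode_op_int opprK mul1r.
  by rewrite rmorphD addrAC.
move: Vh Vl (Ve 0 i j) Et Eg => h l e0 Et Eg; rewrite VxE [j == i]eq_sym.
case: (i == j); rewrite ?mulr1n ?mulr0n ?mul1r ?mul0r ?add0r ?mulrDr sgCA ?Et Eg; nring.
Qed.

Lemma V_mode_lowering r i j : Ve r i j * Vl - Vl * Ve r i j = Ve r.+1 i j *+ r.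
Proof.
have E := congr1 (@pointwise C V) (@mode_op_int C m n _ leN11 i j r%:Z).
rewrite rmorphD !rmorphM rmorph_int rmorphN mulNr in E.
have E2 := low_pointwise (ga i j r%:Z).
rewrite /Ve -[r.+1%:Z]/(1 + r%:Z) [1 + _]addrC -mulr_natl /Vl.
have dist (a b c z : endo M) : a * c = c * a - z -> b * c = c * b ->
  c * (a + b) - (a + b) * c = z.
  by move=> Ea Eb; rewrite mulrDr mulrDl Ea Eb; nring.
exact: dist E E2.
Qed.

Lemma V_killed (v : M) : str_span par Vx V0 v -> forall r i j p, act (e_ C i j r%:Z) (v p) = 0.
Proof.
move=> Sv r i j p.
have cst0 (X : endo V) : X (vac C m n) = 0 -> pointwise X V0 = 0.
  move=> X0; by apply/funext => -[|q] /=; rewrite /pointwise_fun /V0 /const0 /= ?X0 ?endo0r.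
have H : Ve r i j v = 0; last by rewrite -[LHS]/(Ve r i j v p) H.
have pZ (X : endo V) c u : (forall c v, X (c *: v) = c *: X v) ->
    pointwise X (c *: u) = c *: pointwise X u.
  by move=> XZ; apply/funext => q; exact: XZ.
have He r' i' j' c u : Ve r' i' j' (c *: u) = c *: Ve r' i' j' u.
  by apply: pZ => c' u'; apply: act_opZr.
have Hh c u : Vh (c *: u) = c *: Vh u.
  rewrite /Vh !endoD scalerDr pZ; last by apply: mode_opZ.
  congr (_ + _); apply/funext => q.
  by change ((c *: u q) *+ q = c *: (u q *+ q)); rewrite scalerMnr.
have Hl c u : Vl (c *: u) = c *: Vl u.
  rewrite /Vl !endoD scalerDr pZ; last by apply: mode_opZ.
  congr (_ + _); apply/funext => q.
  by change ((c *: u q.+1) *+ (q.+1 * q) = c *: (u q.+1 *+ (q.+1 * q))); rewrite scalerMnr.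
have He0 r' i' j' : Ve r' i' j' V0 = 0.
  by apply: cst0; exact: act_vac_pos.
have Hh0 : Vh V0 = 0.
  rewrite /Vh endoD cst0 ?mode_op_vac // add0r; apply/funext => -[|q].
    by change (V0 0 *+ 0 = 0); rewrite mulr0n.
  by change ((0 : V) *+ q.+1 = 0); rewrite mul0rn.
have Hl0 : Vl V0 = 0.
  rewrite /Vl endoD cst0 ?mode_op_vac // add0r; apply/funext => q.
  by change ((0 : V) *+ (q.+1 * q) = 0); rewrite mul0rn.
exact: (str_span_killed char0 V_two_reg Vx_manin V_zero V_one V_grading V_lowering
  V_mode_lowering He Hh Hl He0 Hh0 Hl0 Sv).
Qed.

Lemma str_span_cst : str_span par Vx V0 V0. Proof. exact: str_span_base. Qed.

Definition Veval : {rmorphism free_alg C (opletter m n) -> endo M} :=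
  opeval (@dact_lin C m n) (@mode_opZ C m n _ leN1N1).

Lemma Veval_Tmat : map_mx Veval (Tmat C m n) = Vx.
Proof. exact: opeval_Tmat. Qed.

Lemma dwop_state w : dwop (@dact C m n) (vac C m n) w
  = (\prod_(x <- w) (x.2)`!%:R : C) *: state C w.
Proof.
elim: w => [|x w IHw]; first by rewrite big_nil scale1r.
rewrite big_cons; apply: etrans (congr1 (dact C x) IHw) _.
apply: etrans (dact_lin x _ _) _; rewrite mulrC -scalerA; congr (_ *: _).
rewrite /dact endoM -(rmorph_nat (scalar_op V)).
exact: erefl.
Qed.

Lemma sugawara_normal_coef (x : free_alg C (opletter m n)) p r :
  str_span par Vx V0 (Veval x V0) -> sugawara_operator (normal_coef x p r).
Proof.
move=> Sx; exists (Veval x V0 p), (normal_coef x p), r; split=> //.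
  by move=> i j s; apply: V_killed.
pose F (w : seq (dletter m n)) : C := \prod_(y <- w) (y.2)`!%:R.
(* The terms of [opevalE] with their products of factorials, which the definition of [state_field]
   divides out again. *)
exists (flatten [seq [seq (x@_w * F t.1, t.1) | t <- move_right w & t.2 == p] | w <- msupp x]).
split.
  rewrite [LHS]opevalE; last first.
  - exact: mode_op_vac.
  - exact: D_dact.
  rewrite big_flatten big_map; apply: eq_bigr => w _.
  rewrite big_map big_filter scaler_sumr; apply: eq_bigr => t _ /=.
  by rewrite dwop_state scalerA.
apply/funext => s; apply/funext => v.
rewrite big_flatten big_map; apply: eq_bigr => w _.
rewrite big_map big_filter scaler_sumr; apply: eq_bigr => t _ /=.
rewrite mulfK // /F; elim: (t.1) => [|y u IHu]; first by rewrite big_nil oner_neq0.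
rewrite big_cons mulf_neq0 //.
by have := fact_gt0 y.2; case: (y.2)`!.
Qed.

Lemma sugawara_all k p r : [/\ sugawara_operator (normal_coef (str (Tmat C m n ^+ k)) p r),
  sugawara_operator (normal_coef (ber (Tmat C m n) k) p r),
  sugawara_operator (normal_coef (sigma_expr C m n k) p r) &
  sugawara_operator (normal_coef (h_expr C m n k) p r)].
Proof.
have tf := endo_torsion_free (M := M) char0.
have xM : smanin par (map_mx Veval (Tmat C m n)) by rewrite Veval_Tmat; exact: Vx_manin.
have Sb := str_span_base par Vx V0.
split; apply: sugawara_normal_coef.
- by rewrite phi_str Veval_Tmat; apply: str_span_strx.
- apply: (str_span_newton_left char0 (x := Vx) (c := fun k => Veval (ber (Tmat C m n) k))) => //.
    exact: ber0_phi.
  by move=> k'; rewrite -Veval_Tmat; apply: ber_newton_phi.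
- apply: (str_span_newton_left char0 (x := Vx) (c := fun k => Veval (sigma_expr C m n k))) => //.
    exact: sigma0_phi.
  by move=> k'; rewrite -Veval_Tmat; apply: sigma_newton_phi.
apply: (str_span_newton_right char0 (x := Vx) (c := fun k => Veval (h_expr C m n k))) => //.
  exact: h0_phi.
by move=> k'; rewrite -Veval_Tmat; apply: h_newton_phi.
Qed.

End Annihilators.

From mathcomp Require Import classical_sets fsbigop cardinality.

(** * Normally ordered products *)

Section IntSums.
Variable V : zmodType.
Implicit Types f : int -> V.

Lemma fsbig_nonneg f B : (forall t : nat, (B <= t)%N -> f t%:Z = 0) ->
  \sum_(j \in [set j : int | (0 <= j)%R]%classic) f j = \sum_(t < B) f t%:Z.
Proof.
move=> fB; rewrite -(big_mkord xpredT (fun t : nat => f t%:Z)) -[RHS](big_map (fun t : nat => t%:Z) xpredT f).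
rewrite -(@fsbig_widen _ _ _ _ [set` [seq t%:Z | t <- index_iota 0 B]]) //=.
- by apply/esym/fsbig_seq; rewrite map_inj_uniq ?iota_uniq // => x y [].
- by move=> _ /= /mapP[t _ ->].
move=> [t|t] /= []// _ tB; apply: fB; rewrite leqNgt; apply: contra_notN tB.
by move=> tB; apply/mapP; exists t; rewrite // mem_index_iota.
Qed.

Lemma fsbig_neg f B : (forall t : nat, (B <= t)%N -> f (- t.+1%:Z) = 0) ->
  \sum_(j \in [set j : int | (j < 0)%R]%classic) f j = \sum_(t < B) f (- t.+1%:Z).
Proof.
move=> fB; rewrite -(big_mkord xpredT (fun t : nat => f (- t.+1%:Z))) -[RHS](big_map (fun t : nat => - t.+1%:Z) xpredT f).
rewrite -(@fsbig_widen _ _ _ _ [set` [seq - t.+1%:Z | t <- index_iota 0 B]]) //=.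
- by apply/esym/fsbig_seq; rewrite map_inj_uniq ?iota_uniq // => x y; lia.
- by move=> _ /= /mapP[t _ ->]; lia.
move=> [t|t] /= []// _; rewrite NegzE => tB; apply: fB; rewrite leqNgt; apply: contra_notN tB.
by move=> tB; apply/mapP; exists t; rewrite // mem_index_iota.
Qed.

(** For T < B all T + 1 pairs with t + u = T lie in the square; the remaining pairs of the square
    contribute zero. *)
Lemma sum_antidiag (g : nat -> V) B : (forall T, (B <= T)%N -> g T = 0) ->
  \sum_(t < B) \sum_(u < B) g (t + u)%N = \sum_(T < B) g T *+ T.+1.
Proof.
move=> gB; pose h (n : nat) := \sum_(t < n) \sum_(u < B) g (t + u)%N.
suff H n : (n <= B)%N -> \sum_(t < n) \sum_(u < B) g (t + u)%N
    = \sum_(T < B) g T *+ minn T.+1 n.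
  by rewrite H //; apply: eq_bigr => T _; rewrite (minn_idPl _).
elim: n => [_|n IHn nB]; first by rewrite big_ord0 big1 // => T _; rewrite minn0.
rewrite big_ord_recr IHn 1?ltnW //=.
have -> : \sum_(u < B) g (n + u)%N = \sum_(T < B) (if (n <= T)%N then g T else 0).
  rewrite -(big_mkord xpredT (fun u => g (n + u)%N)) -(big_mkord xpredT (fun T => if (n <= T)%N then g T else 0)).
  rewrite [RHS](@big_cat_nat _ _ _ n) //=; last exact: ltnW.
  rewrite [X in _ = X + _]big_nat [X in _ = X + _]big1 ?add0r => [|T /andP[_ Tn]]; last by rewrite leqNgt Tn.
  rewrite [RHS](big_addn 0 _ n) [LHS](@big_cat_nat _ _ _ (B - n)) //=; last by rewrite leq_subr.
  rewrite [X in _ + X = _]big_nat [X in _ + X = _]big1 ?addr0 => [|u /andP[Bu _]]; last by rewrite gB //; lia.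
  by apply: eq_bigr => u _; rewrite leq_addl addnC.
rewrite -big_split; apply: eq_bigr => T _ /=.
case: (leqP n T) => nT; last by rewrite addr0; congr (_ *+ _); lia.
by rewrite -mulrSr; congr (_ *+ _); lia.
Qed.

End IntSums.

Fact comm_kill (V : zmodType) (a b c1 c2 z d1 d2 : endo V) s s' v :
  scom s s' a b = d1 * c1 - sg (s && s') * (d2 * c2) + z -> z = 0 ->
  a v = 0 -> c1 v = 0 -> c2 v = 0 -> a (b v) = 0.
Proof.
move=> /(congr1 (fun z : endo V => z v)) E z0 av c1v c2v; move: E.
by rewrite /scom z0 addr0 !(endoD, endoN, endoM) av c1v c2v !endo0r !subr0.
Qed.

Section Fields.
Variables (C : fieldType) (m n : nat).
Local Notation V := (vacmod C m n).
Local Notation field := (field C m n).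
Implicit Types (a b : field) (v : V).

(** The second clause is the truncation condition of a field: on each vector all modes from some
    index on vanish. *)
Definition good_field a := (forall r c u v, a r (c *: u + v) = c *: a r u + a r v) /\
  (forall v, exists N : nat, forall r : int, (N%:Z <= r)%R -> a r v = 0).

Lemma good0 a r : good_field a -> a r 0 = 0.
Proof. by case=> aP _; have := aP r (-1) 0 0; rewrite scaler0 addr0 scaleN1r addNr. Qed.

(** Truncation replaces both infinite mode sums by sums up to one bound; any larger bound serves as
    well, so several products can be compared term by term. *)
Lemma nprod_fin s a b r v B : good_field a -> good_field b ->
  (forall t : nat, (B <= t)%N -> a t%:Z v = 0) ->
  (forall t : nat, (B <= t)%N -> b (r + t%:Z) v = 0) ->
  nprod s a b r v = \sum_(t < B) a (- t.+1%:Z) (b (r + t%:Z) v)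
    + (-1) ^+ s *: \sum_(t < B) b (r - t.+1%:Z) (a t%:Z v).
Proof.
move=> ga gb aB bB; have E (t : nat) : r - 1 - - t.+1%:Z = r + t%:Z by lia.
have E' (t : nat) : r - 1 - t%:Z = r - t.+1%:Z by lia.
rewrite /nprod (@fsbig_neg _ _ B) => [|t tB]; last by rewrite E bB // good0.
rewrite (@fsbig_nonneg _ _ B) => [|t tB]; last by rewrite aB // good0.
by congr (_ + _ *: _); apply: eq_bigr => t _; rewrite ?E ?E'.
Qed.

Definition bounded_at a (r : int) v (B : nat) :=
  forall t : nat, (B <= t)%N -> a (r + t%:Z) v = 0.

Lemma bounded_exists a r v : good_field a -> exists B, forall B', (B <= B')%N -> bounded_at a r v B'.
Proof.
case=> _ /(_ v)[N aN]; exists (N + absz r)%N => B' BB t tB; apply: aN; lia.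
Qed.

Lemma good_nprod s a b : good_field a -> good_field b -> good_field (nprod s a b).
Proof.
move=> ga gb; split=> [r c u v|v].
  have [B1 H1] := bounded_exists 0 u ga; have [B2 H2] := bounded_exists 0 v ga.
  have [B3 H3] := bounded_exists r u gb; have [B4 H4] := bounded_exists r v gb.
  pose B := (B1 + B2 + B3 + B4)%N.
  have a1 t : (B <= t)%N -> a t%:Z u = 0 by move=> tB; rewrite -[t%:Z]add0r (H1 B) //; lia.
  have a2 t : (B <= t)%N -> a t%:Z v = 0 by move=> tB; rewrite -[t%:Z]add0r (H2 B) //; lia.
  have b1 t : (B <= t)%N -> b (r + t%:Z) u = 0 by move=> tB; rewrite (H3 B) //; lia.
  have b2 t : (B <= t)%N -> b (r + t%:Z) v = 0 by move=> tB; rewrite (H4 B) //; lia.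
  have [aP _] := ga; have [bP _] := gb.
  rewrite (nprod_fin s ga gb a1 b1) (nprod_fin s ga gb a2 b2) (@nprod_fin _ _ _ _ _ B) //.
  - rewrite scalerDr addrACA; congr (_ + _).
      by rewrite scaler_sumr -big_split; apply: eq_bigr => t _; rewrite bP aP.
    rewrite scalerA [c * _]mulrC -scalerA -scalerDr; congr (_ *: _).
    by rewrite scaler_sumr -big_split; apply: eq_bigr => t _; rewrite aP bP.
  - by move=> t tB; rewrite aP a1 ?a2 // scaler0 addr0.
  by move=> t tB; rewrite bP b1 ?b2 // scaler0 addr0.
have [B1 H1] := bounded_exists 0 v ga; have [_ /(_ v)[N bN]] := gb.
(* The vectors a_t v are nonzero for finitely many t only, so a single bound for b on all of them
   exists. *)
have [B2 H2] : exists B2 : nat, forall t : nat, (t < B1)%N -> forall r : int,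
    (B2%:Z <= r)%R -> b r (a t%:Z v) = 0.
  elim: (B1) => [|k [B2 IHk]]; first by exists 0%N.
  have [_ /(_ (a k%:Z v))[N' bN']] := gb; exists (B2 + N')%N => t; rewrite ltnS leq_eqVlt.
  by case/orP=> [/eqP->|tk] r rB; [apply: bN' | apply: (IHk t)] => //; lia.
have a0 t : (B1 <= t)%N -> a t%:Z v = 0 by move=> tB; rewrite -[t%:Z]add0r (H1 B1) //; lia.
exists (N + B1 + B2 + 1)%N => r rB; rewrite (nprod_fin s ga gb a0); last first.
  by move=> t _; apply: bN; lia.
rewrite !big1 ?scaler0 ?addr0 // => t _; first by rewrite (H2 t) //; have := ltn_ord t; lia.
by rewrite bN ?good0 //; lia.
Qed.

Lemma good_deriv a : good_field a -> good_field (field_deriv a).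
Proof.
case=> aP aN; split=> [r c u v|v].
  by rewrite /field_deriv aP scalerDr !scalerA [_ * c]mulrC.
have [N aN'] := aN v; exists N.+1 => r rN; rewrite /field_deriv aN' ?scaler0 //; lia.
Qed.

Lemma good_current (i j : 'I_(m + n)) : good_field (current i j : field).
Proof.
split=> [r c u v|]; first by rewrite /current -!act_opE endoDr act_opZr.
(* The bound has to be uniform in i and j for the induction: commuting past e_kl[s] changes the
   indices of the current. *)
suff H v : exists N : nat, forall i j (r : int), (N%:Z <= r)%R -> act_op (e_ C i j r) v = 0.
  by move=> v; have [N vN] := H v; exists N => r; apply: vN.
elim/vac_ind: v => {i j} [c u v [N1 H1] [N2 H2]||k l s v [N H]].
- exists (N1 + N2)%N => i j r rN; rewrite endoDr act_opZr H1 ?H2 ?scaler0 ?addr0 //; lia.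
- by exists 0%N => i j [r|//] _; exact: act_vac_pos.
exists (N + absz s + 1)%N => i j r rN.
have H1 i' j' : act_op (e_ C i' j' r) v = 0 by apply: H; clear -rN; lia.
have H2 i' j' : act_op (e_ C i' j' (r + s)) v = 0 by apply: H; clear -rN; lia.
have rs : (r == - s) = false by clear -rN; lia.
apply: (comm_kill (act_comm C i j r k l s) _ (H1 i j) (H2 i l) (H2 k j)).
by rewrite rs mulr0 raddf0.
Qed.

Lemma good_id : good_field (@field_id C m n).
Proof.
split=> [r c u v|v]; rewrite /field_id; first by case: eqP => _ //; rewrite scaler0 addr0.
by exists 0%N => -[r|r].
Qed.

End Fields.

Fact zmod_shuffle (Z : zmodType) (a1 a2 a3 a4 b1 b4 : Z) :
  a1 + a2 + (a3 + a4) - (b1 + a3 + (a2 + b4)) = a1 - b1 + (a4 - b4).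
Proof.
have -> : a1 + a2 + (a3 + a4) = (a1 + a4) + (a2 + a3) by rewrite (addrC a3) addrACA.
have -> : b1 + a3 + (a2 + b4) = (b1 + b4) + (a2 + a3).
  by rewrite (addrC a2 b4) addrACA (addrC a3).
by rewrite [- (_ + (a2 + a3))]opprD (addrACA (a1 + a4)) subrr addr0 opprD addrACA.
Qed.

Section IntScaling.
Variables (C : fieldType) (L : lmodType C).

Fact scaleDz (k1 k2 k : int) (u : L) : k1 + k2 = k ->
  (k1%:~R : C) *: u + (k2%:~R : C) *: u = (k%:~R : C) *: u.
Proof. by move=> <-; rewrite rmorphD scalerDl. Qed.

Fact scale_posz (t : nat) (u : L) : ((t%:Z)%:~R : C) *: u = u *+ t.
Proof. by rewrite -pmulrn scaler_nat. Qed.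

Fact scale_oppz (t : nat) (u : L) : ((- t%:Z)%:~R : C) *: u = - (u *+ t).
Proof. by rewrite mulrNz scaleNr scale_posz. Qed.

Fact sum_lin_split (I : finType) c (x y : I -> L) :
  \sum_i (x i + c *: y i) = \sum_i x i + c *: \sum_i y i.
Proof. by rewrite big_split scaler_sumr. Qed.

Fact sign_shuffle (P s0 s1 s2 s3 s5 : C) (x1 x2 x3 x4 y1 y4 : L) :
  P * s2 = s1 -> P * s3 = s0 -> s0 * s1 = s5 * P -> s1 * s3 = s5 ->
  x1 + s1 *: x2 + s0 *: (x3 + s1 *: x4) - P *: (y1 + s3 *: x3 + s2 *: (x2 + s3 *: y4))
  = x1 - P *: y1 + s5 *: - (y4 - P *: x4).
Proof.
move=> E2 E3 E0 E5; rewrite !scalerDr !scalerN !scalerDr !scalerN !scalerA E2 E3 E0 E5 opprB.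
exact: zmod_shuffle.
Qed.

End IntScaling.

Section NormalProducts.
Variables (C : fieldType) (m n : nat).
Local Notation V := (vacmod C m n).
Local Notation field := (field C m n).
Implicit Types (a b c f : field) (v : V).

Lemma goodZ a r k u : good_field a -> a r (k *: u) = k *: a r u.
Proof. by move=> ga; have [aP _] := ga; rewrite -[k *: u]addr0 aP (good0 r ga) addr0. Qed.

Lemma goodB a r u w : good_field a -> a r (u - w) = a r u - a r w.
Proof. by case=> aP _; rewrite addrC -scaleN1r aP scaleN1r addrC. Qed.

Lemma good_sum a r (I : Type) (l : seq I) (g : I -> V) : good_field a ->
  a r (\sum_(i <- l) g i) = \sum_(i <- l) a r (g i).
Proof.
move=> ga; elim/big_rec2: _ => [|i x y _ <-]; first exact: good0.
by have [aP _] := ga; rewrite -[g i]scale1r aP !scale1r.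
Qed.

Lemma nprod_deriv s a b : good_field a -> good_field b ->
  field_deriv (nprod s a b)
  = fun r v => nprod s (field_deriv a) b r v + nprod s a (field_deriv b) r v.
Proof.
move=> ga gb; apply/funext => r; apply/funext => v.
have [B1 H1] := bounded_exists 0 v ga; have [B2 H2] := bounded_exists (r - 1) v gb.
pose B := (B1 + B2)%N.
have aB t : (B <= t)%N -> a t%:Z v = 0 by move=> tB; rewrite -[t%:Z]add0r (H1 B) //; lia.
have bB t : (B <= t)%N -> b (r - 1 + t%:Z) v = 0 by move=> tB; rewrite (H2 B) //; lia.
rewrite {1}/field_deriv (nprod_fin s ga gb aB bB).
rewrite (@nprod_fin _ _ _ _ (field_deriv a) _ _ _ B.+1) //; last 3 first.
- exact: good_deriv.
- move=> [//|t] tB; rewrite /field_deriv (_ : t.+1%:Z - 1 = t) ?aB ?scaler0 //; lia.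
- by move=> t tB; rewrite (_ : r + t%:Z = r - 1 + t.+1%:Z) ?bB //; lia.
rewrite (@nprod_fin _ _ _ _ _ (field_deriv b) _ _ B) //; last 2 first.
- exact: good_deriv.
- by move=> t tB; rewrite /field_deriv (_ : r + t%:Z - 1 = r - 1 + t%:Z) ?bB ?scaler0 //; lia.
rewrite [RHS]addrACA -[X in _ = _ + X]scalerDr [LHS]scalerDr [X in _ + X = _]scalerA.
rewrite [(- r)%:~R * (-1) ^+ s]mulrC -[X in _ + X = _]scalerA; congr (_ + _ *: _).
  (* The derivative of a contributes [al t.+1]. Shifting the index turns this into [al t], whose
     weight t corrects the weight -(r + t) from the derivative of b to -r. *)
  pose al t : V := (t%:Z)%:~R *: a (- t.+1%:Z) (b (r - 1 + t%:Z) v).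
  rewrite [X in _ = X + _](_ : _ = \sum_(t < B) al t).
    rewrite scaler_sumr -big_split; apply: eq_bigr => t _ /=.
    have e : r + t%:Z - 1 = r - 1 + t%:Z by clear; lia.
    rewrite /field_deriv (goodZ _ _ _ ga) e; apply: esym; apply: scaleDz.
    by clear; lia.
  transitivity (\sum_(t < B.+1) al t.+1).
    apply: eq_bigr => t _; have e1 : - t.+1%:Z - 1 = - t.+2%:Z by clear; lia.
    have e2 : r + t%:Z = r - 1 + t.+1%:Z by clear; lia.
    by rewrite /field_deriv e1 e2 opprK.
  have al0 : al 0%N = 0 by exact: scale0r.
  have alB t : (B <= t)%N -> al t = 0.
    move=> tB; rewrite /al (bB t tB); have -> := good0 (- t.+1%:Z) ga; exact: scaler0.
  transitivity (\sum_(t < B.+2) al t); first by rewrite [RHS]big_ord_recl al0 add0r.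
  by rewrite !big_ord_recr /= !alB ?addr0.
rewrite big_ord_recl; have -> : field_deriv a (ord0 : 'I_B.+1)%:Z v = 0 by exact: scale0r.
rewrite (good0 _ gb) add0r scaler_sumr -big_split.
apply: eq_bigr => t _; rewrite lift0.
have e1 : t.+1%:Z - 1 = t by clear; lia.
have e2 : r - t.+2%:Z = r - 1 - t.+1%:Z by clear; lia.
have e3 : r - t.+1%:Z - 1 = r - 1 - t.+1%:Z by clear; lia.
rewrite /field_deriv (goodZ _ _ _ gb) e1 e2 e3; apply: esym; apply: scaleDz.
by clear; lia.
Qed.

Lemma uniform_bound f a v : good_field f -> good_field a ->
  exists N : nat, forall (t : nat) (s : int), (N%:Z <= s)%R -> f s (a t%:Z v) = 0.
Proof.
move=> gf ga; have [B1 H1] := bounded_exists 0 v ga.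
have [N HN] : exists N : nat, forall t : nat, (t < B1)%N -> forall s : int,
    (N%:Z <= s)%R -> f s (a t%:Z v) = 0.
  elim: (B1) => [|k [N IHk]]; first by exists 0%N.
  have [_ /(_ (a k%:Z v))[N' fN']] := gf; exists (N + N')%N => t; rewrite ltnS leq_eqVlt.
  by case/orP=> [/eqP->|tk] s sB; [apply: fN' | apply: (IHk t)] => //; lia.
exists N => t s sN; have [tB|tB] := ltnP t B1; first exact: HN.
by rewrite -[t%:Z]add0r (H1 B1) // good0.
Qed.

(** One bound for all the double sums of a nested product, including those in which f or b acts on
    the vectors a_t v. *)
Definition nice_bound f a b (r : int) v B := [/\ forall t : nat, (B <= t)%N -> a t%:Z v = 0,
  forall t : nat, (B <= t)%N -> f (r + t%:Z) v = 0,
  forall t u : nat, (B <= u)%N -> f (r - t.+1%:Z + u%:Z) (a t%:Z v) = 0 &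
  forall t u : nat, (B <= u)%N -> b u%:Z (a t%:Z v) = 0].

Lemma nice_bound_exists f a b r v : good_field f -> good_field a -> good_field b ->
  exists N, forall B, (N <= B)%N -> nice_bound f a b r v B.
Proof.
move=> gf ga gb; have [B1 H1] := bounded_exists 0 v ga; have [B2 H2] := bounded_exists r v gf.
have [N1 HN1] := uniform_bound v gf ga; have [N2 HN2] := uniform_bound v gb ga.
exists (B1 + B2 + N1 + N2 + absz r + 1)%N => B NB.
have aB t : (B1 <= t)%N -> a t%:Z v = 0 by move=> tB; rewrite -[t%:Z]add0r (H1 B1).
split=> [t tB|t tB|t u uB|t u uB].
- by apply: aB; lia.
- by apply: (H2 B2) => //; lia.
- have [tB|tB] := ltnP t B1; last by rewrite aB // good0.
  by apply: HN1; lia.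
by apply: HN2; lia.
Qed.

Lemma nprod2_fin s s' f a b r v B : good_field f -> good_field a -> good_field b ->
  nice_bound f a b r v B -> nice_bound f b a r v B ->
  nprod s a (nprod s' b f) r v
  = \sum_(t < B) \sum_(u < B) a (- t.+1%:Z) (b (- u.+1%:Z) (f (r + (t + u)%:Z) v))
  + (-1) ^+ s' *: (\sum_(t < B) \sum_(u < B) a (- t.+1%:Z) (f (r + t%:Z - u.+1%:Z) (b u%:Z v)))
  + (-1) ^+ s *: ((\sum_(t < B) \sum_(u < B) b (- u.+1%:Z) (f (r - t.+1%:Z + u%:Z) (a t%:Z v)))
  + (-1) ^+ s' *: (\sum_(t < B) \sum_(u < B) f (r - (t + u).+2%:Z) (b u%:Z (a t%:Z v)))).
Proof.
move=> gf ga gb [aB fB faB baB] [bB _ fbB abB].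
have inner t : nprod s' b f (r + t%:Z) v
    = \sum_(u < B) b (- u.+1%:Z) (f (r + (t + u)%:Z) v)
      + (-1) ^+ s' *: \sum_(u < B) f (r + t%:Z - u.+1%:Z) (b u%:Z v).
  rewrite (nprod_fin s' gb gf bB) => [|u uB]; last first.
    have tu : (B <= t + u)%N by apply: leq_trans uB (leq_addl _ _).
    by rewrite -addrA -PoszD (fB _ tu).
  by congr (_ + _); apply: eq_bigr => u _; rewrite PoszD addrA.
have HB (t : nat) : (B <= t)%N -> nprod s' b f (r + t%:Z) v = 0.
  move=> tB; rewrite inner.
  have -> : \sum_(u < B) b (- u.+1%:Z) (f (r + (t + u)%:Z) v) = 0.
    apply: big1 => u _; have tu : (B <= t + u)%N by apply: leq_trans tB (leq_addr _ _).
    by rewrite (fB _ tu); exact: good0.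
  rewrite add0r big1; first exact: scaler0.
  move=> u _; have -> : r + t%:Z - u.+1%:Z = r - u.+1%:Z + t%:Z by clear; lia.
  exact: fbB.
apply: etrans (nprod_fin s ga (good_nprod s' gb gf) aB HB) _.
have aS t : a (- t.+1%:Z) (nprod s' b f (r + t%:Z) v)
   = \sum_(u < B) a (- t.+1%:Z) (b (- u.+1%:Z) (f (r + (t + u)%:Z) v))
   + (-1) ^+ s' *: \sum_(u < B) a (- t.+1%:Z) (f (r + t%:Z - u.+1%:Z) (b u%:Z v)).
  have [aP _] := ga; rewrite inner addrC aP addrC; congr (_ + _ *: _); exact: good_sum.
apply: etrans (congr1 (fun z => z + _) (etrans (eq_bigr _ (fun (t : 'I_B) _ => aS t))
  (sum_lin_split _ _ _))) _.
apply: (congr1 (fun z : V => _ + (-1) ^+ s *: z)).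
rewrite -sum_lin_split; apply: eq_bigr => t _.
apply: etrans (nprod_fin s' gb gf (baB t) (faB t)) _.
congr (_ + _ *: _); apply: eq_bigr => u _.
have -> // : r - t.+1%:Z - u.+1%:Z = r - (t + u).+2%:Z by clear; lia.
Qed.

(** Quasi-commutativity. Each nested product splits into four double sums; the mixed ones cancel in
    pairs. In the others, the pairs of modes with t + u = T give T + 1 equal terms, and T + 1 is the
    coefficient in the derivative of c. Commutators are assumed only for modes both negative or both
    nonnegative, where the cocycle vanishes. *)
Lemma nprod_comm (p q e : bool) a b c f :
  good_field a -> good_field b -> good_field c -> good_field f ->
  (forall (t u : nat) v, a (- t.+1%:Z) (b (- u.+1%:Z) v)
     - (-1) ^+ (p && q) *: b (- u.+1%:Z) (a (- t.+1%:Z) v) = c (- (t + u).+2%:Z) v) ->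
  (forall (t u : nat) v, a t%:Z (b u%:Z v)
     - (-1) ^+ (p && q) *: b u%:Z (a t%:Z v) = c (t + u)%:Z v) ->
  forall r v, nprod (p && (q (+) e)) a (nprod (q && e) b f) r v
    - (-1) ^+ (p && q) *: nprod (q && (p (+) e)) b (nprod (p && e) a f) r v
  = nprod ((p (+) q) && e) (field_deriv c) f r v.
Proof.
move=> ga gb gc gf abN abP r v.
have [N1 H1] := nice_bound_exists r v gf ga gb; have [N2 H2] := nice_bound_exists r v gf gb ga.
have [N3 H3] := nice_bound_exists r v gf gc gc; pose B := (N1 + N2 + N3)%N.
have nab : nice_bound f a b r v B by apply: H1; lia.
have nba : nice_bound f b a r v B by apply: H2; lia.
have [cB fB _ _] : nice_bound f c c r v B by apply: H3; lia.
rewrite (nprod2_fin _ _ gf ga gb nab nba) (nprod2_fin _ _ gf gb ga nba nab).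
set S1 := \sum_(t < B) _; set S2 := \sum_(t < B) _; set S3 := \sum_(t < B) _; set S4 := \sum_(t < B) _.
set S1' := \sum_(t < B) _; set S2' := \sum_(t < B) _; set S3' := \sum_(t < B) _; set S4' := \sum_(t < B) _.
(* The mixed sums of the two products coincide after exchanging the summation variables; their signs
   are matched in [sign_shuffle]. *)
have E2 : S2' = S3.
  rewrite /S2' exchange_big; apply: eq_bigr => t _; apply: eq_bigr => u _.
  by have -> : r + u%:Z - t.+1%:Z = r - t.+1%:Z + u%:Z by clear; lia.
have E3 : S3' = S2.
  rewrite /S3' exchange_big; apply: eq_bigr => t _; apply: eq_bigr => u _.
  by have -> : r - u.+1%:Z + t%:Z = r + t%:Z - u.+1%:Z by clear; lia.
pose g1 T := c (- T.+2%:Z) (f (r + T%:Z) v); pose g2 T := f (r - T.+2%:Z) (c T%:Z v).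
(* Summation along antidiagonals: T + 1 is minus the negative mode index -(T + 1), as produced by
   [field_deriv]. *)
have E1 : S1 - (-1) ^+ (p && q) *: S1' = \sum_(T < B) g1 T *+ T.+1.
  rewrite -sum_antidiag => [|T TB]; last by rewrite /g1 (fB T TB); exact: good0.
  rewrite /S1' exchange_big scaler_sumr -sumrB; apply: eq_bigr => t _.
  rewrite scaler_sumr -sumrB; apply: eq_bigr => u _; by rewrite (addnC u t) abN.
have E4 : S4' - (-1) ^+ (p && q) *: S4 = \sum_(T < B) g2 T *+ T.+1.
  rewrite -sum_antidiag => [|T TB]; last by rewrite /g2 (cB T TB); exact: good0.
  rewrite /S4' exchange_big scaler_sumr -sumrB; apply: eq_bigr => t _.
  rewrite scaler_sumr -sumrB; apply: eq_bigr => u _.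
  by rewrite (addnC u t) /g2 -abP (goodB _ _ _ gf) (goodZ _ _ _ gf).
have cB' (t : nat) : (B.+1 <= t)%N -> field_deriv c t%:Z v = 0.
  case: t => // t tB; rewrite /field_deriv; have -> : t.+1%:Z - 1 = t by clear; lia.
  by rewrite (cB t tB); exact: scaler0.
have fB' (t : nat) : (B.+1 <= t)%N -> f (r + t%:Z) v = 0 by move=> tB; apply: fB; apply: ltnW.
rewrite [RHS](nprod_fin _ (good_deriv gc) gf cB' fB').
have -> : \sum_(t < B.+1) field_deriv c (- t.+1%:Z) (f (r + t%:Z) v)
    = \sum_(T < B) g1 T *+ T.+1.
  rewrite big_ord_recr /= -[RHS]addr0; congr (_ + _); last first.
    by rewrite (fB B (leqnn B)); exact: good0 (good_deriv gc).
  apply: eq_bigr => t _; have ez : - t.+1%:Z - 1 = - t.+2%:Z by clear; lia.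
  by rewrite /field_deriv opprK ez; exact: scale_posz.
have -> : \sum_(t < B.+1) f (r - t.+1%:Z) (field_deriv c t%:Z v) = - \sum_(T < B) g2 T *+ T.+1.
  rewrite big_ord_recl; have -> : field_deriv c (ord0 : 'I_B.+1)%:Z v = 0 by exact: scale0r.
  rewrite good0 // add0r -sumrN; apply: eq_bigr => t _; rewrite lift0.
  have ez : t.+1%:Z - 1 = t by clear; lia.
  by rewrite /field_deriv (goodZ _ _ _ gf) ez; exact: scale_oppz.
rewrite -E1 -E4 {}E2 {}E3 {nab nba E1 E4 g1 g2 cB fB}.
move: S1 S2 S3 S4 S1' S4' => x1 x2 x3 x4 y1 y4.
have Es2 : (-1) ^+ (p && q) * (-1) ^+ (q && (p (+) e)) = (-1) ^+ (q && e) :> C.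
  by rewrite -!sgE -sgD; case: p q e {abN abP} => [] [] [].
have Es3 : (-1) ^+ (p && q) * (-1) ^+ (p && e) = (-1) ^+ (p && (q (+) e)) :> C.
  by rewrite -!sgE -sgD; case: p q e {abN abP Es2} => [] [] [].
have Es0 : (-1) ^+ (p && (q (+) e)) * (-1) ^+ (q && e)
    = (-1) ^+ ((p (+) q) && e) * (-1) ^+ (p && q) :> C.
  by rewrite -!sgE -!sgD; case: p q e {abN abP Es2 Es3} => [] [] [].
have Es5 : (-1) ^+ (q && e) * (-1) ^+ (p && e) = (-1) ^+ ((p (+) q) && e) :> C.
  by rewrite -!sgE -sgD; case: p q e {abN abP Es2 Es3 Es0} => [] [] [].
exact: sign_shuffle Es2 Es3 Es0 Es5.
Qed.

End NormalProducts.

(** * Bilinearity of the normally ordered product and the module of graded fields *)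

Section LinearProducts.
Variables (C : fieldType) (m n : nat).
Local Notation V := (vacmod C m n).
Local Notation field := (field C m n).
Implicit Types (a b : field).

Fact lin_shuffle (L : lmodType C) c k (x1 x2 y1 y2 : L) :
  (c *: x1 + y1) + k *: (c *: x2 + y2) = c *: (x1 + k *: x2) + (y1 + k *: y2).
Proof. by rewrite !scalerDr !scalerA [k * c]mulrC addrACA. Qed.

Fact lin_swap (L : lmodType C) c k (x y z t : L) :
  c *: (k *: x + y) + (k *: z + t) = k *: (c *: x + z) + (c *: y + t).
Proof. by rewrite !scalerDr !scalerA [c * k]mulrC addrACA. Qed.

Fact lin_sums (L : lmodType C) (I : finType) c k (x1 x2 y1 y2 z w : I -> L) :
  (forall i, z i = c *: x1 i + y1 i) -> (forall i, w i = c *: x2 i + y2 i) ->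
  \sum_i z i + k *: (\sum_i w i)
  = c *: (\sum_i x1 i + k *: \sum_i x2 i) + (\sum_i y1 i + k *: \sum_i y2 i).
Proof.
move=> Ez Ew; rewrite (eq_bigr _ (fun i _ => Ez i)) (eq_bigr _ (fun i _ => Ew i)).
by rewrite !big_split -!scaler_sumr; apply: lin_shuffle.
Qed.

Lemma good_lin c a b : good_field a -> good_field b ->
  good_field (fun r v => c *: a r v + b r v).
Proof.
move=> [aP aN] [bP bN]; split=> [r k u v|v].
  by rewrite aP bP; exact: lin_swap.
have [N1 H1] := aN v; have [N2 H2] := bN v; exists (N1 + N2)%N => r rN.
rewrite H1 ?H2 ?scaler0 ?addr0 //; lia.
Qed.

Fact common_bound a b r v : good_field a -> good_field b ->
  exists B, (forall t : nat, (B <= t)%N -> a r (0 : V) = 0 /\ a (r + t%:Z) v = 0)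
    /\ (forall t : nat, (B <= t)%N -> b (r + t%:Z) v = 0).
Proof.
move=> ga gb; have [B1 H1] := bounded_exists r v ga; have [B2 H2] := bounded_exists r v gb.
exists (B1 + B2)%N; split=> t tB.
  by split; [exact: good0 | apply: (H1 B1 (leqnn _)); lia].
by apply: (H2 B2 (leqnn _)); lia.
Qed.

Lemma nprod_linr s a b1 b2 c r v : good_field a -> good_field b1 -> good_field b2 ->
  nprod s a (fun r v => c *: b1 r v + b2 r v) r v = c *: nprod s a b1 r v + nprod s a b2 r v.
Proof.
move=> ga g1 g2; have [B1 [H1 _]] := common_bound 0 v ga ga.
have [B2 [H2 H3]] := common_bound r v g1 g2; pose B := (B1 + B2)%N.
have aB (t : nat) : (B <= t)%N -> a t%:Z v = 0.
  by move=> tB; rewrite -[t%:Z]add0r; apply: (H1 t _).2; lia.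
have b1B (t : nat) : (B <= t)%N -> b1 (r + t%:Z) v = 0 by move=> tB; apply: (H2 t _).2; lia.
have b2B (t : nat) : (B <= t)%N -> b2 (r + t%:Z) v = 0 by move=> tB; apply: H3; lia.
have bB (t : nat) : (B <= t)%N -> c *: b1 (r + t%:Z) v + b2 (r + t%:Z) v = 0.
  by move=> tB; rewrite b1B // b2B // addr0; exact: scaler0.
rewrite (nprod_fin s ga g1 aB b1B) (nprod_fin s ga g2 aB b2B).
apply: etrans (nprod_fin s ga (good_lin c g1 g2) aB bB) _.
apply: lin_sums => t; last by [].
by have [aP _] := ga; apply: aP.
Qed.

Lemma nprod_linl s a1 a2 b c r v : good_field a1 -> good_field a2 -> good_field b ->
  nprod s (fun r v => c *: a1 r v + a2 r v) b r v = c *: nprod s a1 b r v + nprod s a2 b r v.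
Proof.
move=> g1 g2 gb; have [B1 [H1 H3]] := common_bound 0 v g1 g2.
have [B2 [_ H2]] := common_bound r v gb gb; pose B := (B1 + B2)%N.
have bB (t : nat) : (B <= t)%N -> b (r + t%:Z) v = 0 by move=> tB; apply: H2; lia.
have a1B (t : nat) : (B <= t)%N -> a1 t%:Z v = 0.
  by move=> tB; rewrite -[t%:Z]add0r; apply: (H1 t _).2; lia.
have a2B (t : nat) : (B <= t)%N -> a2 t%:Z v = 0.
  by move=> tB; rewrite -[t%:Z]add0r; apply: H3; lia.
have aB (t : nat) : (B <= t)%N -> c *: a1 t%:Z v + a2 t%:Z v = 0.
  by move=> tB; rewrite a1B // a2B // addr0; exact: scaler0.
rewrite (nprod_fin s g1 gb a1B bB) (nprod_fin s g2 gb a2B bB).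
apply: etrans (nprod_fin s (good_lin c g1 g2) gb aB bB) _.
apply: lin_sums => t; first by [].
by have [bP _] := gb; apply: bP.
Qed.

Fact good_zero : good_field (fun (r : int) (v : V) => 0 : V).
Proof. by split=> [r c u v|v]; [rewrite scaler0 addr0 | exists 0%N]. Qed.

Definition good_pred : {pred bool -> int -> V -> V} :=
  fun F => `[< forall e, good_field (F e) >].

Fact good_submod_closed : submod_closed good_pred.
Proof.
split; first by apply/asboolP => e; exact: good_zero.
move=> c F F' /asboolP gF /asboolP gF'; apply/asboolP => e; exact: good_lin.
Qed.
HB.instance Definition _ :=
  GRing.isSubmodClosed.Build C (bool -> int -> V -> V) good_pred good_submod_closed.

(* The component at e consists of fields of parity e. *)
Record gfield := GField { gfield_val : bool -> int -> V -> V; _ : gfield_val \in good_pred }.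
HB.instance Definition _ := [isSub for gfield_val].
HB.instance Definition _ := [Choice of gfield by <:].
HB.instance Definition _ := [SubChoice_isSubLmodule of gfield by <:].

Lemma gfield_good (F : gfield) e : good_field (gfield_val F e).
Proof. by case: F => F /= /asboolP gF. Qed.

Lemma gfieldP (F G : gfield) : (forall e r v, gfield_val F e r v = gfield_val G e r v) -> F = G.
Proof.
move=> FG; apply: val_inj; apply/funext => e; apply/funext => r; apply/funext => v; exact: FG.
Qed.

Lemma gvalD (F G : gfield) e r v :
  gfield_val (F + G) e r v = gfield_val F e r v + gfield_val G e r v.
Proof. by []. Qed.

Lemma gvalN (F : gfield) e r v : gfield_val (- F) e r v = - gfield_val F e r v.
Proof. by []. Qed.

Lemma gvalZ c (F : gfield) e r v : gfield_val (c *: F) e r v = c *: gfield_val F e r v.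
Proof. by []. Qed.

End LinearProducts.

(** * Currents acting by normally ordered multiplication *)

Section GradedAction.
Variables (C : fieldType) (m n : nat).
Local Notation V := (vacmod C m n).
Local Notation field := (field C m n).
Local Notation W := (gfield C m n).
Local Notation par := (@par m n).
Local Notation xpar := (@dletter_par m n).

Definition dcurrent (x : dletter m n) : field :=
  iter x.2 (@field_deriv C m n) (current x.1.1 x.1.2).

Lemma good_dcurrent x : good_field (dcurrent x).
Proof.
rewrite /dcurrent; elim: x.2 => [|s IHs]; first exact: good_current.
by rewrite iterS; apply: good_deriv.
Qed.

(** The sign in [nprod] depends on the parity of the right factor. Component e of the result comes
    from component e + xpar x of F, so the parity is known and the action is linear. *)
Definition gact_val x (F : W) : bool -> int -> V -> V := fun e =>
  nprod (xpar x && (e (+) xpar x)) (dcurrent x) (gfield_val F (e (+) xpar x)).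
Fact gact_good x F : gact_val x F \in @good_pred C m n.
Proof. by apply/asboolP => e; apply: good_nprod; [exact: good_dcurrent | exact: gfield_good]. Qed.
Definition gact_fun x F : W := GField (gact_good x F).

Fact gact_linear x c F G : gact_fun x (c *: F + G) = c *: gact_fun x F + gact_fun x G.
Proof.
apply: gfieldP => e r v.
change (nprod (xpar x && (e (+) xpar x)) (dcurrent x)
    (fun r v => c *: gfield_val F (e (+) xpar x) r v + gfield_val G (e (+) xpar x) r v) r v
  = c *: nprod (xpar x && (e (+) xpar x)) (dcurrent x) (gfield_val F (e (+) xpar x)) r v
    + nprod (xpar x && (e (+) xpar x)) (dcurrent x) (gfield_val G (e (+) xpar x)) r v).
exact: (nprod_linr _ c r v (good_dcurrent x) (gfield_good F _) (gfield_good G _)).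
Qed.

Definition gderiv_val (F : W) : bool -> int -> V -> V := fun e => field_deriv (gfield_val F e).
Fact gderiv_good F : gderiv_val F \in @good_pred C m n.
Proof. by apply/asboolP => e; apply: good_deriv; exact: gfield_good. Qed.
Definition gderiv_fun F : W := GField (gderiv_good F).

Fact scale_lin (L : lmodType C) k c (x y : L) : k *: (c *: x + y) = c *: (k *: x) + k *: y.
Proof. by rewrite scalerDr !scalerA mulrC. Qed.

Fact gderiv_linear c F G : gderiv_fun (c *: F + G) = c *: gderiv_fun F + gderiv_fun G.
Proof.
apply: gfieldP => e r v; change ((- r)%:~R *: (c *: gfield_val F e (r - 1) v + gfield_val G e (r - 1) v)
  = c *: ((- r)%:~R *: gfield_val F e (r - 1) v) + (- r)%:~R *: gfield_val G e (r - 1) v).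
exact: scale_lin.
Qed.

Fact linear_zmod (L : lmodType C) (f : L -> L) :
  (forall c x y, f (c *: x + y) = c *: f x + f y) -> zmod_morphism f.
Proof. by move=> fP x y; rewrite addrC -scaleN1r fP scaleN1r addrC. Qed.

Fact linear_scale (L : lmodType C) (f : L -> L) :
  (forall c x y, f (c *: x + y) = c *: f x + f y) -> forall c x, f (c *: x) = c *: f x.
Proof.
move=> fP c x; have f0 : f 0 = 0 by have := linear_zmod fP 0 0; rewrite !subrr.
by rewrite -[c *: x]addr0 fP f0 addr0.
Qed.

Definition gact x : endo W := Endo (linear_zmod (gact_linear x)).
Definition gderiv : endo W := Endo (linear_zmod gderiv_linear).

Lemma gact_lin x c F : gact x (c *: F) = c *: gact x F.
Proof. exact: (linear_scale (gact_linear x)). Qed.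
Lemma gderiv_lin c F : gderiv (c *: F) = c *: gderiv F.
Proof. exact: (linear_scale gderiv_linear). Qed.

Lemma gderiv_gact ij s F :
  gderiv (gact (ij, s) F) = gact (ij, s) (gderiv F) + gact (ij, s.+1) F.
Proof.
rewrite addrC; apply: gfieldP => e r v.
exact: (congr1 (fun f : field => f r v) (nprod_deriv _ (good_dcurrent (ij, s)) (gfield_good F _))).
Qed.

Definition gid_val : bool -> int -> V -> V := fun e r v => if e then 0 else field_id r v.
Fact gid_good : gid_val \in @good_pred C m n.
Proof. by apply/asboolP => -[]; [exact: good_zero | exact: good_id]. Qed.
Definition gid : W := GField gid_good.

Lemma gderiv_gid : gderiv gid = 0.
Proof.
apply: gfieldP => e r v; change ((- r)%:~R *: gid_val e (r - 1) v = 0).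
case: e; first exact: scaler0.
rewrite /gid_val /field_id; case: eqP => [E|_]; last exact: scaler0.
have -> : r = 0 by clear -E; lia.
exact: scale0r.
Qed.

Lemma nprod0r s a r v : good_field a -> nprod s a (fun _ _ => 0 : V) r v = 0.
Proof.
move=> ga; have [B aB] := bounded_exists 0 v ga.
have aB' (t : nat) : (B <= t)%N -> a t%:Z v = 0.
  by move=> tB; rewrite -[t%:Z]add0r; apply: (aB B (leqnn _)).
rewrite (nprod_fin s ga (good_zero C m n) aB' (fun _ _ => erefl)) big1 => [|t _]; last exact: good0.
by rewrite add0r big1 // scaler0.
Qed.

Lemma dwop_gact w e : gfield_val (dwop gact gid w) e
  = if e == dword_par w then normal_order w else fun _ _ => 0.
Proof.
elim: w e => [|x w IHw] e.
  by rewrite /dword_par big_nil; case: e.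
change (nprod (xpar x && (e (+) xpar x)) (dcurrent x)
  (gfield_val (dwop gact gid w) (e (+) xpar x))
  = if e == dword_par (x :: w) then normal_order (x :: w) else fun _ _ => 0).
rewrite IHw /dword_par big_cons -/(dword_par w).
have -> : (e == xpar x (+) dword_par w) = (e (+) xpar x == dword_par w).
  by case: e (xpar x) (dword_par w) => [] [] [].
case: eqP => [->//|_]; apply/funext => r; apply/funext => v.
by apply: nprod0r; exact: good_dcurrent.
Qed.

Fact gval_sum (I : Type) (l : seq I) (P : pred I) (F : I -> W) e r v :
  gfield_val (\sum_(i <- l | P i) F i) e r v = \sum_(i <- l | P i) gfield_val (F i) e r v.
Proof. by elim/big_rec2: _ => // i x y _ <-. Qed.

Definition Weval : {rmorphism free_alg C (opletter m n) -> endo (nat -> W)} :=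
  opeval gact_lin gderiv_lin.

(** A monomial contributes only to the component of its own parity ([dwop_gact]), so adding the two
    components recovers the ungraded field. *)
Lemma normal_coefE x p r v : normal_coef x p r v
  = gfield_val (Weval x (const0 gid) p) false r v
    + gfield_val (Weval x (const0 gid) p) true r v.
Proof.
rewrite [Weval _ _ _](opevalE gact_lin gderiv_lin gderiv_gact gderiv_gid) !gval_sum -big_split.
apply: eq_bigr => w _; rewrite !gvalZ !gval_sum -[RHS]scalerDr; congr (_ *: _).
rewrite -big_split; apply: eq_bigr => t _; rewrite !dwop_gact.
by case: (dword_par _); rewrite /= ?addr0 ?add0r.
Qed.

Fact gval_sg b (F : W) e r v :
  gfield_val ((sg b : endo W) F) e r v = (-1) ^+ b *: gfield_val F e r v.
Proof.
case: b; rewrite ?sg0 ?sg1 ?expr0 ?expr1.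
  by change (- gfield_val F e r v = (-1 : C) *: gfield_val F e r v); rewrite scaleN1r.
by change (gfield_val F e r v = (1 : C) *: gfield_val F e r v); rewrite scale1r.
Qed.

Fact gval_nat (b : bool) (F : W) e r v :
  gfield_val ((b%:R : endo W) F) e r v = (b%:R : C) *: gfield_val F e r v.
Proof.
case: b.
  by change (gfield_val F e r v = (1 : C) *: gfield_val F e r v); rewrite scale1r.
by change (0 = (0 : C) *: gfield_val F e r v); rewrite scale0r.
Qed.

End GradedAction.

From mathcomp Require Import reals.
From mathcomp.real_closed Require Import complex.

Fact comm_val (C : fieldType) (L : lmodType C) (a b c1 c2 z : endo L) (s s' d1 d2 : bool) v :
  scom s s' a b = d1%:R * c1 - sg (s && s') * (d2%:R * c2) + z -> z = 0 ->
  a (b v) - (-1) ^+ (s && s') *: b (a v)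
  = d1%:R *: c1 v + ((- ((-1) ^+ (s && s') * d2%:R) - 1) *: c2 v + c2 v).
Proof.
move=> /(congr1 (fun z : endo L => z v)) E z0; move: E; rewrite z0 addr0 /scom.
rewrite scalerBl scale1r subrK.
by case: d1 d2 (s && s') => [] [] []; rewrite ?sg0 ?sg1 !(endoD, endoN, endoM) ?expr0 ?expr1;
  rewrite ?mul1r ?mulr1 ?mulr0 ?mulN1r ?oppr0 ?scale1r ?scale0r ?scaleN1r ?opprK ?endo1 => ->;
  rewrite ?endo0r ?oppr0 ?opprK ?scaleN1r ?scale1r ?scale0r.
Qed.

Fact coef_shuffle (C : fieldType) (L : lmodType C) (k1 s k2 : C) (x y : L) :
  k1 *: x + ((- (s * k2) - 1) *: y + y) = k1 *: x - s *: (k2 *: y).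
Proof. by rewrite scalerBl scale1r subrK scaleNr scalerA. Qed.

Fact deriv_shuffle (C : fieldType) (L : lmodType C) (r k1 k2 : C) (x y : L) :
  r *: (k1 *: x + (k2 *: y + y)) = k1 *: (r *: x) + (k2 *: (r *: y) + r *: y).
Proof. by rewrite !scalerDr !scalerA ![r * _]mulrC. Qed.

Fact scom_app (N : zmodType) s s' (a b : endo N) u :
  scom s s' a b u = a (b u) - (sg (s && s') : endo N) (b (a u)).
Proof. by []. Qed.

Fact diff_app (N : zmodType) (d1 d2 c1 c2 s : endo N) u :
  (d1 * c1 - s * (d2 * c2)) u = d1 (c1 u) - s (d2 (c2 u)).
Proof. by []. Qed.

(** * Quasi-commutativity of the currents and equality of the coefficients *)

Section CurrentCommutators.
Variables (C : fieldType) (m n : nat).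
Local Notation V := (vacmod C m n).
Local Notation field := (field C m n).
Local Notation W := (gfield C m n).
Local Notation par := (@par m n).

Lemma gact_comm i j k l :
  scom (par i (+) par j) (par k (+) par l) (@gact C m n ((i, j), 0%N)) (gact C ((k, l), 0%N))
  = (k == j)%:R * gact C ((i, l), 1%N)
    - sg ((par i (+) par j) && (par k (+) par l)) * ((i == l)%:R * gact C ((k, j), 1%N)).
Proof.
apply: endoP => F; apply: gfieldP => e r v.
set p := par i (+) par j; set q := par k (+) par l; pose e0 := e (+) p (+) q.
(* The field c is the combination of e_il(z) and e_kj(z) governing the commutator. [nprod_linl]
   treats sums of the form k * f + g, so a multiple of e_kj(z) is written as k2 times it plus
   itself; hence the - 1 in k2. *)
pose k1 : C := (k == j)%:R; pose k2 : C := - ((-1) ^+ (p && q) * (i == l)%:R) - 1.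
pose cil : field := current i l; pose ckj : field := current k j.
pose c2 : field := fun r v => k2 *: ckj r v + ckj r v.
pose c : field := fun r v => k1 *: cil r v + c2 r v.
have gil : good_field cil by exact: good_current.
have gkj : good_field ckj by exact: good_current.
have gc2 : good_field c2 by exact: good_lin.
have gc : good_field c by exact: good_lin.
(* The condition removes the central term: two negative modes never add up to 0, and two nonnegative
   ones do so only at s = 0, where the factor s vanishes. *)
have H (s t : int) w : (s%:~R * (s == - t)%:R = 0 :> C) ->
    current i j s (current k l t w) - (-1) ^+ (p && q) *: current k l t (current i j s w)
    = c (s + t) w.
  move=> st; apply: (comm_val w (act_comm C i j s k l t)).
  by rewrite -mulrA st mulr0 raddf0.
have Hn (t u : nat) w : current i j (- t.+1%:Z) (current k l (- u.+1%:Z) w)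
    - (-1) ^+ (p && q) *: current k l (- u.+1%:Z) (current i j (- t.+1%:Z) w)
    = c (- (t + u).+2%:Z) w.
  have -> : - (t + u).+2%:Z = - t.+1%:Z - u.+1%:Z by clear; lia.
  apply: H; have -> : (- t.+1%:Z == - - u.+1%:Z) = false by clear; lia.
  by rewrite mulr0.
have Hp (t u : nat) w : current i j t%:Z (current k l u%:Z w)
    - (-1) ^+ (p && q) *: current k l u%:Z (current i j t%:Z w) = c (t + u)%:Z w.
  rewrite PoszD; apply: H; case: t => [|t]; first by rewrite mulr0z mul0r.
  have -> : (t.+1%:Z == - u%:Z) = false by clear; lia.
  by rewrite mulr0.
have X := nprod_comm (p := p) (q := q) e0 (good_current C i j) (good_current C k l) gc
  (gfield_good F e0) Hn Hp r v.
have Dc : field_deriv c = fun r v => k1 *: field_deriv cil r v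
    + (fun r v => k2 *: field_deriv ckj r v + field_deriv ckj r v) r v.
  by apply/funext => r'; apply/funext => v'; exact: deriv_shuffle.
have E := nprod_linl ((p (+) q) && e0) k1 r v (good_deriv gil)
  (good_lin k2 (good_deriv gkj) (good_deriv gkj)) (gfield_good F e0).
have E' := nprod_linl ((p (+) q) && e0) k2 r v (good_deriv gkj) (good_deriv gkj)
  (gfield_good F e0).
rewrite Dc in X; have {}X := etrans X (etrans E (congr1 _ E')).
transitivity (nprod (p && (q (+) e0)) (current i j)
     (nprod (q && e0) (current k l) (gfield_val F e0)) r v
   - (-1) ^+ (p && q) *: nprod (q && (p (+) e0)) (current k l)
     (nprod (p && e0) (current i j) (gfield_val F e0)) r v).
  have -> : q (+) e0 = e (+) p by rewrite /e0 addbC addbK.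
  have -> : p (+) e0 = e (+) q by rewrite /e0 addbAC addbC addbK.
  rewrite scom_app; apply: etrans (gvalD _ _ _ _ _) _.
  apply: etrans (congr1 (fun z : V => _ - z) (gval_sg _ _ _ _ _)) _.
  apply: (congr2 (fun x y : V => x - (-1) ^+ (p && q) *: y)); first exact: erefl.
  by rewrite [e0]addbAC; exact: erefl.
rewrite X diff_app; apply: esym; apply: etrans (gvalD _ _ _ _ _) _.
apply: etrans (congr2 (fun x y : V => x - y) (gval_nat _ _ _ _ _)
  (etrans (gval_sg _ _ _ _ _) (congr1 (GRing.scale _) (gval_nat _ _ _ _ _)))) _.
apply: esym; apply: etrans (coef_shuffle _ _ _ _ _) _.
apply: (congr2 (fun x y : V => x - (-1) ^+ (p && q) *: y)).
  rewrite /k1; case: (eqVneq k j) => [kj|_]; last by rewrite !scale0r.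
  congr (_ *: _); change (nprod ((p (+) q) && e0) (field_deriv cil) (gfield_val F e0) r v
    = nprod ((par i (+) par l) && (e (+) (par i (+) par l))) (field_deriv cil)
        (gfield_val F (e (+) (par i (+) par l))) r v).
  have -> : p (+) q = par i (+) par l by rewrite /p /q kj addbA addbK.
  by have -> : e0 = e (+) (par i (+) par l) by rewrite /e0 -addbA /p /q kj [_ (+) (_ (+) par l)]addbA addbK.
case: (eqVneq i l) => [il|_]; last by rewrite !scale0r.
congr (_ *: _); change (nprod ((p (+) q) && e0) (field_deriv ckj) (gfield_val F e0) r v
  = nprod ((par k (+) par j) && (e (+) (par k (+) par j))) (field_deriv ckj)
      (gfield_val F (e (+) (par k (+) par j))) r v).
have pq : p (+) q = par k (+) par j.
  by rewrite /p /q il; case: (par l) (par j) (par k) => [] [] [].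
have e0E : e0 = e (+) (par k (+) par j) by rewrite /e0 -addbA pq.
by rewrite pq e0E.
Qed.

(** The Newton recurrences hold for operators on sequences of graded fields; applying equal
    operators to the identity field and adding parity components gives equal coefficients. *)
Lemma sigma_berE (char0 : forall k, k.+1%:R != 0 :> C) k p :
  normal_coef (sigma_expr C m n k) p = normal_coef (ber (Tmat C m n) k) p.
Proof.
have xM : smanin par (map_mx (Weval C m n) (Tmat C m n)).
  have Mn := Topr_manin (@gderiv_gact C m n) gact_comm.
  by rewrite opeval_Tmat => i j k' l; rewrite ![(\matrix_(_, _) _) _ _]mxE; apply: Mn.
have tf := endo_torsion_free (M := nat -> W) char0.
have E := sigma_ber_phi char0 tf xM k.
by apply/funext => r; apply/funext => v; rewrite !normal_coefE E.
Qed.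

End CurrentCommutators.

Theorem corollary3p5 (R : realType) (m n : nat) (mn_gt0 : (0 < m + n)%N) :
  (forall k l : nat, (l <= k)%N -> forall r : int,
     [/\ sugawara_operator (s_coef R[i] m n k l r),
         sugawara_operator (b_coef R[i] m n k l r),
         sugawara_operator (sigma_coef R[i] m n k l r) &
         sugawara_operator (h_coef R[i] m n k l r)]) /\
  (forall k l : nat, (l <= k)%N ->
     sigma_coef R[i] m n k l = b_coef R[i] m n k l).
Proof.
have char0 k : k.+1%:R != 0 :> R[i] by rewrite Num.Theory.pnatr_eq0.
by split=> [k l _ r|k l _]; [exact: sugawara_all | exact: sigma_berE].
Qed.
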